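(* There is an algorithm that, given a maximal outerplanar graph $G$ with $n$ vertices and a non-cutting edge $(u,v)$ of $G$, computes the rooted umbrella depth $ud(G;u,v)$ in $O(n)$ time.
   Context: A maximal outerplanar graph is a simple graph $G$ with $n\ge 3$ vertices having a planar embedding (standard embedding) with all vertices on the outer face forming an $n$-cycle and all interior faces triangles. An edge $(u,v)$ is a cutting edge if $G-\{u,v\}$ is disconnected, non-cutting otherwise. For a cutting edge there are exactly two cut-components: maximal outerplanar subgraphs $G_1,G_2$ with $G_1\cap G_2=\{u,v\}$ and $G_1\cup G_2=G$. The dual tree has a node per interior face of the standard embedding, adjacent iff faces share an edge. An outerplanar path is a maximal outerplanar graph whose dual tree is a path $f_1,\dots,f_k$; it connects edges $e,e'$ if $e$ is incident to $f_1$ and $e'$ to $f_k$ (a triangle connects any two of its edges). An umbrella with cap $(u,v)$ ($(u,v)$ non-cutting in $G$) is a subgraph $U$ with at least 3 vertices that is a union of outerplanar paths $P$ (handle), $F_1,F_2$ (fans, possibly empty) with: (1) $P$ connects $(u,v)$ to some other non-cutting edge of $G$; (2) $F_1$ contains only $u$ and neighbours of $u$, $F_2$ only $v$ and neighbours of $v$; (3) $F_1,F_2$ edge-disjoint, $F_1$ and $P$ share exactly one edge (incident to $u$), $F_2$ and $P$ share exactly one edge (incident to $v$); (4) all neighbours of $u,v$ in $G$ belong to $U$. An anchor-edge of $U$ is an edge of $U$ that is cutting in $G$ but not in $U$; its hanging subgraph is the cut-component of $G$ w.r.t. it not containing $(u,v)$. An umbrella system of $G$ with root-edge $(u,v)$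 consists of an umbrella $U_0$ with cap $(u,v)$, with anchor-edges $(u_i,v_i)$, $i=1,\dots,k$, and for each $i$ an umbrella system of the hanging subgraph $S_i$ with root-edge $(u_i,v_i)$; its depth is $1+\max_i$ of the depths of these systems (max over the empty set $=0$). $ud(G;u,v)$ is the minimum depth of an umbrella system of $G$ with root-edge $(u,v)$. *)

(* Defs.v *)
From mathcomp Require Import all_boot.

Set Implicit Arguments.
Unset Strict Implicit.
Unset Printing Implicit Defensive.

(* A raw graph on a subset of an ambient finite type, so that all the subgraphs
   of a graph live in the same type.  Edges are two-element vertex sets; this is
   enforced by [simple_graph], not by the record. *)
Record graph (T : finType) :=
  Graph { vertices : {set T}; edges : {set {set T}} }.

Section Graphs.

Variable T : finType.
Implicit Types (G H P F U S : graph T) (e : {set T}) (u v x y z : T).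

Definition simple_graph G : bool :=
  [forall e in edges G, (#|e| == 2) && (e \subset vertices G)].

Definition empty_graph : graph T := Graph set0 set0.

Definition graph_union G H : graph T :=
  Graph (vertices G :|: vertices H) (edges G :|: edges H).

Definition subgraph H G : bool :=
  (vertices H \subset vertices G) && (edges H \subset edges G).

Definition adj G : rel T := fun x y => [set x; y] \in edges G.

Definition neighbours G x : {set T} := [set y | adj G x y].

Definition connected G : bool :=
  [forall x in vertices G, forall y in vertices G, connect (adj G) x y].

Definition delete_vertices G (W : {set T}) : graph T :=
  Graph (vertices G :\: W) [set e in edges G | [disjoint e & W]].

Definition cutting G e : bool :=
  (e \in edges G) && ~~ connected (delete_vertices G e).

Definition noncutting G e : bool :=
  (e \in edges G) && connected (delete_vertices G e).

(* Planar embeddings are combinatorial: a rotation system [rho], where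
   [rho x y] is the neighbour of [x] following [y] in the cyclic order around
   [x].  The faces are the orbits on darts of [(x, y) |-> (y, rho y x)], and
   planarity (genus zero) of a connected graph is Euler's formula. *)

Definition darts G : {set T * T} := [set d | adj G d.1 d.2].

Definition rotation_system G (rho : T -> T -> T) : Prop :=
  forall x y z, adj G x y -> adj G x z ->
    adj G x (rho x y) /\ fconnect (rho x) y z.

Definition face_step (rho : T -> T -> T) (d : T * T) : T * T :=
  (d.2, rho d.2 d.1).

Definition faces G rho : {set {set T * T}} :=
  [set [set d' | fconnect (face_step rho) d d'] | d in darts G].

Definition face_edges (f : {set T * T}) : {set {set T}} :=
  [set [set d.1; d.2] | d in f].

Definition planar_embedding G rho : Prop :=
  [/\ connected G,
      rotation_system G rho
    & #|vertices G| + #|faces G rho| = #|edges G| + 2].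

(* The outer face [o] has as many darts as [G] has vertices and meets every
   vertex, i.e., its boundary walk is an n-cycle through all the vertices. *)
Definition standard_embedding G rho (o : {set T * T}) : Prop :=
  [/\ planar_embedding G rho,
      o \in faces G rho,
      #|o| = #|vertices G|,
      [set d.1 | d in o] = vertices G
    & forall f, f \in faces G rho :\ o -> #|f| = 3].

Definition maximal_outerplanar G : Prop :=
  [/\ simple_graph G, 3 <= #|vertices G|
    & exists rho o, standard_embedding G rho o].

Definition share_edge (f g : {set T * T}) : bool :=
  face_edges f :&: face_edges g != set0.

(* [fs] lists the nodes of the dual tree, which is a path in that order. *)
Definition dual_path G rho (o : {set T * T}) (fs : seq {set T * T}) : Prop :=
  [/\ uniq fs, fs =i faces G rho :\ o
    & forall i j, i < j < size fs ->
        share_edge (nth set0 fs i) (nth set0 fs j) = (j == i.+1)].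

Definition outerplanar_path P : Prop :=
  maximal_outerplanar P /\
  exists rho o fs, standard_embedding P rho o /\ dual_path P rho o fs.

Definition outerplanar_path_connecting P e e' : Prop :=
  maximal_outerplanar P /\
  exists rho o f fs,
    [/\ standard_embedding P rho o, dual_path P rho o (f :: fs),
        e \in face_edges f & e' \in face_edges (last f fs)].

Definition handle G u v P : Prop :=
  subgraph P G /\
  exists e', [/\ noncutting G e', e' != [set u; v]
               & outerplanar_path_connecting P [set u; v] e'].

Definition fan G P x F : Prop :=
  F = empty_graph \/
  [/\ subgraph F G, outerplanar_path F,
      vertices F \subset x |: neighbours G x
    & exists e, edges F :&: edges P = [set e] /\ x \in e].

Definition umbrella G u v U : Prop :=
  [/\ noncutting G [set u; v],
      3 <= #|vertices U|,
      exists P F1 F2,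
        [/\ U = graph_union P (graph_union F1 F2),
            handle G u v P, fan G P u F1, fan G P v F2
          & [disjoint edges F1 & edges F2]]
    & neighbours G u :|: neighbours G v \subset vertices U].

Definition anchor_edges G U : {set {set T}} :=
  [set e in edges U | cutting G e && ~~ cutting U e].

Definition cut_components G e S S' : Prop :=
  [/\ maximal_outerplanar S, maximal_outerplanar S',
      vertices S :&: vertices S' = e /\ edges S :&: edges S' = [set e]
    & graph_union S S' = G].

Definition hanging_subgraph G u v e S : Prop :=
  [set u; v] \notin edges S /\ exists S', cut_components G e S S'.

(* [umbrella_system G u v d]: [G] has an umbrella system of depth [d] with
   root-edge (u, v).  For an anchor-edge [e] = (a e, b e), its hanging subgraph
   is [S e], and [k e] is the depth of the umbrella system chosen for [S e]. *)
Inductive umbrella_system : graph T -> T -> T -> nat -> Prop :=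
| UmbrellaSystem G u v U (S : {set T} -> graph T) (a b : {set T} -> T)
    (k : {set T} -> nat) of
    umbrella G u v U &
    (forall e, e \in anchor_edges G U -> e = [set a e; b e]) &
    (forall e, e \in anchor_edges G U -> hanging_subgraph G u v e (S e)) &
    (forall e, e \in anchor_edges G U ->
       umbrella_system (S e) (a e) (b e) (k e)) :
  umbrella_system G u v (1 + \max_(e in anchor_edges G U) k e).

(* ud(G; u, v) = d; the minimum is asserted to be attained. *)
Definition rooted_umbrella_depth G u v (d : nat) : Prop :=
  umbrella_system G u v d /\ forall d', umbrella_system G u v d' -> d <= d'.

End Graphs.

(* Random access machine, as a while-language over finitely many (per program)
   integer registers and zero-initialised, randomly accessible integer arrays.
   Unit cost is charged per operation.  Executions are relative to a bound [W]
   on machine words: a command storing a number above [W], or writing at an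
   address above [W], has no execution. *)

Inductive expr :=
| Const of nat
| Reg of nat
| Get of nat & expr
| Add of expr & expr
| Sub of expr & expr.

(* [If] and [While] interpret a nonzero value as true. *)
Inductive cmd :=
| Skip
| Assign of nat & expr
| Put of nat & expr & expr
| Seq of cmd & cmd
| If of expr & cmd & cmd
| While of expr & cmd.

Record state := State { reg : nat -> nat; arr : nat -> nat -> nat }.

Fixpoint eval (s : state) (e : expr) : nat :=
  match e with
  | Const k => k
  | Reg r => reg s r
  | Get a i => arr s a (eval s i)
  | Add e1 e2 => eval s e1 + eval s e2
  | Sub e1 e2 => eval s e1 - eval s e2
  end.

Fixpoint cost (e : expr) : nat :=
  match e with
  | Const _ | Reg _ => 1
  | Get _ i => (cost i).+1
  | Add e1 e2 | Sub e1 e2 => (cost e1 + cost e2).+1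
  end.

Definition set_reg (s : state) (r k : nat) : state :=
  State (fun r' => if r' == r then k else reg s r') (arr s).

Definition set_arr (s : state) (a i k : nat) : state :=
  State (reg s)
    (fun a' i' => if (a' == a) && (i' == i) then k else arr s a' i').

(* [exec W c s t s']: with words bounded by [W], [c] started in [s] halts in
   [s'] after exactly [t] time units. *)
Inductive exec (W : nat) : cmd -> state -> nat -> state -> Prop :=
| ExecSkip s : exec W Skip s 1 s
| ExecAssign s r e of eval s e <= W :
    exec W (Assign r e) s (1 + cost e) (set_reg s r (eval s e))
| ExecPut s a i e of eval s i <= W & eval s e <= W :
    exec W (Put a i e) s (1 + cost i + cost e)
      (set_arr s a (eval s i) (eval s e))
| ExecSeq c1 c2 s t1 s1 t2 s2 of exec W c1 s t1 s1 & exec W c2 s1 t2 s2 :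
    exec W (Seq c1 c2) s (t1 + t2) s2
| ExecIfTrue e c1 c2 s t s' of eval s e != 0 & exec W c1 s t s' :
    exec W (If e c1 c2) s (1 + cost e + t) s'
| ExecIfFalse e c1 c2 s t s' of eval s e = 0 & exec W c2 s t s' :
    exec W (If e c1 c2) s (1 + cost e + t) s'
| ExecWhileDone e c s of eval s e = 0 :
    exec W (While e c) s (1 + cost e) s
| ExecWhileStep e c s t1 s1 t2 s2 of
    eval s e != 0 & exec W c s t1 s1 & exec W (While e c) s1 t2 s2 :
    exec W (While e c) s (1 + cost e + t1 + t2) s2.

(* The neighbours of each vertex are listed in an arbitrary order. *)
Definition adjacency_lists n (G : graph 'I_n) (L : 'I_n -> seq 'I_n) : Prop :=
  forall x, perm_eq (L x) (enum (neighbours G x)).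

(* Input: n, u, v in registers 0, 1, 2; the concatenated adjacency lists in
   array 1, the list of vertex x occupying the positions from (array 0)[x]
   up to (array 0)[x + 1] excluded. *)
Definition input_state n (L : 'I_n -> seq 'I_n) (u v : 'I_n) : state :=
  let lists := [seq map val (L x) | x <- enum 'I_n] in
  State
    (nth 0 [:: n; val u; val v])
    (fun a => match a with
              | 0 => nth 0 [seq sumn (take i (shape lists)) | i <- iota 0 n.+1]
              | 1 => nth 0 (flatten lists)
              | _ => fun=> 0
              end).

(* The output is read in register 0. *)
Definition output (s : state) : nat := reg s 0.

(* Main.v *)
(* A maximal outerplanar graph with a non-cutting edge (u, v) is a triangulated
   polygon, described by a binary tree of triangles rooted at (u, v).  Number the
   vertices along the outer cycle from u to v and count the descents of the
   darts: every edge has one, the outer face has one, and a triangle has one or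
   two; by Euler's formula all triangles must have exactly two, so the apex of
   the triangle on an edge (x, y) lies between x and y, which gives the tree.

   A subgraph of a maximal outerplanar graph has at most 2n - 3 edges, with
   equality for the maximal outerplanar ones.  Counting edges therefore shows that
   an umbrella is a subtree containing the root: a path of triangles out of the
   root, and all the triangles at u and v.  The rooted umbrella depth is then
   given by a recursion over the tree, with six numbers per edge: the optimum over
   umbrellas, over paths, and over fans at either end with or without a path.

   The machine eliminates vertices of degree 2 other than u and v, kept on a
   stack.  When w is eliminated, its two remaining neighbours x and y are the feet
   of its triangle, and the parts beyond the edges wx and wy are headed by those
   neighbours of w that were themselves eliminated with feet {w, x} and {w, y}; so
   two scans of the adjacency list of w suffice to evaluate the recursion. *)
Require Import Defs.
From mathcomp Require Import all_boot.
From mathcomp Require Import zify.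

Set Implicit Arguments.
Unset Strict Implicit.
Unset Printing Implicit Defensive.

(** Every edge of a polygon except its base is a leg of a triangle, its other end being less deep in
    the tree than the apex, and each apex has just two legs to its feet. This orientation gives the
    edge bound for subgraphs; equality in it says that a subgraph contains with each apex both its
    feet and both legs, hence is closed towards the root. The definition of an umbrella restricts
    only the shared edges, so its pieces might overlap in further vertices; this is what the
    counting excludes. The lower bound on the depth uses that the umbrella lies within the handle
    and the two full fans: taking in more triangles never makes the hanging parts worse. This
    monotonicity has to be derived from the recursion itself, by comparing [ud] of a polygon with
    [ud] of its parts. The orientation of an embedding is not prescribed, nor is the order of the
    two ends of an anchor-edge, and the machine meets the feet of a vertex in arbitrary order.
    Reflection of trees absorbs these choices. *)

(* The part of a triangulated polygon beyond one of its edges (a, b): either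
   (a, b) is an outer edge, or there is a triangle with apex [w] on it, and [l]
   and [r] are the parts beyond (a, w) and (w, b). *)
Inductive tree (T : Type) := Leaf | Node (w : T) (l r : tree T).
Arguments Leaf {T}.

(** * Triangulated polygons as trees *)

Section Trees.

Variable T : finType.
Implicit Types (t s l r h : tree T) (a b c u v w x y z : T) (e : {set T}).

Lemma set2_eqP a b c d :
  [set a; b] = [set c; d] -> (a = c /\ b = d) \/ (a = d /\ b = c).
Proof.
move=> E.
have /set2P Ha: a \in [set c; d] by rewrite -E set21.
have /set2P Hb: b \in [set c; d] by rewrite -E set22.
have /set2P Hc: c \in [set a; b] by rewrite E set21.
have /set2P Hd: d \in [set a; b] by rewrite E set22.
by case: Ha Hb Hc Hd => -> [] -> [] ? [] ?; subst; auto.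
Qed.

Fixpoint inner t : seq T :=
  if t is Node w l r then inner l ++ w :: inner r else [::].

Definition outer t a b := a :: rcons (inner t) b.

Fixpoint tedges t a b : {set {set T}} :=
  if t is Node w l r
  then [set a; b] |: (tedges l a w :|: tedges r w b)
  else [set [set a; b]].

Definition tgraph t a b : graph T := Graph [set x in outer t a b] (tedges t a b).

Definition wf t a b := uniq (outer t a b).

(* [located t a b s x y]: in the triangulated polygon of [t] with base (a, b),
   the subtree [s] is the part beyond the edge (x, y). *)
Inductive located : tree T -> T -> T -> tree T -> T -> T -> Prop :=
| LocHere t a b : located t a b t a b
| LocLeft w l r a b s x y of located l a w s x y :
    located (Node w l r) a b s x y
| LocRight w l r a b s x y of located r w b s x y :
    located (Node w l r) a b s x y.

Lemma mem_outer t a b x :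
  (x \in outer t a b) = [|| x == a, x == b | x \in inner t].
Proof. by rewrite inE mem_rcons inE. Qed.

Lemma outer_node w l r a b : outer (Node w l r) a b = (a :: inner l) ++ outer r w b.
Proof. by rewrite /outer /= rcons_cat. Qed.

Lemma outer_nodeE w l r a b x :
  (x \in outer (Node w l r) a b) = (x \in outer l a w) || (x \in outer r w b).
Proof.
by rewrite !mem_outer /= mem_cat inE; do !case: (_ == _); do !case: (_ \in _).
Qed.

Lemma wf_left w l r a b : wf (Node w l r) a b -> wf l a w.
Proof.
rewrite /wf outer_node /outer -cat_rcons -rcons_cons cat_uniq.
by case/andP.
Qed.

Lemma wf_right w l r a b : wf (Node w l r) a b -> wf r w b.
Proof. by rewrite /wf outer_node cat_uniq => /and3P[]. Qed.

Lemma wf_disj w l r a b x : wf (Node w l r) a b ->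
  x \in outer l a w -> x \in outer r w b -> x = w.
Proof.
rewrite /wf outer_node cat_uniq => /and3P[_ /hasPn H _] Hl Hr.
move: (H _ Hr) Hl; rewrite mem_outer /= inE.
by case: (x == a) => //=; case: (x \in _) => //; rewrite orbF => _ /eqP.
Qed.

Lemma wf_neq t a b : wf t a b -> a != b.
Proof.
by rewrite /wf /outer /= mem_rcons inE negb_or => /andP[/andP[]].
Qed.

Lemma wf_inner t a b : wf t a b -> (a \notin inner t) && (b \notin inner t).
Proof.
rewrite /wf /outer /= mem_rcons inE negb_or rcons_uniq.
by move/andP=> [/andP[_ ->] /andP[-> _]].
Qed.

Lemma wf_in_neq t a b x : wf t a b -> x \in inner t -> (x != a) && (x != b).
Proof.
move=> /wf_inner/andP[Ha Hb] Hx; apply/andP; split; apply/eqP => E; subst.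
  by rewrite Hx in Ha.
by rewrite Hx in Hb.
Qed.

Lemma wf_node w l r a b : wf (Node w l r) a b ->
  [/\ w != a, w != b, w \notin inner l & w \notin inner r].
Proof.
move=> H; split.
- by rewrite eq_sym (wf_neq (wf_left H)).
- by rewrite (wf_neq (wf_right H)).
- by case/andP: (wf_inner (wf_left H)).
- by case/andP: (wf_inner (wf_right H)).
Qed.

Lemma wf_left_notin w l r a b : wf (Node w l r) a b ->
  (b \notin outer l a w) && (a \notin outer r w b).
Proof.
move=> H; have [wa wb _ _] := wf_node H; apply/andP; split; apply/negP => Hx.
  have := wf_disj H Hx; rewrite mem_outer eqxx orbT => /(_ isT) E.
  by rewrite E eqxx in wb.
have := wf_disj H _ Hx; rewrite mem_outer eqxx => /(_ isT) E.
by rewrite E eqxx in wa.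
Qed.

Lemma wf_inner_disj w l r a b x : wf (Node w l r) a b ->
  x \in inner l -> x \in outer r w b -> False.
Proof.
move=> H Hl Hr; have E : x = w by apply: wf_disj H _ Hr; rewrite mem_outer Hl !orbT.
by case: (wf_node H) => _ _ /negP[]; rewrite -E.
Qed.

Lemma wf_inner_disjr w l r a b x : wf (Node w l r) a b ->
  x \in inner r -> x \in outer l a w -> False.
Proof.
move=> H Hr Hl; have E : x = w by apply: wf_disj H Hl _; rewrite mem_outer Hr !orbT.
by case: (wf_node H) => _ _ _ /negP[]; rewrite -E.
Qed.

Lemma tedges_base t a b : [set a; b] \in tedges t a b.
Proof. by case: t => [|w l r] /=; rewrite !inE eqxx. Qed.

Lemma tedges_node w l r a b e :
  (e \in tedges (Node w l r) a b) =
  [|| e == [set a; b], e \in tedges l a w | e \in tedges r w b].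
Proof. by rewrite /= !inE. Qed.

Lemma located_wf t a b s x y : located t a b s x y -> wf t a b -> wf s x y.
Proof.
elim=> [//|w l r {}a {}b {}s {}x {}y _ IH|w l r {}a {}b {}s {}x {}y _ IH] H.
  exact: IH (wf_left H).
exact: IH (wf_right H).
Qed.

Lemma located_edges t a b s x y : located t a b s x y ->
  tedges s x y \subset tedges t a b.
Proof.
elim=> [? ? ?|w l r {}a {}b {}s {}x {}y _ /subsetP IH|w l r {}a {}b {}s {}x {}y _ /subsetP IH];
  apply/subsetP => e //; by rewrite tedges_node => /IH ->; rewrite !orbT.
Qed.

Lemma located_inner t a b s x y : located t a b s x y ->
  {subset inner s <= inner t}.
Proof.
elim=> [? ? ? z //|w l r {}a {}b {}s {}x {}y _ IH z|w l r {}a {}b {}s {}x {}y _ IH z];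
  by move=> /IH /= Hz; rewrite mem_cat inE Hz ?orbT.
Qed.

Lemma located_outer t a b s x y : located t a b s x y ->
  {subset outer s x y <= outer t a b}.
Proof.
elim=> [? ? ? z //|w l r {}a {}b {}s {}x {}y _ IH z|w l r {}a {}b {}s {}x {}y _ IH z];
  by rewrite outer_nodeE => /IH ->; rewrite ?orbT.
Qed.

Lemma located_trans t a b s x y s' x' y' : located t a b s x y ->
  located s x y s' x' y' -> located t a b s' x' y'.
Proof. by elim=> //; constructor; auto. Qed.

Lemma tedgesP t a b e :
  reflect (exists s x y, located t a b s x y /\ e = [set x; y]) (e \in tedges t a b).
Proof.
apply: (iffP idP) => [|[s [x [y [H ->]]]]]; last first.
  exact: (subsetP (located_edges H)) (tedges_base s x y).
elim: t a b => [|w l IHl r IHr] a b.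
  by rewrite /= inE => /eqP ->; exists Leaf, a, b; split=> //; constructor.
rewrite tedges_node => /or3P[/eqP->|/IHl|/IHr].
- by exists (Node w l r), a, b; split=> //; constructor.
- by move=> [s [x [y [H ->]]]]; exists s, x, y; split=> //; constructor.
- by move=> [s [x [y [H ->]]]]; exists s, x, y; split=> //; constructor.
Qed.

Lemma located_ends t a b s x y : located t a b s x y ->
  (x \in outer t a b) && (y \in outer t a b).
Proof.
by move=> /located_outer H; rewrite !H // mem_outer eqxx ?orbT.
Qed.

Lemma tedges_outer t a b e x : e \in tedges t a b -> x \in e -> x \in outer t a b.
Proof.
case/tedgesP=> [s [y [z [H ->]]]]; case/andP: (located_ends H) => Hy Hz.
by rewrite !inE => /orP[] /eqP->.
Qed.

Lemma tedges_card t a b e : wf t a b -> e \in tedges t a b -> #|e| = 2.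
Proof.
move=> W /tedgesP[s [y [z [H ->]]]].
by rewrite cards2 (wf_neq (located_wf H W)).
Qed.

Lemma tgraph_simple t a b : wf t a b -> simple_graph (tgraph t a b).
Proof.
move=> W; apply/forallP => e; apply/implyP => /= He.
rewrite (tedges_card W He) eqxx /=; apply/subsetP => x.
by rewrite inE => /(tedges_outer He).
Qed.

Lemma inner_located t a b w : w \in inner t ->
  exists l r x y, located t a b (Node w l r) x y.
Proof.
elim: t a b => //= c l IHl r IHr a b; rewrite mem_cat inE => /or3P[/(IHl a c)|/eqP->|/(IHr c b)].
- by move=> [l' [r' [x [y H]]]]; exists l', r', x, y; constructor.
- by exists l, r, a, b; constructor.
- by move=> [l' [r' [x [y H]]]]; exists l', r', x, y; constructor.
Qed.

(** With two ends and [size (inner t)] apexes this is the count [2n - 3]: each apex adds two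
    legs. *)
Lemma card_tedges t a b : wf t a b -> #|tedges t a b| = (size (inner t)).*2.+1.
Proof.
elim: t a b => [|w l IHl r IHr] a b W /=; first by rewrite cards1.
have [Wl Wr] := (wf_left W, wf_right W).
have abl : [set a; b] \notin tedges l a w :|: tedges r w b.
  rewrite inE; case/andP: (wf_left_notin W) => Hb Ha; apply/negP => /orP[] H.
    by case/negP: Hb; apply: tedges_outer H _; rewrite set22.
  by case/negP: Ha; apply: tedges_outer H _; rewrite set21.
have lr0 : tedges l a w :&: tedges r w b = set0.
  apply/setP => e; rewrite !inE; apply/negP => /andP[Hl Hr].
  have : e \subset [set w].
    apply/subsetP => x xe; rewrite inE; apply/eqP.
    exact: wf_disj W (tedges_outer Hl xe) (tedges_outer Hr xe).
  by move/subset_leq_card; rewrite cards1 (tedges_card Wl Hl).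
rewrite cardsU1 abl cardsU lr0 cards0 IHl // IHr // size_cat /=; lia.
Qed.

(** [t'] is [t] with [s] replaced by a leaf, so that (x, y) becomes an outer edge. The last clause
    singles out the case where nothing remains of [t]. *)
Lemma located_split t a b s x y : located t a b s x y ->
  exists t', [/\ perm_eq (inner t) (inner t' ++ inner s),
    tedges t a b = tedges t' a b :|: tedges s x y,
    located t' a b Leaf x y & t' = Leaf -> t = s /\ a = x /\ b = y].
Proof.
elim=> [{}t {}a {}b|w l r {}a {}b {}s {}x {}y _ [t' [P E L _]]
  |w l r {}a {}b {}s {}x {}y _ [t' [P E L _]]].
- exists Leaf; split=> //; last by constructor.
  by apply/setP => e; rewrite !inE; case: eqP => [->|]; rewrite ?tedges_base.
- exists (Node w t' r); split=> //; last by constructor.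
    rewrite /= perm_sym perm_catAC perm_sym; exact: perm_cat.
  by rewrite /= E -!setUA; congr (_ :|: (_ :|: _)); rewrite setUC.
- exists (Node w l t'); split=> //; last by constructor.
    by rewrite /= -catA perm_cat2l /= perm_cons.
  by rewrite /= E !setUA.
Qed.

Lemma split_perm t t' s a b :
  perm_eq (inner t) (inner t' ++ inner s) ->
  perm_eq (outer t a b) (outer t' a b ++ inner s).
Proof.
move=> P; rewrite /outer /= perm_cons -!cats1 perm_sym perm_catAC.
by rewrite perm_cat2r perm_sym.
Qed.

Lemma split_wf t t' s a b : wf t a b ->
  perm_eq (inner t) (inner t' ++ inner s) ->
  wf t' a b /\ {in outer t' a b, forall z, z \notin inner s}.
Proof.
move=> W /(split_perm a b) P; move: W.
rewrite /wf (perm_uniq P) cat_uniq => /and3P[-> /hasPn H _]; split=> //.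
by move=> z zt; apply/negP => /H /=; rewrite zt.
Qed.

Lemma located_sep t a b s x y e : wf t a b -> located t a b s x y ->
  e \in tedges t a b ->
  e \in tedges s x y \/ {in e, forall z, z \notin inner s}.
Proof.
move=> W /located_split [t' [P E L _]]; rewrite E inE => /orP[] H; last by left.
right=> z ze; have [_] := split_wf W P; apply; exact: tedges_outer H ze.
Qed.

(** * Triangles of a polygon and the depth of their apexes *)

(** Depth of the triangle with apex [z], and 0 for the ends of the base. It orients the edges, since
    feet have smaller rank than their apex. *)
Fixpoint rank t z : nat :=
  if t is Node w l r then
    if z == w then 1 else
    if z \in inner l then (rank l z).+1 else
    if z \in inner r then (rank r z).+1 else 0
  else 0.

Lemma rank_gt0 t z : (0 < rank t z) = (z \in inner t).
Proof.
case: t => //= w l r; rewrite mem_cat inE.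
by case: ifP => [_|_]; last case: ifP => //= _; rewrite ?orbT //; case: ifP.
Qed.

Lemma rank_eq0 t z : z \notin inner t -> rank t z = 0.
Proof. by rewrite -rank_gt0 lt0n negbK => /eqP. Qed.

(** Here [w] is any apex, with feet [a] and [b]; it has degree 2 only once the parts beyond (a, w)
    and (w, b) are gone. *)
Definition ear t u v w a b := exists l r, located t u v (Node w l r) a b.

Lemma rank_ear t u v w a b : wf t u v -> ear t u v w a b ->
  rank t a < rank t w /\ rank t b < rank t w.
Proof.
move=> W [l [r H]].
move Es: (Node w l r) H => s H; elim: H W Es => {t u v s a b}.
- move=> t a b W Es; subst.
  by case/andP: (wf_inner W) => Ha Hb; rewrite (rank_eq0 Ha) (rank_eq0 Hb) /= eqxx.
- move=> c l0 r0 a b s x y H IH W Es; have [Hx Hy] := IH (wf_left W) Es.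
  have Hw : w \in inner l0.
    by apply: (located_inner H); rewrite -Es /= mem_cat inE eqxx orbT.
  have Rw : rank (Node c l0 r0) w = (rank l0 w).+1.
    rewrite /= Hw; case: eqP => // E; case: (wf_node W) => _ _; rewrite -E Hw //.
  rewrite Rw; case/andP: (located_ends H) => Ox Oy.
  suff K z : z \in outer l0 a c -> rank l0 z < rank l0 w ->
    rank (Node c l0 r0) z < (rank l0 w).+1 by split; apply: K.
  move=> zO Hz /=; case: ifP => _; first by rewrite ltnS rank_gt0.
  case: ifP => // zl; case: ifP => // zr.
  by case: (wf_inner_disjr W zr zO).
- move=> c l0 r0 a b s x y H IH W Es; have [Hx Hy] := IH (wf_right W) Es.
  have Hw : w \in inner r0.
    by apply: (located_inner H); rewrite -Es /= mem_cat inE eqxx orbT.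
  have Rw : rank (Node c l0 r0) w = (rank r0 w).+1.
    rewrite /= Hw; case: eqP => [E|_]; first by case: (wf_node W) => _ _ _; rewrite -E Hw.
    by case: ifP => // wl; case: (wf_inner_disj W wl); rewrite mem_outer Hw !orbT.
  rewrite Rw; case/andP: (located_ends H) => Ox Oy.
  suff K z : z \in outer r0 c b -> rank r0 z < rank r0 w ->
    rank (Node c l0 r0) z < (rank r0 w).+1 by split; apply: K.
  move=> zO Hz /=; case: ifP => _; first by rewrite ltnS rank_gt0.
  case: ifP => // zl; first by case: (wf_inner_disj W zl zO).
  by case: ifP.
Qed.

Lemma located_node_inner t u v w l r a b :
  located t u v (Node w l r) a b -> w \in inner t.
Proof. by move/located_inner; apply; rewrite /= mem_cat inE eqxx orbT. Qed.

Lemma ear_inner t u v w a b : ear t u v w a b -> w \in inner t.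
Proof.
by move=> [l [r /located_node_inner]]. Qed.

Lemma earP t u v w : w \in inner t -> exists a b, ear t u v w a b.
Proof.
by case/(inner_located u v) => l [r [x [y H]]]; exists x, y, l, r.
Qed.

Lemma located_unique t u v w l r a b l' r' a' b' : wf t u v ->
  located t u v (Node w l r) a b -> located t u v (Node w l' r') a' b' ->
  [/\ l = l', r = r', a = a' & b = b'].
Proof.
elim: t u v => [|c l0 IHl r0 IHr] u v W H1 H2; first by inversion H1.
have D x : x \in inner l0 -> x \in inner r0 -> False.
  by move=> xl xr; apply: (wf_inner_disj W xl); rewrite mem_outer xr !orbT.
case: (wf_node W) => _ _ /negP cl /negP cr.
have [Wl Wr] := (wf_left W, wf_right W).
inversion H1; subst; inversion H2; subst; try by [
  | apply: IHl Wl _ _ | apply: IHr Wr _ _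
  | case: cl; apply: located_node_inner; eassumption
  | case: cr; apply: located_node_inner; eassumption
  | case: (D w); apply: located_node_inner; eassumption].
Qed.

Lemma ear_unique t u v w a b a' b' : wf t u v ->
  ear t u v w a b -> ear t u v w a' b' -> a = a' /\ b = b'.
Proof.
move=> W [l [r H]] [l' [r' H']].
by case: (located_unique W H H').
Qed.

Lemma ear_edges t u v w a b : ear t u v w a b ->
  [/\ [set a; b] \in tedges t u v, [set a; w] \in tedges t u v
    & [set w; b] \in tedges t u v].
Proof.
move=> [l [r H]]; split; apply: (subsetP (located_edges H)); rewrite tedges_node.
- by rewrite eqxx.
- by rewrite tedges_base orbT.
- by rewrite tedges_base !orbT.
Qed.

(** Charging each edge other than the base to the apex of which it is a leg charges every apex
    twice; this is the origin of the edge bound for subgraphs. *)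
Lemma tedges_ear t u v e : e \in tedges t u v ->
  e = [set u; v] \/
  exists w a b, ear t u v w a b /\ (e = [set a; w] \/ e = [set w; b]).
Proof.
elim: t u v => [|w l IHl r IHr] u v; first by rewrite inE => /eqP; left.
rewrite tedges_node => /or3P[/eqP|/IHl[->|]|/IHr[->|]].
- by left.
- by right; exists w, u, v; split; [exists l, r; constructor|left].
- move=> [c [a [b [[l' [r' H]] E]]]]; right; exists c, a, b; split=> //.
  by exists l', r'; constructor.
- by right; exists w, u, v; split; [exists l, r; constructor|right].
- move=> [c [a [b [[l' [r' H]] E]]]]; right; exists c, a, b; split=> //.
  by exists l', r'; constructor.
Qed.

Lemma ear_neq t u v w a b : wf t u v -> ear t u v w a b ->
  [/\ a != b, w != a, w != b, w != u & w != v].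
Proof.
move=> W H; case/andP: (wf_in_neq W (ear_inner H)) => -> ->.
by case: H => l [r /located_wf/(_ W) W']; case: (wf_node W'); rewrite (wf_neq W') => -> ->.
Qed.

Lemma ear_outer t u v w a b : ear t u v w a b ->
  [/\ a \in outer t u v, b \in outer t u v & w \in outer t u v].
Proof.
move=> H; have := ear_inner H; rewrite (mem_outer t u v w) => ->; rewrite !orbT.
by case: H => l [r /located_ends/andP[-> ->]].
Qed.

Lemma adj_rank t u v x y : wf t u v -> [set x; y] \in tedges t u v ->
  rank t y <= rank t x -> x \in inner t ->
  exists a b, ear t u v x a b /\ (y = a \/ y = b).
Proof.
move=> W /tedges_ear[/set2_eqP E|[w [a [b [H E]]]]] R xt.
  by case/andP: (wf_in_neq W xt); case: E => [[-> _]|[-> _]]; rewrite eqxx.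
have [Ra Rb] := rank_ear W H.
case: E => /set2_eqP[] [? ?]; subst; try lia;
 by exists a, b; split; auto.
Qed.

(** Of three mutually adjacent vertices, the one of largest rank is not an end of the base, and its
    neighbours of no larger rank are its feet. *)
Lemma clique_ear t u v x y z : wf t u v ->
  [set x; y] \in tedges t u v -> [set y; z] \in tedges t u v ->
  [set z; x] \in tedges t u v -> 
  exists w a b, ear t u v w a b /\ [set x; y; z] = [set a; b; w].
Proof.
move=> W.
have N p q : [set p; q] \in tedges t u v -> p != q.
  by move/(tedges_card W); rewrite cards2; case: (p != q).
wlog H : x y z / rank t y <= rank t x /\ rank t z <= rank t x.
  move=> K xy yz zx; have rot p q i : [set p; q; i] = [set q; i; p] by rewrite -setUA setUC.
  have [R1|R1] := leqP (rank t y) (rank t x); have [R2|R2] := leqP (rank t z) (rank t x).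
  - exact: K.
  - by rewrite -rot; apply: K => //; split; lia.
  - by rewrite rot; apply: K => //; split; lia.
  - have [R3|R3] := leqP (rank t z) (rank t y).
      by rewrite rot; apply: K => //; split; lia.
    by rewrite -rot; apply: K => //; split; lia.
move=> xy yz zx; case: H => Hy Hz.
have xt : x \in inner t.
  rewrite -rank_gt0; case: (posnP (rank t x)) => // R0.
  have K p : rank t p <= rank t x -> p \in outer t u v -> p = u \/ p = v.
    rewrite mem_outer -rank_gt0 R0 leqn0 => /eqP->; rewrite orbF.
    by case/orP => /eqP; auto.
  have Ox : x \in outer t u v by apply: tedges_outer xy _; rewrite set21.
  have Oy : y \in outer t u v by apply: tedges_outer xy _; rewrite set22.
  have Oz : z \in outer t u v by apply: tedges_outer zx _; rewrite set21.
  move: (N _ _ xy) (N _ _ yz) (N _ _ zx).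
  case: (K x _ Ox) => // ->; case: (K y _ Oy) => // ->; case: (K z _ Oz) => // ->;
  by rewrite ?eqxx.
have [a [b [E1 F1]]] := adj_rank W xy Hy xt.
have zx' : [set x; z] \in tedges t u v by rewrite setUC.
have [a' [b' [E2 F2]]] := adj_rank W zx' Hz xt.
have [? ?] := ear_unique W E1 E2; subst a' b'.
exists x, a, b; split=> //.
have := N _ _ yz.
by case: F1 F2 => -> [] ->; rewrite ?eqxx // => _;
  apply/setP => p; rewrite !inE; do !case: (_ == _).
Qed.

(** * Cutting and non-cutting edges of a triangulated polygon *)

Implicit Types (G : graph T) (W : {set T}).

Lemma adj_sym G : symmetric (adj G).
Proof. by move=> x y; rewrite /adj setUC. Qed.

Lemma adj_delete G W x y :
  adj (delete_vertices G W) x y = [&& adj G x y, x \notin W & y \notin W].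
Proof.
rewrite /adj inE; congr (_ && _).
by rewrite disjoints_subset subUset !sub1set !inE.
Qed.

Lemma mem_delete t u v W c :
  (c \in vertices (delete_vertices (tgraph t u v) W)) =
  (c \notin W) && (c \in outer t u v).
Proof. by rewrite in_setD inE. Qed.

Lemma connect_path G W x p y z : path (adj G) x p ->
  {in x :: p, forall c, c \notin W} -> y \in x :: p -> z \in x :: p ->
  connect (adj (delete_vertices G W)) y z.
Proof.
move=> H N Hy Hz.
have H' : path (adj (delete_vertices G W)) x p.
  apply: (sub_in_path (P := [pred c | c \notin W])) H.
    by move=> c d; rewrite !inE adj_delete => -> -> ->.
  by apply/allP => c /N.
apply: (connect_trans (y := x)); last exact: path_connect H' _ Hz.
by rewrite (sym_connect_sym (adj_sym _)); apply: path_connect H' _ Hy.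
Qed.

(** Deleting two consecutive vertices of a Hamiltonian cycle leaves a path. *)
Lemma cycle_noncutting G x y q : cycle (adj G) [:: x, y & q] ->
  uniq [:: x, y & q] -> vertices G =i [:: x, y & q] ->
  noncutting G [set x; y].
Proof.
move=> /= /andP[Hxy Hp] U E; apply/andP; split=> //.
apply/forallP => c; apply/implyP => Hc; apply/forallP => d; apply/implyP => Hd.
have K z : z \in vertices (delete_vertices G [set x; y]) -> z \in q.
  by rewrite /= !inE E !inE negb_or => /andP[/andP[/negPf-> /negPf->]].
move: {Hc Hd}(K _ Hc) (K _ Hd); case: q Hp U {E K} => //= z q /andP[_].
rewrite rcons_path => /andP[Hp _] U.
apply: connect_path Hp _ => i Hi; rewrite !inE; apply/negP => /orP[] /eqP ?; subst.
  by case/andP: U => /negP[]; rewrite inE Hi orbT.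
by case/and3P: U => _ /negP[].
Qed.

Lemma outer_path_leaf (e : rel T) t u v :
  (forall x y, located t u v Leaf x y -> e x y) -> path e u (rcons (inner t) v).
Proof.
elim: t u v => [|w l IHl r IHr] u v H; first by rewrite /= H //; constructor.
rewrite [rcons _ _]/= -cat_rcons rcons_cat cat_path last_rcons IHl ?IHr //;
  by move=> x y L; apply: H; constructor.
Qed.

Lemma outer_path t u v : path (adj (tgraph t u v)) u (rcons (inner t) v).
Proof.
apply: outer_path_leaf => x y /located_edges/subsetP; apply; exact: tedges_base.
Qed.

Lemma outer_cycle t u v : cycle (adj (tgraph t u v)) (outer t u v).
Proof.
rewrite /outer /= rcons_path outer_path last_rcons.
by rewrite /adj setUC tedges_base.
Qed.

Lemma located_leaf_outer t u v x y : located t u v Leaf x y ->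
  exists p q, outer t u v = p ++ [:: x, y & q].
Proof.
move Es: Leaf => s H; elim: H Es => {t u v s x y}.
- by move=> t a b <-; exists [::], [::].
- move=> w l r a b s x y _ IH /IH [p [q E]].
  by exists p, (q ++ rcons (inner r) b); rewrite outer_node /outer -cat_rcons
    rcons_cons -/(outer l a w) E -catA.
- move=> w l r a b s x y _ IH /IH [p [q E]].
  by exists ((a :: inner l) ++ p), q; rewrite outer_node E catA.
Qed.

Lemma leaf_noncutting t u v x y : wf t u v -> located t u v Leaf x y ->
  noncutting (tgraph t u v) [set x; y].
Proof.
move=> W H; have [p [q E]] := located_leaf_outer H.
have R : [:: x, y & q ++ p] = rot (size p) (outer t u v) by rewrite E rot_size_cat.
apply: (@cycle_noncutting _ x y (q ++ p)); rewrite R ?rot_cycle ?rot_uniq //.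
  exact: outer_cycle.
by move=> z; rewrite inE mem_rot.
Qed.

Lemma base_noncutting t u v : wf t u v -> noncutting (tgraph t u v) [set u; v].
Proof.
move=> W; rewrite setUC.
have R : [:: v, u & inner t] = rotr 1 (outer t u v).
  by rewrite /outer -rcons_cons rotr1_rcons.
apply: (@cycle_noncutting _ v u (inner t)); rewrite R ?rotr_cycle ?rotr_uniq //.
  exact: outer_cycle.
by move=> z; rewrite inE mem_rotr.
Qed.

(** No edge that avoids [W] leaves [I], so [I] is closed under adjacency once [W] is deleted. *)
Lemma separated_not_connected G W (I : {set T}) x y :
  (forall e, e \in edges G -> [disjoint e & I] \/ e \subset I :|: W) ->
  x \in I -> y \notin I -> ~~ connect (adj (delete_vertices G W)) x y.
Proof.
move=> H xI yI; apply/negP => C.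
suff : y \in I by rewrite (negPf yI).
have Cl : closed (adj (delete_vertices G W)) I.
  apply: (intro_closed (sym_connect_sym (adj_sym _))) => c d.
  rewrite adj_delete => /and3P[/H[D|S] Hc Hd] cI.
    by move: D; rewrite disjoints_subset subUset !sub1set !inE cI.
  have := subsetP S d; rewrite set22 inE => /(_ isT).
  by rewrite (negPf Hd) orbF.
by rewrite -(closed_connect Cl C).
Qed.

Lemma located_sep_set t u v s x y e : wf t u v -> located t u v s x y ->
  e \in tedges t u v ->
  [disjoint e & [set z in inner s]] \/ e \subset [set z in inner s] :|: [set x; y].
Proof.
move=> W H He; case: (located_sep W H He) => [Hs|D]; [right|left].
  apply/subsetP => z /(tedges_outer Hs); rewrite mem_outer !inE.
  by do !case: (_ == _) => //=; rewrite ?orbT ?orbF.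
by rewrite disjoints_subset; apply/subsetP => z /D; rewrite !inE.
Qed.

Lemma node_cutting t u v w l r x y : wf t u v ->
  located t u v (Node w l r) x y -> [set x; y] != [set u; v] ->
  cutting (tgraph t u v) [set x; y].
Proof.
move=> W H N; set s := Node w l r in H.
apply/andP; split; first by apply: (subsetP (located_edges H)); apply: tedges_base.
have ws : w \in inner s by rewrite /= mem_cat inE eqxx orbT.
have [Ws] := located_wf H W; have /wf_inner/andP[xs ys] := Ws.
have Wxy := wf_neq Ws.
have [t' [P E L NL]] := located_split H.
have [Wt' Dt'] := split_wf W P.
(* A vertex on the other side: [t'] is not a leaf because (x, y) is not the base, and then [u] or
   [v] is off the edge. *)
have [c ct cN] : exists2 c, c \in outer t' u v & c \notin [set x; y].
  case: t' {P E} L NL Wt' Dt' => [_ NL _ _|w' l' r' L _ Wt' Dt'].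
    by case: (NL erefl) => [_ [? ?]]; subst; rewrite eqxx in N.
  case: (boolP (u \in [set x; y])) => [ux|]; last by exists u => //; rewrite mem_outer eqxx.
  case: (boolP (v \in [set x; y])) => [vx|]; last by exists v => //; rewrite mem_outer eqxx orbT.
  exfalso; move/negP: N; apply.
  have := wf_neq W; move: ux vx; rewrite !inE => /orP[] /eqP-> /orP[] /eqP->;
  by rewrite ?eqxx // setUC.
have xyo : (x \in outer t u v) && (y \in outer t u v) := located_ends H.
apply/negP => /forallP/(_ w)/implyP; rewrite mem_delete.
have wN : w \notin [set x; y] by rewrite !inE negb_or; apply: wf_in_neq ws.
have wo : w \in outer t u v by rewrite mem_outer (located_inner H ws) !orbT.
have co : c \in outer t u v by rewrite (perm_mem (split_perm u v P)) mem_cat ct.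
rewrite wN wo => /(_ isT)/forallP/(_ c)/implyP; rewrite mem_delete cN co => /(_ isT).
apply/negP.
apply: (@separated_not_connected _ _ [set z in inner s]); rewrite ?inE ?Dt' //.
by move=> e; apply: located_sep_set.
Qed.

Lemma inner_connected t u v s x y c d : wf t u v -> located t u v s x y ->
  c \in inner s -> d \in inner s ->
  connect (adj (delete_vertices (tgraph t u v) [set x; y])) c d.
Proof.
move=> W H; have Ws := located_wf H W.
have := outer_path s x y; have := wf_in_neq Ws.
case: (inner s) => // z p N /=; rewrite rcons_path => /and3P[_ Hp _].
apply: connect_path; last by move=> i Hi; rewrite !inE negb_or; apply: N.
apply: sub_path Hp => i j; rewrite /adj /=; exact: (subsetP (located_edges H)).
Qed.

Lemma rest_connected t u v t' x y c d : wf t' u v -> located t' u v Leaf x y ->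
  tedges t' u v \subset tedges t u v ->
  c \in outer t' u v -> d \in outer t' u v ->
  c \notin [set x; y] -> d \notin [set x; y] ->
  connect (adj (delete_vertices (tgraph t u v) [set x; y])) c d.
Proof.
move=> W L S Hc Hd cN dN.
have /andP[_ /forallP/(_ c)/implyP] := leaf_noncutting W L.
rewrite mem_delete Hc cN => /(_ isT)/forallP/(_ d)/implyP.
rewrite mem_delete Hd dN => /(_ isT).
apply: connect_sub => i j; rewrite adj_delete => /and3P[A B C].
by apply: connect1; rewrite adj_delete B C !andbT; apply: (subsetP S) A.
Qed.

End Trees.

(** * Counting darts and faces *)

Section Rotation.

Variable T : finType.
Implicit Types (G : graph T) (x y z : T) (d : T * T) (f o : {set T * T}).

Lemma simple_adj_neq G x y : simple_graph G -> adj G x y -> x != y.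
Proof.
move=> /forallP/(_ [set x; y])/implyP H /H /andP[+ _].
by rewrite cards2; case: (x != y).
Qed.

Lemma simple_adj_vertices G x y : simple_graph G -> adj G x y ->
  (x \in vertices G) && (y \in vertices G).
Proof.
move=> /forallP/(_ [set x; y])/implyP H /H /andP[_ /subsetP S].
by rewrite !S ?set21 ?set22.
Qed.

Lemma mem_darts G d : (d \in darts G) = adj G d.1 d.2.
Proof. by rewrite inE. Qed.

Lemma darts_rev G x y : ((x, y) \in darts G) = ((y, x) \in darts G).
Proof. by rewrite !mem_darts /= adj_sym. Qed.

Lemma sum_darts G (F : T * T -> nat) k : simple_graph G ->
  (forall x y, adj G x y -> F (x, y) + F (y, x) = k) ->
  \sum_(d in darts G) F d = #|edges G| * k.
Proof.
move=> S HF.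
rewrite (partition_big (fun d => [set d.1; d.2]) (mem (edges G))) /=; last first.
  by move=> d; rewrite inE.
rewrite -sum_nat_const; apply: eq_bigr => e He.
have := forallP S e; rewrite He /= => /andP[/cards2P[x [y [Nxy E]]] _].
rewrite E in He *.
rewrite (eq_bigl (mem [set (x, y); (y, x)])); last first.
  case=> a b /=; rewrite !inE /=; apply/andP/orP => [[_ /eqP /set2_eqP[] [-> ->]]|].
  - by rewrite eqxx; left.
  - by rewrite eqxx; right.
  - by case=> /eqP[-> ->]; rewrite /adj /= 1?(setUC [set y]) ?eqxx.
rewrite big_setU1 /= ?big_set1 ?HF // inE; apply/negP => /eqP[E1 _].
by rewrite E1 eqxx in Nxy.
Qed.

Lemma card_darts G : simple_graph G -> #|darts G| = #|edges G| + #|edges G|.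
Proof. by move=> S; rewrite -sum1_card (sum_darts (k := 2) S) // muln2 addnn. Qed.

Section FixRho.
Variables (G : graph T) (rho : T -> T -> T).
Hypothesis R : rotation_system G rho.

(** The way back from [rho x y] to [y] makes [rho x] map onto the neighbours of [x], and a
    surjection of a finite set to itself is injective. *)
Lemma rho_inj x : {in neighbours G x &, injective (rho x)}.
Proof.
apply/imset_injP; rewrite eqn_leq leq_imset_card /=; apply: subset_leq_card.
have Cl y : adj G x y -> adj G x (rho x y) by move=> H; case: (R H H).
apply/subsetP => y; rewrite inE => Hy.
have [_ /connectP[p /fpathP[k ->]]] := R (Cl _ Hy) Hy; rewrite last_traject => Ek.
apply/imsetP; exists (iter k (rho x) y); last by rewrite -iterS iterSr.
by rewrite inE; elim: k {Ek} => //= k /Cl.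
Qed.

Lemma face_step_darts : {homo face_step rho : d / d \in darts G}.
Proof.
case=> x y; rewrite !mem_darts /= => H.
by have Hy : adj G y x; [rewrite adj_sym | case: (R Hy Hy)].
Qed.

Lemma face_step_inj : {in darts G &, injective (face_step rho)}.
Proof.
case=> x y [x' y']; rewrite !mem_darts /= => H H' [E]; subst y' => E.
congr (_, _); apply: (rho_inj (x := y)) => //; by rewrite inE adj_sym.
Qed.

Lemma faces_partition : partition (faces G rho) (darts G).
Proof.
have Sym := fconnect_sym_in face_step_darts face_step_inj.
have Cl d d' : d \in darts G -> fconnect (face_step rho) d d' -> d' \in darts G.
  move=> Hd /connectP[p /fpathP[k ->] ->]; rewrite last_traject.
  by elim: k => //= k; apply: face_step_darts.
have -> : faces G rho = equivalence_partition (fconnect (face_step rho)) (darts G).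
  apply: eq_in_imset => d Hd; apply/setP => d'; rewrite !inE.
  case C: (fconnect _ _ _); rewrite ?andbF // andbT.
  by have := Cl _ _ Hd C; rewrite inE => ->.
apply: equivalence_partitionP => d1 d2 d3 H1 H2 H3; split; first exact: connect0.
move=> C; apply/idP/idP => C'; last exact: connect_trans C C'.
by apply: connect_trans C'; rewrite Sym.
Qed.

Lemma sum_faces (F : T * T -> nat) :
  \sum_(f in faces G rho) \sum_(d in f) F d = \sum_(d in darts G) F d.
Proof.
have /and3P[/eqP <- Tr _] := faces_partition.
by rewrite -big_trivIset.
Qed.

Lemma face_eq f d : f \in faces G rho -> d \in f ->
  f = [set d' | fconnect (face_step rho) d d'].
Proof.
have Sym := fconnect_sym_in face_step_darts face_step_inj.
move=> /imsetP[d0 Hd0 ->]; rewrite inE => C; apply/setP => d'; rewrite !inE.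
have Cl k : iter k (face_step rho) d0 \in darts G by elim: k => //= k; apply: face_step_darts.
have Hd : d \in darts G.
  by case/connectP: C => p /fpathP[k ->] ->; rewrite last_traject.
have C' : fconnect (face_step rho) d d0 by rewrite Sym.
by apply/idP/idP; apply: connect_trans.
Qed.

Lemma face_darts f d : f \in faces G rho -> d \in f -> d \in darts G.
Proof.
have /and3P[/eqP <- _ _] := faces_partition.
by move=> Hf Hd; apply/bigcupP; exists f.
Qed.

Lemma dart_face d : d \in darts G ->
  [set d' | fconnect (face_step rho) d d'] \in faces G rho.
Proof. by move=> H; apply: imset_f. Qed.

End FixRho.

(** Two linear equations: with [m] inner faces and [e] edges, counting darts by faces gives
    [n + 3m = 2e], and Euler's formula gives [n + m + 1 = e + 2]. *)
Lemma standard_count G rho o : simple_graph G -> standard_embedding G rho o ->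
  #|faces G rho :\ o| + 2 = #|vertices G| /\
  #|edges G| + 3 = 2 * #|vertices G|.
Proof.
move=> S [[_ R E] Ho Co _ Tri].
have := sum_faces R (fun => 1); rewrite sum1_card (card_darts S) (big_setD1 o) //=.
rewrite sum1_card Co (eq_bigr (fun => 3)); last by move=> f /Tri; rewrite sum1_card.
rewrite sum_nat_const; move: E; rewrite (cardsD1 o (faces G rho)) Ho /=.
move: #|vertices G| #|edges G| #|_ :\ _| => V E F; lia.
Qed.

Lemma maximal_outerplanar_edges G : maximal_outerplanar G ->
  #|edges G| + 3 = 2 * #|vertices G|.
Proof. by move=> [S _ [rho [o /(standard_count S) []]]]. Qed.

End Rotation.

(** * Maximal outerplanar graphs are triangulated polygons *)

Section Mirror.

Variable T : finType.
Implicit Types (t s l r : tree T) (a b u v w x y z : T).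

(** Reflection swaps the ends of the base without changing the graph. It also yields the right-hand
    cases from the left-hand ones. *)
Fixpoint mirror t : tree T :=
  if t is Node w l r then Node w (mirror r) (mirror l) else Leaf.

Lemma mirrorK : involutive mirror.
Proof. by elim=> //= w l -> r ->. Qed.

Lemma inner_mirror t : inner (mirror t) = rev (inner t).
Proof. by elim: t => //= w l IHl r IHr; rewrite IHl IHr rev_cat rev_cons cat_rcons. Qed.

Lemma tedges_mirror t a b : tedges (mirror t) b a = tedges t a b.
Proof.
elim: t a b => [|w l IHl r IHr] a b /=; first by rewrite setUC.
by rewrite IHl IHr (setUC [set b]) (setUC (tedges r w b)).
Qed.

Lemma outer_mirror t a b : outer (mirror t) b a = rev (outer t a b).
Proof. by rewrite /outer inner_mirror rev_cons rev_rcons. Qed.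

Lemma wf_mirror t a b : wf (mirror t) b a = wf t a b.
Proof. by rewrite /wf outer_mirror rev_uniq. Qed.

Lemma tgraph_mirror t a b : tgraph (mirror t) b a = tgraph t a b.
Proof.
rewrite /tgraph tedges_mirror outer_mirror; congr Graph.
by apply/setP => x; rewrite !in_set mem_rev.
Qed.

End Mirror.

(** A closed walk of three steps cannot descend at each of them. *)
Lemma descents_le2 (i j k : nat) : (j < i) + (k < j) + (i < k) <= 2.
Proof. lia. Qed.

Lemma descents_eq2 (i j k : nat) :
  i < j -> (j < i) + (k < j) + (i < k) = 2 -> i < k /\ k < j.
Proof. lia. Qed.

Lemma split_bound (i j m k : nat) :
  i < j -> j < m -> m <= i + k.+1 -> j <= i + k /\ m <= j + k.
Proof. lia. Qed.

Lemma split_length (i j m : nat) :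
  i < j -> j < m -> (j - i) + (m - j).+1 = (m - i).+1.
Proof. lia. Qed.

Section Triangulation.

Variable T : finType.
Variables (G : graph T) (rho : T -> T -> T) (o : {set T * T}).
Hypotheses (SG : simple_graph G) (V3 : 3 <= #|vertices G|).
Hypothesis Emb : standard_embedding G rho o.
Implicit Types (u v w x y z : T) (d : T * T) (f : {set T * T}).

Let R : rotation_system G rho. Proof. by case: Emb => [[]]. Qed.
Let Fo : o \in faces G rho. Proof. by case: Emb. Qed.
Let homo := face_step_darts R.
Let inj := face_step_inj R.

Lemma face_order f d : f \in faces G rho -> d \in f ->
  f =i orbit (face_step rho) d /\ iter #|f| (face_step rho) d = d.
Proof.
move=> Hf Hd; rewrite (face_eq R Hf Hd).
have E : #|[set d' | fconnect (face_step rho) d d']| = order (face_step rho) d.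
  by rewrite cardsE.
rewrite E; split; first by move=> d'; rewrite inE fconnect_orbit.
exact: (iter_order_in homo inj (face_darts R Hf Hd)).
Qed.

Lemma triangle_face f x y : f \in faces G rho -> #|f| = 3 -> (x, y) \in f ->
  exists z, [/\ f = [set (x, y); (y, z); (z, x)], adj G x y, adj G y z & adj G z x].
Proof.
move=> Hf C Hd; have [E I] := face_order Hf Hd; exists (rho y x).
have Ez : rho (rho y x) y = x by move: I; rewrite C /= /face_step /=; case.
have O : order (face_step rho) (x, y) = 3.
  rewrite -C -[order _ _]size_orbit -(card_uniqP (orbit_uniq _ _)).
  by apply: eq_card => d; rewrite E.
have Ef : f = [set (x, y); (y, rho y x); (rho y x, x)].
  by apply/setP => d; rewrite E /orbit O /= /face_step /= Ez !inE orbA.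
have D d : d \in f -> adj G d.1 d.2 by move/(face_darts R Hf); rewrite mem_darts.
by split=> //; [apply: (D (x, y)) | apply: (D (y, rho y x)) | apply: (D (rho y x, x))];
  rewrite Ef !inE eqxx ?orbT.
Qed.

(** * Positions along the outer cycle and descents of darts *)

Section Root.

Variables (u v : T).
Hypothesis vuo : (v, u) \in o.

Let F := face_step rho.
Let d0 := F (v, u).
Let n := #|vertices G|.
Let c := traject F d0 n.

(* Position along the outer cycle, starting from [u]. *)
Definition pos x := index x [seq d.1 | d <- c].

Let card_o : #|o| = n. Proof. by case: Emb. Qed.

Let d0o : d0 \in o.
Proof.
rewrite (face_eq R Fo vuo) inE; exact: fconnect1.
Qed.

Let c_mem : o =i c /\ iter n F d0 = d0.
Proof.
have [E I] := face_order Fo d0o; split; last by rewrite -card_o.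
move=> d; rewrite E /orbit /c -card_o.
suff -> : #|o| = order F d0 by [].
by rewrite -size_orbit -(card_uniqP (orbit_uniq _ _)); apply: eq_card.
Qed.

Let fst_inj : {in o &, injective (fun d : T * T => d.1)}.
Proof. by apply/imset_injP; case: Emb => _ _ -> ->. Qed.

Let c_uniq : uniq [seq d.1 | d <- c].
Proof.
rewrite map_inj_in_uniq; last by move=> d d'; rewrite -!c_mem.1; apply: fst_inj.
by apply/card_uniqP; rewrite size_traject -card_o; apply: eq_card => d; rewrite c_mem.1.
Qed.

Lemma pos_iter i : i < n -> pos (iter i F d0).1 = i.
Proof.
move=> H; rewrite /pos -{1}(nth_traject F H).
by rewrite -(nth_map _ u) ?size_traject // index_uniq // size_map size_traject.
Qed.

Lemma outer_iter d : d \in o -> exists2 i, i < n & d = iter i F d0.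
Proof. by rewrite c_mem.1 => /trajectP. Qed.

Lemma iter_last : iter n.-1 F d0 = (v, u).
Proof.
have n0 : 0 < n by apply: leq_trans V3.
have D0 : d0 \in darts G := face_darts R Fo d0o.
apply: inj => [||].
- by elim: n.-1 => //= k; apply: homo.
- by apply: (face_darts R Fo).
by rewrite -iterS prednK // c_mem.2.
Qed.

Lemma pos_u : pos u = 0.
Proof. by rewrite (pos_iter (i := 0)) //; apply: leq_trans V3. Qed.

Lemma pos_v : pos v = n.-1.
Proof.
have <- : (iter n.-1 F d0).1 = v by rewrite iter_last.
by apply: pos_iter; rewrite prednK //; apply: leq_trans V3.
Qed.

Lemma vertex_iter x : x \in vertices G -> exists2 i, i < n & x = (iter i F d0).1.
Proof.
have <- : [set d.1 | d in o] = vertices G by case: Emb.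
by case/imsetP => d /outer_iter[i Hi ->] ->; exists i.
Qed.

Lemma pos_inj : {in vertices G &, injective pos}.
Proof.
move=> x y /vertex_iter[i Hi ->] /vertex_iter[j Hj ->].
by rewrite !pos_iter // => ->.
Qed.

Lemma pos_outer x y : (x, y) \in o ->
  (x, y) = (v, u) \/ pos y = (pos x).+1.
Proof.
case/outer_iter=> i Hi E; case: (ltnP i.+1 n) => Hi'.
  right; have -> : x = (iter i F d0).1 by rewrite -E.
  have -> : y = (iter i.+1 F d0).1 by rewrite iterS -E.
  by rewrite !pos_iter.
left; rewrite E; have -> : i = n.-1 by lia.
exact: iter_last.
Qed.

Let des d : nat := pos d.2 < pos d.1.

Let adj_pos x y : adj G x y -> pos x <> pos y.
Proof.
move=> H E; have /andP[Hx Hy] := simple_adj_vertices SG H.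
by have := simple_adj_neq SG H; rewrite (pos_inj Hx Hy E) eqxx.
Qed.

Let sum_face x y z : adj G x y -> adj G y z -> adj G z x ->
  \sum_(d in [set (x, y); (y, z); (z, x)]) des d = des (x, y) + des (y, z) + des (z, x).
Proof.
move=> /(simple_adj_neq SG) xy /(simple_adj_neq SG) yz /(simple_adj_neq SG) zx.
rewrite -setUA big_setU1 /=; last first.
  by rewrite !inE !xpair_eqE (negPf xy) (eq_sym x z) (negPf zx).
rewrite big_setU1 /= ?big_set1 ?addnA //.
by rewrite inE xpair_eqE (negPf yz).
Qed.

Let des_le2 f : f \in faces G rho :\ o -> \sum_(d in f) des d <= 2.
Proof.
move=> Hf; have Hf' : f \in faces G rho by move: Hf; rewrite inE => /andP[].
have C : #|f| = 3 by case: Emb => _ _ _ _; apply.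
have [[x y] Hd] : exists d, d \in f by apply/card_gt0P; rewrite C.
have [z [-> A1 A2 A3]] := triangle_face Hf' C Hd.
rewrite sum_face // /des /=.
exact: descents_le2.
Qed.

(** With [m] inner faces there are [2m + 1] edges, hence as many descents. At most one lies on the
    outer face and at most two on each inner face, so all these bounds are attained. *)
Let des_eq2 f : f \in faces G rho :\ o -> \sum_(d in f) des d = 2.
Proof.
move=> Hf; apply/eqP; rewrite eqn_leq des_le2 //=.
have [CF CE] := standard_count SG Emb.
have := sum_faces R des; rewrite (sum_darts (k := 1) SG) ?muln1; last first.
  by move=> x y /adj_pos; rewrite /des /=; lia.
rewrite (big_setD1 o) //= (big_setD1 f Hf) /= (big_setD1 (v, u) vuo) /=.
(* Along the outer face positions increase by one, except at the closing dart (v, u). *)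
rewrite (eq_bigr (fun => 0)); last first.
  move=> [x y]; rewrite !inE => /andP[N /pos_outer[E|E]]; first by rewrite E eqxx in N.
  by rewrite /des /= E ltnNge leqnSn.
rewrite sum_nat_const muln0 addn0.
have : \sum_(g in faces G rho :\ o :\ f) \sum_(d in g) des d
    <= \sum_(g in faces G rho :\ o :\ f) 2.
  by apply: leq_sum => g; rewrite inE => /andP[_ /des_le2].
rewrite sum_nat_const; move: CF; rewrite (cardsD1 f (_ :\ o)) Hf.
have : des (v, u) <= 1 by rewrite /des; case: (_ < _).
move: (des _) (\sum_(d in f) _) (\sum_(g in _) _) CE => A B C.
move: #|edges G| #|vertices G| #|_ :\ f| => E V K /=; lia.
Qed.

Lemma inner_triangle x y : (x, y) \in darts G -> (x, y) \notin o -> pos x < pos y ->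
  exists z f, [/\ f \in faces G rho :\ o, f = [set (x, y); (y, z); (z, x)],
    pos x < pos z & pos z < pos y].
Proof.
move=> D No xy; have Hf := dart_face rho D; set f := [set d' | _] in Hf.
have Df : (x, y) \in f by rewrite inE connect0.
have Hf' : f \in faces G rho :\ o.
  by rewrite !inE Hf andbT; apply/eqP => E; rewrite E (negPf No) in Df.
have C : #|f| = 3 by case: Emb => _ _ _ _; apply.
have [z [Ef A1 A2 A3]] := triangle_face Hf C Df.
have := des_eq2 Hf'; rewrite {1}Ef (sum_face A1 A2 A3) /des /= => E.
suff [E1 E2] : pos x < pos z /\ pos z < pos y by exists z, f.
exact: descents_eq2 xy E.
Qed.

(** Recording the positions as an interval gives at once that the vertices of [t] are distinct and,
    for the root edge, that they exhaust [G]. The number [k] is fuel bounding the length of the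
    interval. *)
Lemma triangulate k x y : pos y <= pos x + k -> (x, y) \in darts G -> pos x < pos y ->
  exists t, [/\ [seq pos z | z <- outer t x y] = iota (pos x) (pos y - pos x).+1,
    {subset outer t x y <= vertices G},
    tedges t x y \subset edges G,
    forall a b, located t x y Leaf a b -> (a, b) \in o &
    forall w a b, ear t x y w a b -> exists2 f, f \in faces G rho :\ o &
      face_edges f = [set [set a; b]; [set b; w]; [set w; a]]].
Proof.
elim: k x y => [|k IH] x y Hk D xy; first by rewrite addn0 leqNgt xy in Hk.
have A : adj G x y by rewrite mem_darts in D.
have /andP[Vx Vy] := simple_adj_vertices SG A.
case: (boolP ((x, y) \in o)) => Ho.
  exists Leaf; split.
  - have E : pos y = (pos x).+1.
      by case: (pos_outer Ho) => // -[_ E2]; move: xy; rewrite E2 pos_u.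
    by rewrite E subSnn /= E.
  - by move=> z; rewrite !inE => /orP[] /eqP->.
  - by rewrite sub1set.
  - by move=> a b H; inversion H; subst.
  - by move=> w a b [l [r H]]; inversion H.
have [z [f [Hf Ef xz zy]]] := inner_triangle D Ho xy.
have Df d : d \in f -> d \in darts G.
  by apply: (face_darts R); move: Hf; rewrite inE => /andP[].
have D1 : (x, z) \in darts G by rewrite darts_rev; apply: Df; rewrite Ef !inE eqxx orbT.
have D2 : (z, y) \in darts G by rewrite darts_rev; apply: Df; rewrite Ef !inE eqxx orbT.
have [B1 B2] := split_bound xz zy Hk.
have [l [El Vl Sl Ll Rl]] := IH x z B1 D1 xz.
have [r [Er Vr Sr Lr Rr]] := IH z y B2 D2 zy.
exists (Node z l r); split.
- rewrite outer_node map_cat map_cons Er.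
  have : [seq pos p | p <- rcons (x :: inner l) z] = iota (pos x) (pos z - pos x).+1 by rewrite -El.
  rewrite map_rcons -addn1 iotaD [iota _ 1]/= cats1 => /rcons_inj[-> _].
  have -> : iota (pos z) (pos y - pos z).+1 =
    iota (pos x + (pos z - pos x)) (pos y - pos z).+1 by rewrite (subnKC (ltnW xz)).
  by rewrite -iotaD (split_length xz zy).
- by move=> p; rewrite outer_nodeE => /orP[/Vl|/Vr].
- by rewrite /= !subUset Sl Sr sub1set !andbT.
- by move=> a b H; inversion H; subst; auto.
- move=> w a b [l' [r' H]]; inversion H; subst;
    [|by apply: Rl; exists l', r'|by apply: Rr; exists l', r'].
  by exists [set (a, b); (b, w); (w, a)] => //; rewrite /face_edges !imsetU !imset_set1.
Qed.

Lemma outerplanar_tree : exists t, [/\ wf t u v, G = tgraph t u v,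
    forall a b, located t u v Leaf a b -> (a, b) \in o &
    forall w a b, ear t u v w a b -> exists2 f, f \in faces G rho :\ o &
      face_edges f = [set [set a; b]; [set b; w]; [set w; a]]].
Proof.
have D : (u, v) \in darts G by rewrite darts_rev (face_darts R Fo).
have uv : pos u < pos v by rewrite pos_u pos_v /n; lia.
have [t [Et Vt St Lt Rt]] := triangulate (leq_addl _ _) D uv.
have W : wf t u v by rewrite /wf; apply: (map_uniq (f := pos)); rewrite Et iota_uniq.
have Sz : size (outer t u v) = n.
  by rewrite -(size_map pos) Et size_iota pos_u pos_v /n; lia.
exists t; split=> //.
have EV : [set x in outer t u v] = vertices G.
  apply/eqP; rewrite eqEcard; apply/andP; split; first by apply/subsetP => x; rewrite inE => /Vt.
  by rewrite cardsE (card_uniqP W) Sz.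
(* An inclusion between two sets of the same size [2n - 3]. *)
have EE : tedges t u v = edges G.
  apply/eqP; rewrite eqEcard St (card_tedges W).
  have := standard_count SG Emb; move: Sz; rewrite /outer /= size_rcons /n; lia.
by rewrite /tgraph EV EE; move: (G) => [V0 E0].
Qed.

End Root.

End Triangulation.

Section Recognition.

Variable T : finType.
Implicit Types (G : graph T) (u v w x y z : T).

(** The tree read from an arbitrary outer dart shows that a non-cutting edge is its base or a leaf.
    So (u, v) lies on the outer face in one of its two directions, and the tree can be rebuilt from
    there. *)
Lemma maximal_outerplanar_tree G u v : maximal_outerplanar G ->
  noncutting G [set u; v] -> exists t, [/\ wf t u v, G = tgraph t u v & t <> Leaf].
Proof.
move=> [SG V3 [rho [o Emb]]] Huv.
suff [t [W E]] : exists t, wf t u v /\ G = tgraph t u v.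
  exists t; split=> // Et; move: V3; rewrite E Et /= cardsE.
  by rewrite leqNgt ltnS (leq_trans (card_size _)).
have [[v' u'] Ho'] : exists d, d \in o.
  by apply/card_gt0P; case: Emb => _ _ -> _ _; apply: leq_trans V3.
have [t' [W' E' L' _]] := outerplanar_tree SG V3 Emb Ho'.
have : (v, u) \in o \/ (u, v) \in o.
  move: (Huv); rewrite {1}E' => /andP[/tedgesP[s [x [y [H Exy]]]] C].
  case: s H => [|w l r] H.
    by move/L': H; case/set2_eqP: Exy => -[-> ->]; auto.
  case: (eqVneq [set x; y] [set u'; v']) => [E2|N].
    by move: Exy; rewrite E2 => /set2_eqP[] [-> ->]; auto.
  by have := node_cutting W' H N; rewrite /cutting -Exy C andbF.
case=> Ho; have [t [W E _ _]] := outerplanar_tree SG V3 Emb Ho; first by exists t.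
by exists (mirror t); rewrite wf_mirror tgraph_mirror.
Qed.

Lemma triangle_rot x y z : [set [set x; y]; [set y; z]; [set z; x]] =
  [set [set y; z]; [set z; x]; [set x; y]].
Proof. by rewrite -setUA setUC. Qed.

Lemma triangle_swap x y z : [set [set x; y]; [set y; z]; [set z; x]] =
  [set [set y; x]; [set x; z]; [set z; y]].
Proof.
by rewrite (setUC [set x] [set y]) (setUC [set y] [set z]) (setUC [set z] [set x]) setUAC.
Qed.

(** Three mutually adjacent vertices are an apex and its feet, and the triangle of an apex is a
    face. This locates the triangles of a tree in an embedding given independently of it, such as
    that of a handle. *)
Lemma clique_face G rho o x y z : simple_graph G -> 3 <= #|vertices G| ->
  standard_embedding G rho o -> adj G x y -> adj G y z -> adj G z x ->
  exists2 f, f \in faces G rho :\ o &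
    face_edges f = [set [set x; y]; [set y; z]; [set z; x]].
Proof.
move=> SG V3 Emb xy yz zx.
have [[v u] Ho] : exists d, d \in o.
  by apply/card_gt0P; case: Emb => _ _ -> _ _; apply: leq_trans V3.
have [t [W E _ Rt]] := outerplanar_tree SG V3 Emb Ho.
move: xy yz zx (xy) (yz) (zx); rewrite {1 2 3}E /adj /= => H1 H2 H3 xy yz zx.
have [w [a [b [He Es]]]] := clique_ear W H1 H2 H3.
have [f Hf Ef] := Rt _ _ _ He; exists f => //; rewrite Ef.
have := simple_adj_neq SG xy; have := simple_adj_neq SG yz; have := simple_adj_neq SG zx.
have Hx : x \in [set a; b; w] by rewrite -Es !inE eqxx.
have Hy : y \in [set a; b; w] by rewrite -Es !inE eqxx orbT.
have Hz : z \in [set a; b; w] by rewrite -Es !inE eqxx orbT.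
move: Hx Hy Hz; rewrite !inE -!orbA.
by case/or3P=> /eqP->; case/or3P=> /eqP->; case/or3P=> /eqP->; rewrite ?eqxx // => _ _ _;
  rewrite ?(triangle_swap b a w) ?(triangle_swap w b a) ?(triangle_swap a w b);
  rewrite 1?triangle_rot // triangle_rot.
Qed.

End Recognition.

(** * Triangulated polygons are maximal outerplanar *)

Section Sequences.

Variable T : eqType.
Implicit Types (x y : T) (p q : seq T).

Lemma next_split p x y q : uniq (p ++ [:: x, y & q]) ->
  next (p ++ [:: x, y & q]) x = y.
Proof.
by move/cycle_next; rewrite -(rot_cycle (size p)) rot_size_cat /= => /andP[/eqP].
Qed.

Lemma next_last p x : uniq p -> next p (last x p) = head x p.
Proof.
case: p => // y p /cycle_next /=.
by rewrite rcons_path => /andP[_ /eqP].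
Qed.

End Sequences.

Section Embedding.

Variable T : finType.
Implicit Types (t s l r h : tree T) (a b c u v w x y z : T) (g : T -> seq T).

(* [fanL t b] and [fanR t a] list the neighbours in [t] of the ends a and b of
   its base (a, b), starting with the other end. *)
Fixpoint fanL t b := b :: (if t is Node w l r then fanL l w else [::]).
Fixpoint fanR t a := a :: (if t is Node w l r then fanR r w else [::]).

Fixpoint inner_nbrs t a b x : seq T :=
  if t is Node w l r then
    if x == w then rev (fanL r b) ++ fanR l a else
    if x \in inner l then inner_nbrs l a w x else inner_nbrs r w b x
  else [::].

(* In the cyclic order of a planar embedding. *)
Definition nbrs t u v x :=
  if x == u then rev (fanL t v) else
  if x == v then fanR t u else inner_nbrs t u v x.

Lemma mem_fanL t u v z : wf t u v ->
  (z \in fanL t v) = ([set u; z] \in tedges t u v).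
Proof.
elim: t u v z => [|w l IHl r IHr] u v z W.
  rewrite /= !inE; apply/eqP/eqP => [->//|/set2_eqP[[]|[E1 E2]]] //.
  by move/wf_neq: W; rewrite E1 eqxx.
rewrite tedges_node -(IHl _ _ _ (wf_left W)) inE.
case: (boolP ([set u; z] \in tedges r w v)) => [/tedges_outer/(_ (set21 _ _))|_].
  by case/andP: (wf_left_notin W) => _ /negPf ->.
rewrite orbF; congr (_ || _); apply/eqP/eqP => [->//|/set2_eqP[[]|[E1 E2]]] //.
by move/wf_neq: W; rewrite E1 eqxx.
Qed.

Lemma fanR_mirror t a : fanR t a = fanL (mirror t) a.
Proof. by elim: t a => //= w l IHl r IHr a; rewrite IHr. Qed.

Lemma mem_fanR t u v z : wf t u v ->
  (z \in fanR t u) = ([set v; z] \in tedges t u v).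
Proof. by rewrite -wf_mirror fanR_mirror => /mem_fanL ->; rewrite tedges_mirror. Qed.

Lemma fanL_uniq t u v : wf t u v -> uniq (fanL t v).
Proof.
elim: t u v => // w l IHl r IHr u v W; rewrite [fanL _ _]/= cons_uniq (IHl u w (wf_left W)) andbT.
rewrite (mem_fanL _ (wf_left W)); apply/negP => /tedges_outer/(_ (set22 _ _)).
by case/andP: (wf_left_notin W) => /negP.
Qed.

Lemma fanR_uniq t u v : wf t u v -> uniq (fanR t u).
Proof. by rewrite -wf_mirror fanR_mirror => /fanL_uniq. Qed.

Lemma mem_inner_nbrs t u v x z : wf t u v -> x \in inner t ->
  (z \in inner_nbrs t u v x) = ([set x; z] \in tedges t u v).
Proof.
elim: t u v => // w l IHl r IHr u v W Hx.
have Nuv : [set x; z] == [set u; v] = false.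
  apply/eqP => /set2_eqP E; case/andP: (wf_in_neq W Hx).
  by case: E => [[-> _]|[-> _]]; rewrite eqxx.
rewrite tedges_node Nuv /=; have [Wl Wr] := (wf_left W, wf_right W).
case: eqP => [->|/eqP N].
  by rewrite mem_cat mem_rev (mem_fanL _ Wr) (mem_fanR _ Wl) orbC.
case: ifP => xl.
  rewrite (IHl _ _ Wl xl); case: (boolP (_ \in tedges r w v)); rewrite ?orbF //.
  by move/tedges_outer/(_ (set21 _ _))/(wf_inner_disj W xl).
have xr : x \in inner r by move: Hx; rewrite /= mem_cat inE xl (negPf N).
rewrite (IHr _ _ Wr xr); case: (boolP (_ \in tedges l u w)) => //.
by move/tedges_outer/(_ (set21 _ _))/(wf_inner_disjr W xr).
Qed.

Lemma inner_nbrs_uniq t u v x : wf t u v -> uniq (inner_nbrs t u v x).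
Proof.
elim: t u v => //= w l IHl r IHr u v W; have [Wl Wr] := (wf_left W, wf_right W).
case: eqP => [_|_]; last by case: ifP => _; [apply: IHl|apply: IHr].
rewrite cat_uniq rev_uniq (fanL_uniq Wr) (fanR_uniq Wl) andbT /=.
apply/hasPn => z; rewrite (mem_fanR _ Wl) mem_rev (mem_fanL _ Wr) => Hl.
apply/negP => Hr.
have E := wf_disj W (tedges_outer Hl (set22 _ _)) (tedges_outer Hr (set22 _ _)).
by have := tedges_card Wl Hl; rewrite E setUid cards1.
Qed.

Lemma nbrs_uniq t u v x : wf t u v -> uniq (nbrs t u v x).
Proof.
move=> W; rewrite /nbrs; case: ifP => _; first by rewrite rev_uniq (fanL_uniq W).
by case: ifP => _; [apply: fanR_uniq W|apply: inner_nbrs_uniq].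
Qed.

Lemma mem_nbrs t u v x z : wf t u v -> x \in outer t u v ->
  (z \in nbrs t u v x) = adj (tgraph t u v) x z.
Proof.
move=> W; rewrite mem_outer /nbrs /adj /=.
case: eqP => [-> _|_]; first by rewrite mem_rev (mem_fanL _ W).
case: eqP => [-> _|_]; first exact: mem_fanR.
by move=> H; apply: mem_inner_nbrs.
Qed.

(** Within the rotation, the neighbours inside a part form an initial segment at the left end of its
    base and a final segment at the right end. Smaller parts inherit this form, so the successors
    needed for faces can be read off locally. *)
Definition consistent g t u v :=
  [/\ exists q, g u = rev (fanL t v) ++ q, exists p, g v = p ++ fanR t u &
    forall w l r a b, located t u v (Node w l r) a b ->
      g w = rev (fanL r b) ++ fanR l a].

Lemma consistent_located g t u v s x y :
  consistent g t u v -> located t u v s x y -> consistent g s x y.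
Proof.
move=> C H; elim: H C => {t u v s x y} // w l r a b s x y _ IH [[q Eq] [p Ep] H]; apply: IH.
  have Hw := H _ _ _ _ _ (LocHere (Node w l r) a b); split.
  - by exists (b :: q); rewrite Eq /= rev_cons cat_rcons.
  - by exists (rev (fanL r b)).
  - by move=> w' l' r' a' b' L; apply: H; constructor.
have Hw := H _ _ _ _ _ (LocHere (Node w l r) a b); split.
- by exists (fanR l a).
- by exists (rcons p a); rewrite Ep /= cat_rcons.
- by move=> w' l' r' a' b' L; apply: H; constructor.
Qed.

Lemma inner_nbrs_located t u v w l r a b : wf t u v ->
  located t u v (Node w l r) a b -> inner_nbrs t u v w = rev (fanL r b) ++ fanR l a.
Proof.
move=> W H; move Es: (Node w l r) H => s H; elim: H W Es => {t u v s a b}.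
- by move=> t a b _ <-; rewrite /= eqxx.
- move=> c l0 r0 a b s x y H IH W Es; rewrite /= -(IH (wf_left W) Es).
  have wl : w \in inner l0 by rewrite -Es in H; apply: located_node_inner H.
  by rewrite wl; case: eqP => // E; case: (wf_node W) => _ _; rewrite -E wl.
- move=> c l0 r0 a b s x y H IH W Es; rewrite /= -(IH (wf_right W) Es).
  have wr : w \in inner r0 by rewrite -Es in H; apply: located_node_inner H.
  case: eqP => [E|_]; first by case: (wf_node W) => _ _ _; rewrite -E wr.
  by case: ifP => // wl; case: (wf_inner_disj W wl); rewrite mem_outer wr !orbT.
Qed.

Lemma nbrs_consistent t u v : wf t u v -> consistent (nbrs t u v) t u v.
Proof.
move=> W; rewrite /consistent /nbrs eqxx; split.
- by exists [::]; rewrite cats0.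
- by exists [::]; rewrite eq_sym (negPf (wf_neq W)) eqxx.
- move=> w l r a b H; have := wf_in_neq W (located_node_inner H).
  by case/andP => /negPf-> /negPf->; apply: inner_nbrs_located.
Qed.

Lemma located_parent t u v s x y : located t u v s x y ->
  [/\ s = t, x = u & y = v] \/ exists w l r a b, located t u v (Node w l r) a b /\
    ([/\ x = a, y = w & s = l] \/ [/\ x = w, y = b & s = r]).
Proof.
elim=> {t u v s x y} [t u v|w l r u v s x y H|w l r u v s x y H]; first by left.
  case=> [[-> -> ->]|[w' [l' [r' [a [b [L E]]]]]]]; right.
    by exists w, l, r, u, v; split; [constructor|left].
  by exists w', l', r', a, b; split; [constructor|].
case=> [[-> -> ->]|[w' [l' [r' [a [b [L E]]]]]]]; right.
  by exists w, l, r, u, v; split; [constructor|right].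
by exists w', l', r', a, b; split; [constructor|].
Qed.

Definition triangle w a b : seq (T * T) := [:: (a, b); (b, w); (w, a)].

Fixpoint triangles t u v : seq {set T * T} :=
  if t is Node w l r
  then [set d in triangle w u v] :: triangles l u w ++ triangles r w v
  else [::].

Lemma size_triangles t u v : size (triangles t u v) = size (inner t).
Proof. by elim: t u v => //= w l IHl r IHr u v; rewrite !size_cat /= IHl IHr addnS. Qed.

Lemma located_triangle t u v w l r a b : located t u v (Node w l r) a b ->
  [set d in triangle w a b] \in triangles t u v.
Proof.
move Es: (Node w l r) => s H; elim: H Es => {t u v s a b} [t a b <-||].
- by rewrite inE eqxx.
- by move=> c l0 r0 a b s x y _ IH /IH H; rewrite inE mem_cat H orbT.
- by move=> c l0 r0 a b s x y _ IH /IH H; rewrite inE mem_cat H !orbT.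
Qed.

Lemma triangles_located t u v f : f \in triangles t u v ->
  exists w l r a b, located t u v (Node w l r) a b /\ f = [set d in triangle w a b].
Proof.
elim: t u v => // w l IHl r IHr u v; rewrite inE mem_cat => /or3P[/eqP->|/IHl|/IHr].
- by exists w, l, r, u, v; split=> //; constructor.
- by move=> [w' [l' [r' [a [b [H E]]]]]]; exists w', l', r', a, b; split=> //; constructor.
- by move=> [w' [l' [r' [a [b [H E]]]]]]; exists w', l', r', a, b; split=> //; constructor.
Qed.

(** * The faces of the constructed embedding *)

Section Faces.

Variables (t : tree T) (u v : T).
Hypotheses (W : wf t u v) (N0 : t <> Leaf).
Let G := tgraph t u v.
Let nb := nbrs t u v.
Let rho x y := next (nb x) y.
Let C : consistent nb t u v := nbrs_consistent W.
Let U x : uniq (nb x) := nbrs_uniq x W.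
Let SG : simple_graph G := tgraph_simple W.

Lemma adj_tgraph_outer x y : adj G x y -> x \in outer t u v.
Proof. by case/(simple_adj_vertices SG)/andP; rewrite inE. Qed.

Lemma tgraph_rotation : rotation_system G rho.
Proof.
move=> x y z Hy Hz; have Hx := adj_tgraph_outer Hy.
rewrite -!(mem_nbrs _ W Hx) /rho in Hy Hz *; split; first by rewrite mem_next.
by rewrite (fconnect_cycle (cycle_next (U x))).
Qed.

Let nx x := head x (nb x).
Let od : seq (T * T) := [seq (x, nx x) | x <- outer t u v].

Lemma leaf_step x y : located t u v Leaf x y -> nx x = y /\ last y (nb y) = x.
Proof.
move/(consistent_located C) => [[q Eq] [p Ep] _].
by rewrite /nx Eq Ep /= last_cat.
Qed.

Lemma base_step : nx v = u /\ last u (nb u) = v.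
Proof.
rewrite /nx /nb /nbrs eqxx eq_sym (negPf (wf_neq W)) eqxx.
have lastL s y : last u (rev (fanL s y)) = y 
  by have -> : fanL s y = y :: behead (fanL s y) by [case: s]; rewrite rev_cons last_rcons.
by rewrite lastL; case: (t).
Qed.

Lemma outer_step x y : nx x = y -> last y (nb y) = x ->
  face_step rho (x, nx x) = (y, nx y).
Proof. by move=> <- {1}<-; rewrite /face_step /= /rho next_last. Qed.

Lemma od_cycle : fcycle (face_step rho) od.
Proof.
rewrite cycle_map; apply: (@sub_cycle _ (fun x y => (nx x == y) && (last y (nb y) == x))).
  by move=> x y /andP[/eqP E1 /eqP E2] /=; rewrite (outer_step E1 E2).
rewrite /outer /= rcons_path last_rcons outer_path_leaf /=.
  by case: base_step => -> ->; rewrite !eqxx.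
by move=> x y /leaf_step[-> ->]; rewrite !eqxx.
Qed.

Lemma od_uniq : uniq od.
Proof. by rewrite map_inj_uniq // => x y []. Qed.

Lemma triangle_cycle w l r a b : located t u v (Node w l r) a b ->
  fcycle (face_step rho) (triangle w a b).
Proof.
move=> H; have [[q Eq] [p Ep] _] := consistent_located C H.
have Ew : nb w = rev (fanL r b) ++ fanR l a by case: C => _ _ /(_ _ _ _ _ _ H).
have E1 : rho b a = w.
  have := U b; rewrite /rho Ep /=; case: (r) => *; exact: next_split.
have E2 : rho w b = a.
  have [X EX] : exists X, fanL r b = b :: X by case: (r) => *; eexists.
  have [Y EY] : exists Y, fanR l a = a :: Y by case: (l) => *; eexists.
  have := U w; rewrite /rho Ew EX EY rev_cons cat_rcons; exact: next_split.
have E3 : rho a w = b.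
  have [X EX] : exists X, fanL l w = w :: X by case: (l) => *; eexists.
  have := U a; rewrite /rho Eq /= EX !rev_cons !cat_rcons; exact: next_split.
by rewrite /= /face_step /= E1 E2 E3 !eqxx.
Qed.

Lemma triangle_uniq w l r a b : located t u v (Node w l r) a b -> uniq (triangle w a b).
Proof.
move=> H; have Ws := located_wf H W.
have [wa wb _ _] := wf_node Ws; have ab := wf_neq Ws.
by rewrite /= !inE !xpair_eqE (negPf ab) (eq_sym a w) (eq_sym b w) (negPf wa) (negPf wb) !andbF.
Qed.

Let o := [set d in od].

Lemma fconnect_set (s : seq (T * T)) d : fcycle (face_step rho) s -> d \in s ->
  [set d' | fconnect (face_step rho) d d'] = [set d in s].
Proof. by move=> Cs ds; apply/setP => d'; rewrite !inE (fconnect_cycle Cs). Qed.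

(** The dart from the left to the right end of an edge bounds the triangle beyond it, or the outer
    face if there is none. The reverse dart bounds the triangle of which the edge is a leg, or the
    outer face if it is the base. *)
Lemma tgraph_face f : f \in faces G rho -> f = o \/ f \in triangles t u v.
Proof.
case/imsetP => -[x y]; rewrite mem_darts /= => /tedgesP[s [a [b [L E]]]] ->.
have outer_case c d : nx c = d -> c \in outer t u v ->
    [set d' | fconnect (face_step rho) (c, d) d'] = o.
  move=> <- Hc; apply: fconnect_set od_cycle _; exact: map_f.
have triangle_case w l r p q d : located t u v (Node w l r) p q -> d \in triangle w p q ->
    [set d' | fconnect (face_step rho) d d'] \in triangles t u v.
  move=> H Hd; rewrite (fconnect_set (triangle_cycle H) Hd).
  exact: located_triangle H.
case/set2_eqP: E => -[-> ->].
  case: s L => [|w l r] L.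
    left; apply: outer_case; first by case: (leaf_step L).
    by case/andP: (located_ends L).
  by right; apply: triangle_case L _; rewrite inE eqxx.
case: (located_parent L) => [[_ -> ->]|[w [l [r [p [q [H E]]]]]]].
  by left; apply: outer_case; [case: base_step | rewrite mem_outer eqxx orbT].
right; apply: triangle_case H _.
by case: E => -[-> -> _]; rewrite !inE eqxx ?orbT.
Qed.

Lemma tgraph_card : #|vertices G| = (size (inner t)).+2.
Proof. by rewrite cardsE (card_uniqP W) /outer /= size_rcons. Qed.

Lemma inner_gt0 : 0 < size (inner t).
Proof. by case: t N0 => // w l r _; rewrite size_cat addnS. Qed.

Lemma tgraph_connected s x y : connected (tgraph s x y).
Proof.
apply/forallP => c; apply/implyP; rewrite inE => Hc.
apply/forallP => d; apply/implyP; rewrite inE => Hd.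
have P := outer_path s x y.
apply: connect_trans (path_connect P Hd).
by rewrite (sym_connect_sym (adj_sym _)) (path_connect P Hc).
Qed.

Lemma card_outer_face : #|o| = #|vertices G|.
Proof. by rewrite cardsE (card_uniqP od_uniq) size_map tgraph_card /outer /= size_rcons. Qed.

Lemma outer_is_face : o \in faces G rho.
Proof.
have H : (u, nx u) \in od by apply: map_f; rewrite mem_outer eqxx.
rewrite /o -(fconnect_set od_cycle H); apply: imset_f; rewrite mem_darts /=.
have -> : nx u = head u (rev (fanL t v)) by rewrite /nx /nb /nbrs eqxx.
rewrite /adj /= -(mem_fanL _ W) -mem_rev.
have : rev (fanL t v) != [::] by rewrite -size_eq0 size_rev; case: (t).
by case: (rev _) => // c p _; rewrite inE eqxx.
Qed.

Lemma triangle_card f : f \in triangles t u v -> #|f| = 3.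
Proof.
case/triangles_located => w [l [r [a [b [H ->]]]]].
by rewrite cardsE (card_uniqP (triangle_uniq H)).
Qed.

Lemma inner_faces f : f \in faces G rho :\ o -> f \in triangles t u v.
Proof. by rewrite !inE => /andP[N /tgraph_face[E|//]]; rewrite E eqxx in N. Qed.

(** Counting darts replaces a proof that distinct apexes give distinct faces: an outer face of size
    [n] and inner faces of size 3 share out the [2(2n - 3)] darts. *)
Lemma card_inner_faces : #|faces G rho :\ o| = size (inner t).
Proof.
have := sum_faces tgraph_rotation (fun => 1); rewrite sum1_card (card_darts SG).
rewrite (big_setD1 o outer_is_face) /= sum1_card card_outer_face.
rewrite (eq_bigr (fun => 3)); last first.
  by move=> f /inner_faces/triangle_card Ef; rewrite sum1_card.
rewrite sum_nat_const tgraph_card (card_tedges W).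
by move: (size _) #|_| => m k; lia.
Qed.

(** The list contains every inner face and is no longer than their number, so it is exact and free
    of repetitions. *)
Lemma triangles_faces : uniq (triangles t u v) /\ triangles t u v =i faces G rho :\ o.
Proof.
have S : {subset enum (faces G rho :\ o) <= triangles t u v}.
  by move=> f; rewrite mem_enum => /inner_faces.
have Z : size (triangles t u v) <= size (enum (faces G rho :\ o)).
  by rewrite -cardE card_inner_faces size_triangles.
split; first exact: leq_size_uniq (enum_uniq _) S Z.
have [_ E] := uniq_min_size (enum_uniq _) S Z.
by move=> f; rewrite -E mem_enum.
Qed.

Lemma tgraph_standard : standard_embedding G rho o.
Proof.
split.
- split; [exact: tgraph_connected|exact: tgraph_rotation|].
  have := card_inner_faces; rewrite (cardsD1 o (faces G rho)) outer_is_face => ->.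
  rewrite tgraph_card (card_tedges W) /=; lia.
- exact: outer_is_face.
- exact: card_outer_face.
- apply/setP => x; rewrite [vertices G]/= inE; apply/imsetP/idP.
    by case=> -[c d]; rewrite inE => /mapP[e He [-> _]] ->.
  by move=> Hx; exists (x, nx x) => //; rewrite inE map_f.
- by move=> f /inner_faces/triangle_card.
Qed.

Lemma tgraph_triangles : exists rho o, [/\ standard_embedding G rho o,
  uniq (triangles t u v) & triangles t u v =i faces G rho :\ o].
Proof. by exists rho, o; have [] := triangles_faces; split=> //; apply: tgraph_standard. Qed.

Lemma tgraph_maximal_outerplanar : maximal_outerplanar G.
Proof.
split; first exact: SG; first by rewrite tgraph_card; have := inner_gt0; lia.
by exists rho, o; apply: tgraph_standard.
Qed.

End Faces.

Lemma triangle_edges w a b :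
  face_edges [set d in triangle w a b] = [set [set a; b]; [set b; w]; [set w; a]].
Proof.
have -> : [set d in triangle w a b] = [set (a, b); (b, w); (w, a)].
  by apply/setP => d; rewrite !inE orbA.
by rewrite /face_edges !imsetU !imset_set1.
Qed.

Lemma triangles_edges t u v f e : f \in triangles t u v -> e \in face_edges f ->
  e \in tedges t u v.
Proof.
case/triangles_located => w [l [r [a [b [H ->]]]]]; rewrite triangle_edges !inE.
have [E1 E2 E3] : [/\ [set a; b] \in tedges t u v, [set a; w] \in tedges t u v
    & [set w; b] \in tedges t u v] by apply: ear_edges; exists l, r.
by rewrite (setUC [set b]) (setUC [set w] [set a]) => /orP[/orP[]|] /eqP->.
Qed.

(* [h] is a path of triangles of [t], from its base (u, v) to the edge (x, y),
   which is not on the base of another triangle of [t]. *)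
Inductive path_to : tree T -> tree T -> T -> T -> T -> T -> Prop :=
| PathHere x y : path_to Leaf Leaf x y x y
| PathLeft h w l r u v x y of path_to h l u w x y :
    path_to (Node w h Leaf) (Node w l r) u v x y
| PathRight h w l r u v x y of path_to h r w v x y :
    path_to (Node w Leaf h) (Node w l r) u v x y.

Lemma base_notin_triangles w l r u v f : wf (Node w l r) u v ->
  f \in triangles l u w ++ triangles r w v -> [set u; v] \notin face_edges f.
Proof.
move=> W; case/andP: (wf_left_notin W) => Nv Nu.
rewrite mem_cat => /orP[] Hf; apply/negP => /(triangles_edges Hf) E.
  by case/negP: Nv; apply: tedges_outer E (set22 _ _).
by case/negP: Nu; apply: tedges_outer E (set21 _ _).
Qed.

(** The triangle above meets the part only in [p] and [q], so a shared edge must be the base of the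
    part, and only the first triangle of the part contains that. *)
Lemma share_child u v c p q h : wf h p q ->
  [set p; q] \in face_edges [set d in triangle c u v] ->
  (forall x, x \in [set u; v; c] -> x \in outer h p q -> x \in [set p; q]) ->
  forall j, j < size (triangles h p q) ->
    share_edge [set d in triangle c u v] (nth set0 (triangles h p q) j) = (j == 0).
Proof.
move=> Wh Hpq Hx j Hj; apply/set0Pn/eqP => [[e]|->].
  rewrite inE => /andP[He Hj'].
  have e2 := tedges_card Wh (triangles_edges (mem_nth _ Hj) Hj').
  have epq : e = [set p; q].
    apply/eqP; rewrite eqEcard e2 cards2 (wf_neq Wh) andbT; apply/subsetP => x xe.
    apply: Hx; last exact: tedges_outer (triangles_edges (mem_nth _ Hj) Hj') xe.
    move: He xe; rewrite triangle_edges !inE.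
    by case/orP => [/orP[]|] /eqP->; rewrite !inE => /orP[] ->; rewrite ?orbT.
  case: h Wh Hj Hj' {Hx} => // w' l' r' Wh Hj Hj'.
  case: j Hj Hj' => // j Hj Hj'; exfalso.
  have Hin : nth set0 (triangles (Node w' l' r') p q) j.+1 \in
    triangles l' p w' ++ triangles r' w' q by rewrite /=; apply: mem_nth.
  by have := base_notin_triangles Wh Hin; rewrite -epq Hj'.
exists [set p; q]; rewrite inE Hpq /=.
by case: h Wh Hj {Hx} => // w' l' r' _ _; rewrite [nth _ _ _]/= triangle_edges !inE eqxx.
Qed.

Lemma path_to_share h s u v x y : path_to h s u v x y -> wf h u v ->
  forall i j, i < j < size (triangles h u v) ->
  share_edge (nth set0 (triangles h u v) i) (nth set0 (triangles h u v) j) = (j == i.+1).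
Proof.
elim=> {h s u v x y} [x y _ i j|h w l r u v x y _ IH W|h w l r u v x y _ IH W].
- by rewrite ltn0 andbF.
- have Wl := wf_left W; case/andP: (wf_left_notin W) => Nv _.
  rewrite [triangles _ _ _]/= cats0 => -[|i] [|j] //=; rewrite !ltnS => Hj; last exact: IH.
  rewrite (share_child Wl) //; first by rewrite triangle_edges !inE (setUC [set w]) eqxx !orbT.
  move=> z Hz zo; have /negPf N : z != v by apply: contraTneq zo => ->.
  by move: Hz; rewrite !inE N ?orbF.
- have Wr := wf_right W; case/andP: (wf_left_notin W) => _ Nu.
  rewrite [triangles _ _ _]/= => -[|i] [|j] //=; rewrite !ltnS => Hj; last exact: IH.
  rewrite (share_child Wr) //; first by rewrite triangle_edges !inE (setUC [set v]) eqxx !orbT.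
  move=> z Hz zo; have /negPf N : z != u by apply: contraTneq zo => ->.
  by move: Hz; rewrite !inE N ?orbF orbC.
Qed.

Lemma path_to_last h s u v x y F : path_to h s u v x y ->
  [set u; v] \in face_edges F ->
  [set x; y] \in face_edges (last F (triangles h u v)).
Proof.
move=> H; elim: H F => {h s u v x y} [//|h w l r u v x y _ IH F _|h w l r u v x y _ IH F _] /=.
  by rewrite cats0; apply: IH; rewrite triangle_edges !inE (setUC [set w]) eqxx !orbT.
by apply: IH; rewrite triangle_edges !inE (setUC [set v]) eqxx !orbT.
Qed.

Lemma path_to_connecting h s u v x y : path_to h s u v x y -> wf h u v ->
  h <> Leaf -> outerplanar_path_connecting (tgraph h u v) [set u; v] [set x; y].
Proof.
move=> P W N; split; first exact: tgraph_maximal_outerplanar.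
have [rho [o [E U Eq]]] := tgraph_triangles W.
have [F [fs Efs Huv]] : exists F, exists2 fs, triangles h u v = F :: fs &
    [set u; v] \in face_edges F.
  case: (h) N => // w l r _; exists [set d in triangle w u v].
  by eexists; first reflexivity; rewrite triangle_edges !inE eqxx.
exists rho, o, F, fs; split=> //; first by rewrite -Efs; split=> //; apply: path_to_share P W.
by have := path_to_last P Huv; rewrite Efs.
Qed.

Lemma path_to_outerplanar_path h s u v x y : path_to h s u v x y -> wf h u v ->
  h <> Leaf -> outerplanar_path (tgraph h u v).
Proof.
move=> P W N; have [M [rho [o [F [fs [E D _ _]]]]]] := path_to_connecting P W N.
by split=> //; exists rho, o, (F :: fs).
Qed.

End Embedding.

(** * The recursion *)

(* For a polygon [t] with base (a, b), the least possible maximum of [ud] over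
   the parts of [t] hanging from: [ud] an umbrella with cap (a, b), plus one;
   [path_ud] a path from (a, b) to another outer edge; [lfan_ud] the fan of all
   triangles at a; [lpath_ud] the union of that fan with such a path, the fan
   extending a path that leaves it; [rfan_ud], [rpath_ud] the same at b. *)
Record summary := Summary {
  ud : nat; path_ud : nat;
  lfan_ud : nat; lpath_ud : nat; rfan_ud : nat; rpath_ud : nat }.

Definition summary0 := Summary 0 0 0 0 0 0.

(** The alternatives of a minimum are a path leaving the triangle through its left or its right leg.
    In [ud], the part entered by the handle must still take its fan at the end shared with the base,
    and the other part takes its fan at the opposite end; the successor counts the umbrella
    itself. *)
Definition join (L R : summary) := Summary
  (minn (maxn (lpath_ud L) (rfan_ud R)) (maxn (lfan_ud L) (rpath_ud R))).+1
  (minn (maxn (path_ud L) (ud R)) (maxn (ud L) (path_ud R)))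
  (maxn (ud R) (lfan_ud L))
  (minn (maxn (path_ud R) (lfan_ud L)) (maxn (ud R) (lpath_ud L)))
  (maxn (ud L) (rfan_ud R))
  (minn (maxn (path_ud L) (rfan_ud R)) (maxn (ud L) (rpath_ud R))).

Definition swap (S : summary) :=
  Summary (ud S) (path_ud S) (rfan_ud S) (rpath_ud S) (lfan_ud S) (lpath_ud S).

Lemma minmaxC a b c d : minn (maxn a b) (maxn c d) = minn (maxn d c) (maxn b a).
Proof. by rewrite minnC (maxnC a) (maxnC c). Qed.

Lemma join_swap L R : join (swap R) (swap L) = swap (join L R).
Proof. by rewrite /join /swap /=; congr Summary; [congr S|]; apply: minmaxC. Qed.

(** Larger unions of triangles leave less hanging: a fan with a path does at least as well as either
    of them alone, and these do at least as well as leaving the whole part. *)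
Definition monotone (S : summary) :=
  [/\ path_ud S <= ud S, lfan_ud S <= ud S & rfan_ud S <= ud S] /\
  [/\ lpath_ud S <= lfan_ud S, rpath_ud S <= rfan_ud S,
      lpath_ud S <= path_ud S & rpath_ud S <= path_ud S].

Lemma monotone_swap S : monotone S -> monotone (swap S).
Proof. by move=> [[? ? ?] [? ? ? ?]]; split; split. Qed.

Lemma join_monotone L R : monotone L -> monotone R ->
  ud L <= ud (join L R) -> ud R <= ud (join L R) -> monotone (join L R).
Proof.
move=> [[l1 l2 l3] [l4 l5 l6 l7]] [[r1 r2 r3] [r4 r5 r6 r7]] HL HR.
split; split.
- by move: (ud (join L R)) HL HR => x HL HR /=; rewrite geq_min geq_max HR (leq_trans l1).
- by move: (ud (join L R)) HL HR => x HL HR /=; rewrite geq_max HR (leq_trans l2).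
- by move: (ud (join L R)) HL HR => x HL HR /=; rewrite geq_max HL (leq_trans r3).
- by rewrite /= geq_min !geq_max !leq_max !leqnn l4 !orbT.
- by rewrite /= geq_min !geq_max !leq_max !leqnn r5 !orbT.
- by rewrite /= leq_min !geq_min !geq_max !leq_max !leqnn l6 l2 !orbT.
- by rewrite /= leq_min !geq_min !geq_max !leq_max !leqnn r7 r3 !orbT.
Qed.

(** Inside the left part an umbrella of the whole takes a fan at the left end, with or without a
    path. An umbrella of the part itself can take that and a fan at its right end as well. *)
Lemma join_ge_left L1 L2 R : monotone L1 -> monotone L2 ->
  ud (join L1 L2) <= ud (join (join L1 L2) R).
Proof.
move=> [[l1 l2 l3] [l4 l5 l6 l7]] [[r1 r2 r3] [r4 r5 r6 r7]].
rewrite /= ltnS; set X := minn _ _.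
have H1 : X <= minn (maxn (path_ud L2) (lfan_ud L1)) (maxn (ud L2) (lpath_ud L1)).
  by rewrite leq_min !geq_min !geq_max !leq_max !leqnn r3 r7 !orbT.
have H2 : X <= maxn (ud L2) (lfan_ud L1).
  by rewrite geq_min !geq_max !leq_max l4 r3 !orbT.
by rewrite leq_min (leq_trans H1 (leq_maxl _ _)) (leq_trans H2 (leq_maxl _ _)).
Qed.

Lemma ud_swap S : ud (swap S) = ud S. Proof. by []. Qed.

Lemma join_ge_right L R1 R2 : monotone R1 -> monotone R2 ->
  ud (join R1 R2) <= ud (join L (join R1 R2)).
Proof.
move=> M1 M2; rewrite -(ud_swap (join R1 _)) -(ud_swap (join L _)) -!join_swap.
by apply: join_ge_left; apply: monotone_swap.
Qed.

Section Summaries.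

Variable T : finType.
Implicit Types (t s l r h : tree T) (w z : T) (W X : {set T}).

Fixpoint summarize t : summary :=
  if t is Node w l r then join (summarize l) (summarize r) else summary0.

Lemma summarize_mirror t : summarize (mirror t) = swap (summarize t).
Proof. by elim: t => //= w l -> r ->; rewrite join_swap. Qed.

Lemma summarize_monotone t : monotone (summarize t).
Proof.
(* The induction also carries monotonicity of the children, since [join_ge_left] looks two levels
   down. *)
suff [] : monotone (summarize t) /\ forall w l r, t = Node w l r ->
  monotone (summarize l) /\ monotone (summarize r) by [].
elim: t => [|w l [Ml Kl] r [Mr Kr]]; first by [].
split; last by move=> _ _ _ [_ <- <-].
apply: join_monotone => //.
  by case: l Ml Kl => // w' l1 l2 Ml /(_ _ _ _ erefl)[M1 M2]; apply: join_ge_left.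
by case: r Mr Kr => // w' l1 l2 Mr /(_ _ _ _ erefl)[M1 M2]; apply: join_ge_right.
Qed.

Lemma ud_le_size t : ud (summarize t) <= size (inner t).
Proof.
elim: t => //= w l IHl r IHr; rewrite size_cat /=.
have [[_ l2 _] [l4 _ _ _]] := summarize_monotone l.
have [[_ _ r3] _] := summarize_monotone r.
rewrite addnS ltnS geq_min geq_max; apply/orP; left; apply/andP; split.
  exact: leq_trans (leq_trans l4 (leq_trans l2 IHl)) (leq_addr _ _).
exact: leq_trans (leq_trans r3 IHr) (leq_addl _ _).
Qed.

(* The maximum of [ud] over the parts of [s] hanging from its prefix [h]. *)
Fixpoint hang h s : nat :=
  match h, s with
  | Leaf, _ => ud (summarize s)
  | Node _ hl hr, Node _ l r => maxn (hang hl l) (hang hr r)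
  | Node _ _ _, Leaf => 0
  end.

Lemma hang_mirror h s : hang (mirror h) (mirror s) = hang h s.
Proof.
elim: h s => [|w hl IHl hr IHr] s; first by rewrite /= summarize_mirror.
by case: s => //= w' l r; rewrite IHl IHr maxnC.
Qed.

Fixpoint prune s W : tree T :=
  if s is Node w l r then
    if w \in W then Node w (prune l W) (prune r W) else Leaf
  else Leaf.

Lemma prune_mirror s W : prune (mirror s) W = mirror (prune s W).
Proof. by elim: s => //= w l -> r ->; case: ifP. Qed.

Definition rooted s W := if s is Node w _ _ then w \in W else false.

Lemma rooted_mirror s W : rooted (mirror s) W = rooted s W.
Proof. by case: s. Qed.

Lemma hang_unrooted s W : ~~ rooted s W -> hang (prune s W) s = ud (summarize s).
Proof. by case: s => //= w l r /negPf->. Qed.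

Lemma unrooted s W : (forall z, z \in inner s -> z \notin W) -> ~~ rooted s W.
Proof. by case: s => //= w l r; apply; rewrite mem_cat inE eqxx orbT. Qed.

(** Such a set contains, with any vertex beyond a triangle, the apex of that triangle; so [prune]
    loses none of its vertices in [s]. *)
Fixpoint upclosed s X : Prop :=
  if s is Node w l r then
    [/\ w \notin X -> forall z, z \in inner l ++ inner r -> z \notin X,
        upclosed l X & upclosed r X]
  else True.

Lemma upclosed_mirror s X : upclosed s X -> upclosed (mirror s) X.
Proof.
elim: s => //= w l IHl r IHr [H /IHl ? /IHr ?]; split=> // /H K z Hz.
by apply: K; move: Hz; rewrite !mem_cat !inner_mirror !mem_rev orbC.
Qed.

Lemma upclosed_unrooted s X : upclosed s X -> ~~ rooted s X ->
  forall z, z \in inner s -> z \notin X.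
Proof.
case: s => //= w l r [H _ _] N z; move: (N) => /H{}H.
rewrite mem_cat inE => /or3P[Hz|/eqP->//|Hz]; apply: H; rewrite mem_cat Hz //.
by rewrite orbT.
Qed.

Lemma mem_prune s X : upclosed s X -> inner (prune s X) =i [pred z in inner s | z \in X].
Proof.
elim: s => [|w l IHl r IHr] //= [H Ul Ur] z; rewrite !inE mem_cat inE.
case: ifP => [wX|wX]; last have N := H (negbT wX).
  rewrite mem_cat inE (IHl Ul) (IHr Ur) !inE.
  by case: eqP => [->|_]; rewrite ?wX ?orbT //= andb_orl.
move/(_ z): N (negbT wX); rewrite mem_cat; case: eqP => [->|_] /=.
  by move=> _ /negPf->; rewrite andbF.
by case: (_ || _) => //= /(_ isT)/negPf.
Qed.

Fixpoint unbranched s X : bool :=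
  if s is Node w l r then
    (w \in X) ==> [&& ~~ (rooted l X && rooted r X), unbranched l X & unbranched r X]
  else true.

Lemma unbranched_mirror s X : unbranched (mirror s) X = unbranched s X.
Proof.
elim: s => //= w l IHl r IHr; rewrite !rooted_mirror IHl IHr.
by rewrite (andbC (rooted r X)) (andbC (unbranched r X)).
Qed.

Fixpoint lspine t := if t is Node w l r then w :: lspine l else [::].
Fixpoint rspine t := if t is Node w l r then w :: rspine r else [::].

Lemma lspine_inner t : {subset lspine t <= inner t}.
Proof.
elim: t => //= w l IHl r _ z; rewrite inE mem_cat inE => /orP[->|/IHl->//].
by rewrite orbT.
Qed.

Lemma lspine_mirror t : lspine (mirror t) = rspine t.
Proof. by elim: t => //= w l _ r ->. Qed.

Lemma fanL_lspine t b : fanL t b = b :: lspine t.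
Proof. by elim: t b => //= w l IHl r _ b; rewrite IHl. Qed.

Lemma fanR_rspine t a : fanR t a = a :: rspine t.
Proof. by elim: t a => //= w l _ r IHr a; rewrite IHr. Qed.

(** * Lower bounds for the parts hanging from an umbrella *)

(** [X] stands for the handle and [W] for the umbrella, here in a part out of reach of the fans. The
    handle enters at most one child, and the other hangs whole, as in one alternative of [join]; if
    [W] stops at once, monotonicity applies. *)
Lemma path_ud_le s X W : unbranched s X ->
  (forall z, z \in inner s -> z \in W -> z \in X) ->
  path_ud (summarize s) <= hang (prune s W) s.
Proof.
elim: s => [|w l IHl r IHr] //= B S; have [[M _ _] _] := summarize_monotone (Node w l r).
case: ifP => wW //=; have wX : w \in X by apply: S; rewrite // mem_cat inE eqxx orbT.
move: B; rewrite wX => /and3P[/nandP N Bl Br].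
have Sl z : z \in inner l -> z \in W -> z \in X.
  by move=> Hz; apply: S; rewrite mem_cat Hz.
have Sr z : z \in inner r -> z \in W -> z \in X.
  by move=> Hz; apply: S; rewrite mem_cat inE Hz !orbT.
have R s : (forall z, z \in inner s -> z \in W -> z \in X) -> ~~ rooted s X ->
    hang (prune s W) s = ud (summarize s).
  move=> Ss Ns; apply: hang_unrooted; case: s Ss Ns => //= w' l' r' Ss.
  by apply: contraNN; apply: Ss; rewrite mem_cat inE eqxx orbT.
have {}IHl := IHl Bl Sl; have {}IHr := IHr Br Sr.
case: N => /R => [/(_ Sl)|/(_ Sr)] ->.
  by rewrite geq_min !geq_max !leq_max !leqnn IHr !orbT.
by rewrite geq_min !geq_max !leq_max !leqnn IHl !orbT.
Qed.

Lemma uniq_node w l r : uniq (inner (Node w l r)) ->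
  [/\ uniq (inner l), uniq (inner r), w \notin inner l, w \notin inner r
    & forall z, z \in inner r -> z \notin inner l].
Proof.
rewrite /= cat_uniq /= negb_or => /and3P[-> /andP[-> /hasPn H] /andP[-> ->]].
by split=> // z /H.
Qed.

Lemma lfan_ud_le s W : uniq (inner s) ->
  (forall z, z \in inner s -> z \in W -> z \in lspine s) ->
  lfan_ud (summarize s) <= hang (prune s W) s.
Proof.
elim: s => [|w l IHl r IHr] // U S; have [[_ M _] _] := summarize_monotone (Node w l r).
have [Ul Ur wl wr D] := uniq_node U.
rewrite /=; case: ifP => wW //=.
rewrite (hang_unrooted (s := r)).
  have := IHl Ul; suff K : forall z, z \in inner l -> z \in W -> z \in lspine l.
    by move/(_ K) => Hl; rewrite geq_max !leq_max !leqnn Hl !orbT.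
  move=> z zl zW; have := S z _ zW; rewrite /= mem_cat zl => /(_ isT).
  by rewrite inE => /orP[/eqP E|//]; rewrite -E zl in wl.
apply: unrooted => z zr; apply/negP => zW.
have := S z _ zW; rewrite /= mem_cat inE zr !orbT => /(_ isT).
rewrite inE => /orP[/eqP E|/lspine_inner zl]; first by rewrite -E zr in wr.
by case/negP: (D _ zr).
Qed.

(** Where the handle no longer goes, only fan triangles can be in [W], and [lpath_ud] is at most
    [lfan_ud]. *)
Lemma lpath_ud_le s X W : uniq (inner s) -> upclosed s X -> unbranched s X ->
  (forall z, z \in inner s -> z \in W -> z \in X \/ z \in lspine s) ->
  lpath_ud (summarize s) <= hang (prune s W) s.
Proof.
elim: s => [|w l IHl r IHr] // U C B S.
have [[Mp Ml _] [M _ _ _]] := summarize_monotone (Node w l r).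
case: (boolP (w \in X)) => wX; last first.
  apply: leq_trans M _; apply: lfan_ud_le => // z zs zW.
  by case: (S z zs zW) => // zX; by case/negP: (upclosed_unrooted C wX zs).
have [Ul Ur wl wr D] := uniq_node U; case: C => _ Cl Cr.
have Sl z : z \in inner l -> z \in W -> z \in X \/ z \in lspine l.
  move=> zl zW; have := S z _ zW; rewrite /= mem_cat zl => /(_ isT)[|]; first by left.
  by rewrite inE => /orP[/eqP E|]; [rewrite -E zl in wl | right].
have Sr z : z \in inner r -> z \in W -> z \in X.
  move=> zr zW; have := S z _ zW; rewrite /= mem_cat inE zr !orbT => /(_ isT)[//|].
  rewrite inE => /orP[/eqP E|/lspine_inner zl]; first by rewrite -E zr in wr.
  by case/negP: (D _ zr).
move: B => /=; rewrite wX => /and3P[/nandP N Bl Br].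
case: ifP => wW //; last by apply: leq_trans M Ml.
rewrite [hang _ _]/=; case: N => N.
  have Al : lfan_ud (summarize l) <= hang (prune l W) l.
    apply: lfan_ud_le => // z zl zW; case: (Sl z zl zW) => // zX.
    by case/negP: (upclosed_unrooted Cl N zl).
  by rewrite /= geq_min !geq_max !leq_max Al (path_ud_le Br Sr) !orbT.
rewrite (hang_unrooted (s := r)).
  by rewrite /= geq_min !geq_max !leq_max !leqnn (IHl Ul Cl Bl Sl) !orbT.
apply: unrooted => z zr; apply/negP => /(Sr _ zr) zX.
by case/negP: (upclosed_unrooted Cr N zr).
Qed.

(** The child avoided by the handle contains fan triangles only, the other one a fan with a path.
    The right child is treated through its reflection. *)
Lemma ud_le w l r X W : uniq (inner (Node w l r)) ->
  upclosed (Node w l r) X -> unbranched (Node w l r) X -> w \in X -> w \in W ->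
  (forall z, z \in inner (Node w l r) -> z \in W ->
     [\/ z \in X, z \in lspine (Node w l r) | z \in rspine (Node w l r)]) ->
  ud (summarize (Node w l r)) <= (hang (prune (Node w l r) W) (Node w l r)).+1.
Proof.
move=> U [_ Cl Cr] B wX wW S.
have [Ul Ur wl wr D] := uniq_node U.
have rspine_inner z : z \in rspine r -> z \in inner r.
  by rewrite -lspine_mirror => /lspine_inner; rewrite inner_mirror mem_rev.
have Sl z : z \in inner l -> z \in W -> z \in X \/ z \in lspine l.
  move=> zl zW; have := S z _ zW; rewrite /= mem_cat zl !inE => /(_ isT).
  case: eqP => [E|_]; first by rewrite -E zl in wl.
  by case; auto => /rspine_inner/D; rewrite zl.
have Sr z : z \in inner (mirror r) -> z \in W -> z \in X \/ z \in lspine (mirror r).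
  rewrite inner_mirror mem_rev lspine_mirror.
  move=> zr zW; have := S z _ zW; rewrite /= mem_cat !inE zr !orbT => /(_ isT).
  case: eqP => [E|_]; first by rewrite -E zr in wr.
  by case; auto => /lspine_inner zl; case/negP: (D _ zr).
have Ur' : uniq (inner (mirror r)) by rewrite inner_mirror rev_uniq.
have Cr' := upclosed_mirror Cr.
move: B => /=; rewrite wX wW => /and3P[/nandP N Bl Br].
have Br' : unbranched (mirror r) X by rewrite unbranched_mirror.
have El : hang (prune (mirror r) W) (mirror r) = hang (prune r W) r.
  by rewrite prune_mirror hang_mirror.
have Sw := summarize_mirror r.
rewrite /=; case: N => N.
  have Al : lfan_ud (summarize l) <= hang (prune l W) l.
    apply: lfan_ud_le => // z zl zW; case: (Sl z zl zW) => // zX.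
    by case/negP: (upclosed_unrooted Cl N zl).
  have := lpath_ud_le Ur' Cr' Br' Sr; rewrite El Sw /= => Ar.
  by rewrite ltnS geq_min !geq_max !leq_max Al Ar !orbT.
have Al := lpath_ud_le Ul Cl Bl Sl.
have : lfan_ud (summarize (mirror r)) <= hang (prune (mirror r) W) (mirror r).
  apply: lfan_ud_le => // z zr zW; case: (Sr z zr zW) => // zX.
  by move: zr; rewrite inner_mirror mem_rev => zr; by case/negP: (upclosed_unrooted Cr N zr).
rewrite El Sw /= => Ar.
by rewrite ltnS geq_min !geq_max !leq_max Al Ar !orbT.
Qed.

End Summaries.

(** * Umbrellas of a triangulated polygon *)

Lemma tight_arith (e n k : nat) : 2 <= n -> k <= (n - 2).*2.+1 ->
  e <= k -> e + 3 <= 2 * n.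
Proof. lia. Qed.

Lemma tight_size (e n : nat) : 2 <= n -> e + 3 = 2 * n -> (n - 2).*2.+1 <= e.
Proof. lia. Qed.

(** Two tight graphs sharing one edge and [k] vertices have a union with [2n - 3 + 2(k - 2)] edges,
    so the bound for the union forces [k = 2]. *)
Lemma glue_arith (e1 e2 n1 n2 k e n : nat) : e1 + 3 = 2 * n1 -> e2 + 3 = 2 * n2 ->
  e = e1 + e2 - 1 -> n = n1 + n2 - k -> 2 <= k -> e + 3 <= 2 * n -> 2 <= n1 -> 2 <= n2 ->
  e + 3 = 2 * n.
Proof. lia. Qed.

Section Umbrellas.

Variable T : finType.
Implicit Types (t s l r : tree T) (a b c u v w x y z : T) (e : {set T}).
Implicit Types (G H K : graph T) (W X : {set T}).

(* The number of edges of a maximal outerplanar graph, which is the maximum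
   for a subgraph of such a graph. *)
Definition tight H := #|edges H| + 3 = 2 * #|vertices H|.

Section FixTree.

Variables (t : tree T) (u v : T).
Hypothesis W : wf t u v.
Let G := tgraph t u v.

Definition feet_spec w (p : T * T) := forall a b, ear t u v w a b -> p = (a, b).

Lemma feet_exists : exists f : T -> T * T, forall w, feet_spec w (f w).
Proof.
apply: (@fin_all_exists T (fun => (T * T)%type) feet_spec) => w.
case: (boolP (w \in inner t)) => [/(earP u v)[a [b E]]|N].
  by exists (a, b) => a' b' /(ear_unique W E)[-> ->].
by exists (w, w) => a b /ear_inner; rewrite (negPf N).
Qed.

Section Subgraph.
Variable H : graph T.
Hypotheses (SH : simple_graph H) (HG : subgraph H G).
Hypotheses (uH : u \in vertices H) (vH : v \in vertices H).

Let X := vertices H :\: [set u; v].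

Let card_X : #|X| = #|vertices H| - 2 /\ 2 <= #|vertices H|.
Proof.
have S : [set u; v] \subset vertices H by rewrite subUset !sub1set uH vH.
have C : #|[set u; v]| = 2 by rewrite cards2 (wf_neq W).
by rewrite cardsDS // C; split=> //; rewrite -C subset_leq_card.
Qed.

Let edges_cover (f : T -> T * T) : (forall w, feet_spec w (f w)) ->
  edges H \subset [set u; v] |:
    ([set [set (f w).1; w] | w in X] :|: [set [set w; (f w).2] | w in X]).
Proof.
move=> F; apply/subsetP => e He; have := subsetP (proj2 (andP HG)) _ He.
have /andP[_ S] : (#|e| == 2) && (e \subset vertices H).
  by have := forallP SH e; rewrite He.
case/tedges_ear => [->|[w [a [b [E Ee]]]]]; first by rewrite !inE eqxx.
have wH : w \in vertices H.
  by apply: (subsetP S); case: Ee => ->; rewrite ?set21 ?set22.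
have [_ _ _ wu wv] := ear_neq W E.
have wX : w \in X by rewrite !inE negb_or wu wv.
rewrite !inE; apply/or3P; case: Ee => ->; [apply: Or32|apply: Or33]; apply/imsetP;
  by exists w => //; rewrite (F w a b E).
Qed.

Let card_cover (f : T -> T * T) :
  #|[set u; v] |: ([set [set (f w).1; w] | w in X] :|: [set [set w; (f w).2] | w in X])|
    <= (#|vertices H| - 2).*2.+1.
Proof.
rewrite -card_X.1 -addn1 -addnn addnC.
apply: leq_trans (leq_card_setU _ _).1 _; rewrite cards1 leq_add2l.
apply: leq_trans (leq_card_setU _ _).1 _.
by apply: leq_add; apply: leq_imset_card.
Qed.

(* Besides (u, v), there are just the two edges from each vertex to its feet. *)
Lemma subgraph_edge_bound : #|edges H| + 3 <= 2 * #|vertices H|.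
Proof.
have [f F] := feet_exists.
exact: tight_arith card_X.2 (card_cover f) (subset_leq_card (edges_cover F)).
Qed.

Hypothesis TH : tight H.

Lemma tight_edges : [set u; v] \in edges H /\ forall w a b,
  ear t u v w a b -> w \in vertices H ->
  [set a; w] \in edges H /\ [set w; b] \in edges H.
Proof.
have [f F] := feet_exists.
have E : edges H = [set u; v] |: ([set [set (f w).1; w] | w in X]
    :|: [set [set w; (f w).2] | w in X]).
  apply/eqP; rewrite eqEcard edges_cover //=; apply: leq_trans (card_cover f) _.
  exact: tight_size card_X.2 TH.
rewrite E; split; first by rewrite !inE eqxx.
move=> w a b Ew wH; have [_ _ _ wu wv] := ear_neq W Ew.
have wX : w \in X by rewrite !inE negb_or wu wv.
by split; rewrite !inE; apply/or3P; [apply: Or32|apply: Or33]; apply/imsetP;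
  exists w => //; rewrite (F w a b Ew).
Qed.

Lemma tight_closed w a b : ear t u v w a b -> w \in vertices H ->
  (a \in vertices H) && (b \in vertices H).
Proof.
move=> E wH; have [_ /(_ _ _ _ E wH)[Ea Eb]] := tight_edges.
have /andP[-> _] := simple_adj_vertices SH Ea.
by have /andP[_ ->] := simple_adj_vertices SH Eb.
Qed.

Lemma tight_induced e : e \in tedges t u v -> e \subset vertices H -> e \in edges H.
Proof.
have [Euv Ee] := tight_edges.
case/tedges_ear => [->//|[w [a [b [E D]]]]] S.
have wH : w \in vertices H.
  by apply: (subsetP S); case: D => ->; rewrite ?set21 ?set22.
by have [? ?] := Ee _ _ _ E wH; case: D => ->.
Qed.

End Subgraph.

(** An apex on (x, y) that belongs to [X] would force both ends into [X]. So it does not belong to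
    [X], and the same argument applies to the two parts beyond it. *)
Lemma unclosed_disjoint s x y X : (forall w a b, ear s x y w a b ->
    w \in X -> (a \in X) && (b \in X)) ->
  (x \notin X) || (y \notin X) -> forall z, z \in inner s -> z \notin X.
Proof.
elim: s x y => //= w l IHl r IHr x y C N.
have wX : w \notin X.
  have := C w x y; case: (w \in X) => // /(_ _ isT); case: (x \in X) N => /=;
  case: (y \in X) => //= _ K; apply: K; by exists l, r; constructor.
have Cl p a b : ear l x w p a b -> p \in X -> (a \in X) && (b \in X).
  by move=> [l' [r' L]]; apply: C; exists l', r'; constructor.
have Cr p a b : ear r w y p a b -> p \in X -> (a \in X) && (b \in X).
  by move=> [l' [r' L]]; apply: C; exists l', r'; constructor.
move=> z; rewrite mem_cat inE => /or3P[|/eqP->//|].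
  by apply: (IHl x w) => //; rewrite wX orbT.
by apply: (IHr w y) => //; rewrite wX.
Qed.

Lemma closed_upclosed s x y X : (forall w a b, ear s x y w a b ->
    w \in X -> (a \in X) && (b \in X)) -> upclosed s X.
Proof.
elim: s x y => //= w l IHl r IHr x y C.
have Cl p a b : ear l x w p a b -> p \in X -> (a \in X) && (b \in X).
  by move=> [l' [r' L]]; apply: C; exists l', r'; constructor.
have Cr p a b : ear r w y p a b -> p \in X -> (a \in X) && (b \in X).
  by move=> [l' [r' L]]; apply: C; exists l', r'; constructor.
split; [|exact: IHl Cl|exact: IHr Cr].
move=> wX z; rewrite mem_cat => /orP[].
  by apply: (unclosed_disjoint Cl); rewrite wX orbT.
by apply: (unclosed_disjoint Cr); rewrite wX.
Qed.

Lemma prune_located s X x y c d s' : located (prune s X) x y s' c d ->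
  s' = Leaf \/ exists w l r, s' = Node w (prune l X) (prune r X) /\ w \in X /\
    located s x y (Node w l r) c d.
Proof.
elim: s x y => [|w l IHl r IHr] x y /=; first by move=> L; inversion L; left.
case: ifP => wX L; last by inversion L; left.
inversion L; subst.
- by right; exists w, l, r; split=> //; split=> //; constructor.
- have K : located (prune l X) x w s' c d by [].
  by case: (IHl _ _ K) => [|[w' [l' [r' [E1 [E2 E3]]]]]]; [by left|right;
    exists w', l', r'; split=> //; split=> //; constructor].
- have K : located (prune r X) w y s' c d by [].
  by case: (IHr _ _ K) => [|[w' [l' [r' [E1 [E2 E3]]]]]]; [by left|right;
    exists w', l', r'; split=> //; split=> //; constructor].
Qed.

Lemma prune_subseq s X : subseq (inner (prune s X)) (inner s).
Proof.
elim: s => //= w l IHl r IHr; case: ifP => _; last exact: sub0seq.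
by apply: cat_subseq => //=; rewrite eqxx.
Qed.

(** Containing the feet of its apexes makes the vertex set a prefix; the edges of this prefix are
    present by tightness, and equal counts leave no others. *)
Lemma tight_tree H : simple_graph H -> subgraph H G -> u \in vertices H ->
  v \in vertices H -> tight H -> upclosed t (vertices H) /\
  H = tgraph (prune t (vertices H)) u v.
Proof.
move=> SH HG uH vH TH; have Cl := tight_closed SH HG uH vH TH.
have U : upclosed t (vertices H) := closed_upclosed Cl; split=> //.
have Wp : wf (prune t (vertices H)) u v.
  move: W; rewrite /wf /outer.
  apply: subseq_uniq; rewrite /= eqxx -!cats1.
  exact: cat_subseq (prune_subseq _ _) (subseq_refl _).
have EV : [set x in outer (prune t (vertices H)) u v] = vertices H.
  apply/setP => x; rewrite in_set mem_outer (mem_prune U) inE.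
  have xG : x \in vertices H -> x \in outer t u v.
    by move=> xH; have := subsetP (proj1 (andP HG)) _ xH; rewrite in_set.
  apply/or3P/idP => [[/eqP->|/eqP->|/andP[]]//|xH]; have := xG xH.
  by rewrite mem_outer => /or3P[|| ->]; [apply: Or31|apply: Or32|rewrite xH; apply: Or33].
have EE : tedges (prune t (vertices H)) u v = edges H.
  apply/eqP; rewrite eqEcard; apply/andP; split.
    have [Euv Ee] := tight_edges SH HG uH vH TH.
    apply/subsetP => e /tedges_ear[->//|[w [a [b [[l [r L]] D]]]]].
    case: (prune_located L) => // [[w' [l' [r' [[E _ _] [wX L']]]]]]; subst w'.
    have Ew : ear t u v w a b by exists l', r'.
    by case: (Ee _ _ _ Ew wX) => ? ?; case: D => ->.
  have C : #|vertices H| = (size (inner (prune t (vertices H)))).+2.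
    by rewrite -{1}EV cardsE (card_uniqP Wp) /outer /= size_rcons.
  move: TH; rewrite /tight (card_tedges Wp) C.
  move: (size _) #|_| => i j; lia.
by rewrite /tgraph EV EE; case: (H).
Qed.

Lemma graph_union_simple H K : simple_graph H -> simple_graph K ->
  simple_graph (graph_union H K).
Proof.
move=> /forallP SH /forallP SK; apply/forallP => e; apply/implyP; rewrite inE.
case/orP => He.
  have := SH e; rewrite He /= => /andP[-> S]; exact: subset_trans S (subsetUl _ _).
have := SK e; rewrite He /= => /andP[-> S]; exact: subset_trans S (subsetUr _ _).
Qed.

Lemma graph_union_sub H K G' : subgraph H G' -> subgraph K G' ->
  subgraph (graph_union H K) G'.
Proof.
by move=> /andP[V1 E1] /andP[V2 E2]; rewrite /subgraph /= !subUset V1 E1 V2 E2.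
Qed.

(* If [K] met [H] in more than the ends of [e], the union would have too many
   edges. *)
Lemma tight_glue H K e : simple_graph H -> simple_graph K ->
  subgraph H G -> subgraph K G -> u \in vertices H -> v \in vertices H ->
  tight H -> tight K -> edges H :&: edges K = [set e] ->
  tight (graph_union H K).
Proof.
move=> SH SK HG KG uH vH TH TK Ee.
have eH : e \in edges H :&: edges K by rewrite Ee inE.
move: eH; rewrite inE => /andP[eH eK].
have /andP[/eqP e2 eVH] : (#|e| == 2) && (e \subset vertices H).
  by have := forallP SH e; rewrite eH.
have /andP[_ eVK] : (#|e| == 2) && (e \subset vertices K).
  by have := forallP SK e; rewrite eK.
have k2 : 2 <= #|vertices H :&: vertices K|.
  by rewrite -e2 subset_leq_card // subsetI eVH.
have B := subgraph_edge_bound (graph_union_simple SH SK) (graph_union_sub HG KG) _ _.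
apply: glue_arith TH TK _ _ k2 (B _ _) _ _.
- by rewrite /= cardsU Ee cards1.
- by rewrite /= cardsU.
- by rewrite inE uH.
- by rewrite inE vH.
- by rewrite -e2 subset_leq_card.
- by rewrite -e2 subset_leq_card.
Qed.

End FixTree.

Implicit Types (h : tree T) (d : T) (S U P F : graph T) (f : {set T * T}).

Lemma edge_in_pair e x y : #|e| = 2 -> e \subset [set x; y] -> e = [set x; y].
Proof.
by move=> e2 S; apply/eqP; rewrite eqEcard S e2 cards2; case: (x != y).
Qed.

Lemma mem_tgraph t u v z : (z \in vertices (tgraph t u v)) = (z \in outer t u v).
Proof. by rewrite in_set. Qed.

Lemma located_base t u v s x y : wf t u v -> located t u v s x y ->
  [set x; y] = [set u; v] -> s = t.
Proof.
move=> W L E; case: (located_parent L) => [[]//|[w [l [r [a [b [L' D]]]]]]].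
have wN : w \notin [set u; v].
  by rewrite !inE negb_or; apply: wf_in_neq (located_node_inner L').
by move: wN; rewrite -E; case: D => [[_ -> _]|[-> _ _]]; rewrite !inE eqxx ?orbT.
Qed.

(** * Hanging subgraphs and anchor-edges *)

Section FixTree.

Variables (t : tree T) (u v : T).
Hypothesis W : wf t u v.
Let G := tgraph t u v.

Section Hanging.

Variables (s : tree T) (x y : T).
Hypotheses (L : located t u v s x y) (Ns : s <> Leaf) (Nb : [set x; y] != [set u; v]).

Lemma located_rest : exists t', [/\ wf t' u v, t' <> Leaf, located t' u v Leaf x y,
  tedges t u v = tedges t' u v :|: tedges s x y &
  (forall z, (z \in outer t u v) = (z \in outer t' u v) || (z \in outer s x y)) /\
  (forall z, z \in outer t' u v -> z \notin inner s)].
Proof.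
have [t' [P E L' NL]] := located_split L; have [Wt' D] := split_wf W P.
exists t'; split=> //; first by move/NL => [_ [Eu Ev]]; move: Nb; rewrite Eu Ev eqxx.
split=> // z; have /andP[xt yt] := located_ends L'.
rewrite (perm_mem (split_perm u v P)) mem_cat (mem_outer s).
case: (boolP (z \in outer t' u v)) => //= zt.
have -> : z == x = false by apply/negP => /eqP Ez; rewrite Ez xt in zt.
by have -> : z == y = false by apply/negP => /eqP Ez; rewrite Ez yt in zt.
Qed.

Lemma hanging_exists : hanging_subgraph G u v [set x; y] (tgraph s x y).
Proof.
have Ws := located_wf L W.
have [t' [Wt' Nt' L' E [EV D]]] := located_rest.
have both z : z \in outer s x y -> z \in outer t' u v -> z \in [set x; y].
  by move=> zs /D /negPf zi; move: zs; rewrite mem_outer zi orbF in_set2.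
split.
  apply/negP => H; case/negP: Nb; rewrite eq_sym; apply/eqP.
  apply: edge_in_pair; first by rewrite cards2 (wf_neq W).
  apply/subsetP => z zuv; apply: both; first exact: tedges_outer H zuv.
  by move: zuv; rewrite in_set2 => /orP[] /eqP->; rewrite mem_outer eqxx ?orbT.
exists (tgraph t' u v); split.
- exact: tgraph_maximal_outerplanar.
- exact: tgraph_maximal_outerplanar.
- split.
    apply/setP => z; rewrite in_setI !mem_tgraph; apply/andP/idP => [[]|].
      exact: both.
    have /andP[xt yt] := located_ends L'.
    by rewrite in_set2 => /orP[] /eqP->; rewrite ?xt ?yt mem_outer eqxx ?orbT.
  apply/setP => e; rewrite in_setI in_set1; apply/andP/eqP => [[es et]|->]; last first.
    by split; [apply: tedges_base | apply: (subsetP (located_edges L')) (tedges_base _ _ _)].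
  apply: edge_in_pair (tedges_card Ws es) _.
  by apply/subsetP => z ze; apply: both; [apply: tedges_outer es ze|apply: tedges_outer et ze].
- congr Graph; last by rewrite /= E setUC.
  by apply/setP => z; rewrite in_setU !mem_tgraph orbC -EV.
Qed.

(** A cut-component is given only by its properties. Off the two ends of the edge its vertex set is
    closed under adjacency in [G], so it is determined by the connected pieces that it meets. *)
Lemma hanging_unique S : hanging_subgraph G u v [set x; y] S -> S = tgraph s x y.
Proof.
move=> [NS [S' [MS MS' [VI EI] UG]]]; set e := [set x; y] in VI EI.
have Ws := located_wf L W.
have [t' [Wt' Nt' L' E [EV D]]] := located_rest.
have [SS S3 _] := MS; have [SS' S3' _] := MS'.
have GE e' : e' \in tedges t u v = (e' \in edges S) || (e' \in edges S').
  by rewrite -[tedges t u v]/(edges G) -UG in_setU.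
have GV z : z \in outer t u v = (z \in vertices S) || (z \in vertices S').
  by rewrite -in_setU -[_ :|: _]/(vertices (graph_union S S')) UG in_set.
have eS : e \subset vertices S by rewrite -VI subsetIl.
have adjG c d : [set c; d] \in edges G -> c \in vertices S -> c \notin e -> d \in vertices S.
  move=> H cS ce; move: H; rewrite GE => /orP[] H.
    by have /andP[] := simple_adj_vertices SS H.
  have /andP[cS' _] := simple_adj_vertices SS' H.
  by move: ce; rewrite -VI inE cS cS'.
have Cl c d : connect (adj (delete_vertices G e)) c d -> c \in vertices S -> d \in vertices S.
  move/connectP => [p Hp ->]; elim: p c Hp => //= z p IH c /andP[].
  by rewrite adj_delete => /and3P[H ce _] Hp cS; apply: IH Hp (adjG _ _ H cS ce).
have [Vu Vv] : u \in outer t' u v /\ v \in outer t' u v.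
  by rewrite !mem_outer !eqxx orbT.
(* A vertex of [S] outside the part would bring in all of [t'], hence [u] and [v]. The root edge
   lies in [S'], so both would belong to [S] and [S'], that is, to [e]. *)
have inI c : c \in vertices S -> c \notin e -> c \in inner s.
  move=> cS ce; have : c \in outer t u v by rewrite GV cS.
  rewrite EV => /orP[ct|]; last first.
    by rewrite mem_outer => /or3P[||//] /eqP Ec; move: ce; rewrite Ec !inE eqxx ?orbT.
  have Ot' d : d \in outer t' u v -> d \in vertices S.
    move=> dt; case: (boolP (d \in e)) => [/(subsetP eS)//|de].
    apply: Cl cS; apply: rest_connected Wt' L' _ ct dt ce de.
    by rewrite E subsetUl.
  have := tedges_base t u v; rewrite GE (negPf NS) /= => H.
  have /andP[uS' vS'] := simple_adj_vertices SS' H.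
  case/negP: Nb; rewrite eq_sym; apply/eqP.
  apply: edge_in_pair; first by rewrite cards2 (wf_neq W).
  by rewrite -/e -VI subUset !sub1set !in_setI !Ot' // uS' vS'.
(* [S] has at least three vertices, so it meets the interior of the part and then contains all of
   it. *)
have [c cS ce] : exists2 c, c \in vertices S & c \notin e.
  have : ~~ (vertices S \subset e).
    apply/negP => /subset_leq_card; rewrite cards2 => H.
    by have := leq_trans S3 H; case: (_ != _).
  by case/subsetPn => c; exists c.
have VS z : (z \in vertices S) = (z \in outer s x y).
  apply/idP/idP => [zS|].
    case: (boolP (z \in e)) => [|/(inI _ zS) zi]; rewrite mem_outer.
      by rewrite !inE => /orP[] ->; rewrite ?orbT.
    by rewrite zi !orbT.
  rewrite mem_outer orbA => /orP[H|zi]; first by apply: (subsetP eS); rewrite in_set2.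
  exact: Cl (inner_connected W L (inI _ cS ce) zi) cS.
have ES : edges S = tedges s x y.
  apply/setP => e'; apply/idP/idP => H.
    have HG : e' \in tedges t u v by rewrite GE H.
    have [//|N] := located_sep W L HG.
    suff -> : e' = [set x; y] by exact: tedges_base.
    apply: edge_in_pair (tedges_card W HG) _; apply/subsetP => z ze.
    have := N z ze; have /andP[_ /subsetP/(_ z ze)] : (#|e'| == 2) && (e' \subset vertices S).
      by have := forallP SS e'; rewrite H.
    by rewrite VS mem_outer in_set2 orbA => /orP[//|->].
  have := subsetP (located_edges L) _ H; rewrite GE => /orP[//|HS'].
  have Ee : e' = e.
    apply: edge_in_pair (tedges_card Ws H) _; apply/subsetP => z ze; rewrite -/e -VI.
    rewrite in_setI VS (tedges_outer H ze).
    have /andP[_ /subsetP/(_ z ze)//] : (#|e'| == 2) && (e' \subset vertices S').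
    by have := forallP SS' e'; rewrite HS'.
  have : e \in edges S :&: edges S' by rewrite EI inE.
  by rewrite Ee inE => /andP[].
rewrite /tgraph -ES.
have -> : [set z in outer s x y] = vertices S by apply/setP => z; rewrite in_set VS.
by case: (S).
Qed.

End Hanging.

End FixTree.

(* [hanging h t u v s x y]: [s] is the part of [t] hanging from its prefix [h]
   at the edge (x, y). *)
Inductive hanging : tree T -> tree T -> T -> T -> tree T -> T -> T -> Prop :=
| HangHere t u v : hanging Leaf t u v t u v
| HangLeft w h h' l r u v s x y of hanging h l u w s x y :
    hanging (Node w h h') (Node w l r) u v s x y
| HangRight w h h' l r u v s x y of hanging h r w v s x y :
    hanging (Node w h' h) (Node w l r) u v s x y.

Lemma hanging_located h t u v s x y : hanging h t u v s x y ->
  located t u v s x y /\ located h u v Leaf x y.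
Proof.
by elim=> [*|? ? ? ? ? ? ? ? ? ? _ [? ?]|? ? ? ? ? ? ? ? ? ? _ [? ?]]; split; constructor.
Qed.

Fixpoint prefix h t : Prop :=
  match h, t with
  | Leaf, _ => True
  | Node w hl hr, Node w' l r => [/\ w = w', prefix hl l & prefix hr r]
  | Node _ _ _, Leaf => False
  end.

Lemma prefix_mirror h t : prefix h t -> prefix (mirror h) (mirror t).
Proof. by elim: h t => [|w hl IHl hr IHr] [|w' l r] //= [-> /IHl ? /IHr ?]. Qed.

Lemma prune_prefix t X : prefix (prune t X) t.
Proof. by elim: t => //= w l IHl r IHr; case: ifP. Qed.

Lemma prefix_subseq h t : prefix h t -> subseq (inner h) (inner t).
Proof.
elim: h t => [|w hl IHl hr IHr] [|w' l r] //=; first by move=> _; apply: sub0seq.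
by move=> [<- /IHl Hl /IHr Hr]; apply: (cat_subseq Hl); rewrite /= eqxx.
Qed.

Lemma prefix_wf h t u v : prefix h t -> wf t u v -> wf h u v.
Proof.
move=> /prefix_subseq S; apply: subseq_uniq; rewrite /outer /= eqxx -!cats1.
exact: cat_subseq S (subseq_refl _).
Qed.

Lemma prefix_edges h t u v : prefix h t -> tedges h u v \subset tedges t u v.
Proof.
elim: h t u v => [|w hl IHl hr IHr] [|w' l r] u v //=; rewrite ?sub1set ?tedges_base //.
  by move=> _; rewrite in_setU1 eqxx.
by move=> [<- /IHl Hl /IHr Hr]; apply: setUS; apply: setUSS.
Qed.

Lemma prefix_subgraph h t u v : prefix h t -> subgraph (tgraph h u v) (tgraph t u v).
Proof.
move=> P; apply/andP; split; last exact: prefix_edges.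
apply/subsetP => x; rewrite !in_set !mem_outer => /or3P[->|->|] //; rewrite ?orbT //.
by move/(mem_subseq (prefix_subseq P)) => ->; rewrite !orbT.
Qed.

Lemma prefix_hanging h t u v x y : prefix h t -> located h u v Leaf x y ->
  exists s, hanging h t u v s x y.
Proof.
elim: h t u v => [|w hl IHl hr IHr] [|w' l r] u v //=.
- by move=> _ L; inversion L; subst; exists Leaf; constructor.
- by move=> _ L; inversion L; subst; exists (Node w' l r); constructor.
move=> [<- Pl Pr] L; inversion L; subst.
  have L' : located hl u w Leaf x y by [].
  by have [s H] := IHl _ _ _ Pl L'; exists s; constructor.
have L' : located hr w v Leaf x y by [].
by have [s H] := IHr _ _ _ Pr L'; exists s; constructor.
Qed.

Lemma hanging_le h t u v s x y : hanging h t u v s x y ->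
  ud (summarize s) <= hang h t.
Proof.
by elim=> [|? ? ? ? ? ? ? ? ? ? _ H|? ? ? ? ? ? ? ? ? ? _ H] //=;
  rewrite leq_max H ?orbT.
Qed.

Lemma hang_bound h t u v M : prefix h t ->
  (forall s x y, s <> Leaf -> hanging h t u v s x y -> ud (summarize s) <= M) ->
  hang h t <= M.
Proof.
elim: h t u v => [|w hl IHl hr IHr] t u v.
  by case: t => // w l r _ H; apply: (H (Node w l r) u v) => //; constructor.
case: t => //= w' l r [<- Pl Pr] H; rewrite geq_max (IHl l u w) ?(IHr r w v) //;
  by move=> s x y N K; apply: (H s x y) => //; constructor.
Qed.

Lemma leaf_not_base h u v x y : wf h u v -> h <> Leaf -> located h u v Leaf x y ->
  [set x; y] != [set u; v].
Proof. by move=> W N L; apply/eqP => /(located_base W L) E; apply: N. Qed.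

(** The non-cutting edges of the graph of [h] are its base and its leaves. The base does not cut [t]
    either, and a leaf of [h] cuts it exactly when [t] has a triangle beyond it. *)
Lemma anchor_hanging h t u v e : wf t u v -> prefix h t -> h <> Leaf ->
  e \in anchor_edges (tgraph t u v) (tgraph h u v) <->
  exists s x y, [/\ hanging h t u v s x y, s <> Leaf & e = [set x; y]].
Proof.
move=> W P N; have Wh := prefix_wf P W; rewrite inE; split.
  case/and3P=> He Ct Ch; case/tedgesP: (He) => [hs [x [y [L E]]]].
  case: hs L => [|w l r] L; last first.
    case: (eqVneq [set x; y] [set u; v]) => [E'|Ne].
      have := base_noncutting W; rewrite /noncutting -E' -E => /andP[_ C].
      by move: Ct; rewrite /cutting C andbF.
    by move: Ch; rewrite E (node_cutting Wh L Ne).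
  have [s H] := prefix_hanging P L; exists s, x, y; split=> // Es.
  have [L' _] := hanging_located H; rewrite Es in L'.
  have := leaf_noncutting W L'; rewrite /noncutting -E => /andP[_ C].
  by move: Ct; rewrite /cutting C andbF.
move=> [s [x [y [H Ns ->]]]]; have [Lt Lh] := hanging_located H.
have Nb := leaf_not_base Wh N Lh.
have := leaf_noncutting Wh Lh; rewrite /noncutting /cutting => /andP[-> ->].
by case: s Ns Lt {H} => // w l r _ Lt; case/andP: (node_cutting W Lt Nb) => -> ->.
Qed.

(** * The triangles of a handle form a path in the tree *)

Definition corners f : {set T} := \bigcup_(e in face_edges f) e.

Lemma corners_triangle f x y z :
  face_edges f = [set [set x; y]; [set y; z]; [set z; x]] ->
  corners f = [set x; y; z].
Proof.
move=> E; apply/setP => p; apply/bigcupP/idP => [[e]|].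
  by rewrite E !inE => /orP[/orP[]|] /eqP->; rewrite !inE => /orP[] ->; rewrite ?orbT.
rewrite !inE => /orP[/orP[]|] /eqP->; [exists [set x; y]|exists [set x; y]|exists [set y; z]];
  by rewrite ?E !inE eqxx ?orbT.
Qed.

Lemma corners_edge f x y : [set x; y] \in face_edges f ->
  (x \in corners f) && (y \in corners f).
Proof.
by move=> H; apply/andP; split; apply/bigcupP; exists [set x; y]; rewrite ?set21 ?set22.
Qed.

Lemma share_edge_sym f g : share_edge f g = share_edge g f.
Proof. by rewrite /share_edge setIC. Qed.

Lemma share_edgeP f g e : e \in face_edges f -> e \in face_edges g -> share_edge f g.
Proof. by move=> Hf Hg; apply/set0Pn; exists e; rewrite inE Hf. Qed.

Lemma dual_path_near P rho o fs f g : dual_path P rho o fs ->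
  f \in fs -> g \in fs -> share_edge f g -> f != g ->
  index g fs = (index f fs).+1 \/ index f fs = (index g fs).+1.
Proof.
move=> [U E D] Hf Hg S N.
have If : index f fs < size fs by rewrite index_mem.
have Ig : index g fs < size fs by rewrite index_mem.
case: (ltngtP (index f fs) (index g fs)) => H.
- have := D (index f fs) (index g fs); rewrite H Ig !nth_index // S => /(_ isT)/esym/eqP.
  by left.
- have := D (index g fs) (index f fs).
  by rewrite H If !nth_index // share_edge_sym S => /(_ isT)/esym/eqP; right.
- by case/eqP: N; rewrite -(nth_index set0 Hf) H nth_index.
Qed.

Lemma near_pigeonhole (k i j m : nat) :
  i = k.+1 \/ k = i.+1 -> j = k.+1 \/ k = j.+1 -> m = k.+1 \/ k = m.+1 ->
  i <> j -> m = i \/ m = j.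
Proof. lia. Qed.

Lemma unbranched_located t u v X :
  (forall w l r a b, located t u v (Node w l r) a b -> w \in X ->
     ~~ (rooted l X && rooted r X)) -> unbranched t X.
Proof.
elim: t u v => //= w l IHl r IHr p q H; apply/implyP => wX.
rewrite (H w l r p q) //; last by constructor.
rewrite (IHl p w) ?(IHr w q) // => c l' r' a b L; apply: H; constructor; exact: L.
Qed.

Section Handle.

Variables (t : tree T) (u v : T) (P : graph T).
Hypothesis W : wf t u v.
Hypotheses (SP : simple_graph P) (PG : subgraph P (tgraph t u v)).
Hypotheses (uP : u \in vertices P) (vP : v \in vertices P) (TP : tight P).
Variables (rho : T -> T -> T) (o f0 : {set T * T}) (fs : seq {set T * T}).
Hypotheses (P3 : 3 <= #|vertices P|) (Emb : standard_embedding P rho o).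
Hypotheses (DP : dual_path P rho o (f0 :: fs)) (f0uv : [set u; v] \in face_edges f0).

Let X := vertices P.

Lemma handle_triangle w a b : ear t u v w a b -> w \in X ->
  exists2 f, f \in f0 :: fs & face_edges f = [set [set a; b]; [set b; w]; [set w; a]].
Proof.
move=> E wX; have /andP[aX bX] := tight_closed W SP PG uP vP TP E wX.
have [Eab Eaw Ewb] := ear_edges E.
have ind p q : [set p; q] \in tedges t u v -> p \in X -> q \in X -> adj P p q.
  by move=> H pX qX; apply: (tight_induced W SP PG uP vP TP H); rewrite subUset !sub1set pX.
rewrite setUC in Eaw; rewrite setUC in Ewb.
have [f Hf Ef] := clique_face SP P3 Emb (ind _ _ Eab aX bX)
  (ind _ _ Ewb bX wX) (ind _ _ Eaw wX aX).
by exists f => //; case: DP => _ -> _.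
Qed.

(** A triangle continued through both legs would have a third neighbour in the dual path across its
    base, or, at the root, would be first in that path with two neighbours. *)
Lemma handle_unbranched_at w l r a b : located t u v (Node w l r) a b -> w \in X ->
  ~~ (rooted l X && rooted r X).
Proof.
move=> L wX; apply/negP => /andP[Rl Rr].
case: l Rl L => // c l1 l2 /= cX; case: r Rr => // d r1 r2 /= dX L.
have Wl := located_wf L W; have Ew : ear t u v w a b by eexists; eexists; exact: L.
have Lc : located t u v (Node c l1 l2) a w.
  by apply: located_trans L _; constructor; constructor.
have Ld : located t u v (Node d r1 r2) w b.
  by apply: located_trans L _; constructor; constructor.
have Ec : ear t u v c a w by eexists; eexists; exact: Lc.
have Ed : ear t u v d w b by eexists; eexists; exact: Ld.
have [ab wa wb _ _] := ear_neq W Ew.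
have [_ ca cw _ _] := ear_neq W Ec; have [_ dw db _ _] := ear_neq W Ed.
have cl : c \in inner (Node c l1 l2) by rewrite /= mem_cat inE eqxx orbT.
have dr : d \in inner (Node d r1 r2) by rewrite /= mem_cat inE eqxx orbT.
have cb : c != b.
  apply/negP => /eqP E; apply: (wf_inner_disj Wl cl).
  by rewrite E mem_outer eqxx orbT.
have da : d != a.
  by apply/negP => /eqP E; apply: (wf_inner_disjr Wl dr); rewrite E mem_outer eqxx.
have cd : c != d.
  by apply/negP => /eqP E; apply: (wf_inner_disj Wl cl); rewrite E mem_outer dr !orbT.
have [fw Hw Fw] := handle_triangle Ew wX.
have [fc Hc Fc] := handle_triangle Ec cX.
have [fd Hd Fd] := handle_triangle Ed dX.
have Cw := corners_triangle Fw; have Cc := corners_triangle Fc.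
have Cd := corners_triangle Fd.
have Nwc : fw != fc.
  apply/eqP => E; have : c \in corners fw by rewrite E Cc !inE eqxx !orbT.
  by rewrite Cw !inE (negPf ca) (negPf cb) (negPf cw).
have Nwd : fw != fd.
  apply/eqP => E; have : d \in corners fw by rewrite E Cd !inE eqxx !orbT.
  by rewrite Cw !inE (negPf da) (negPf db) (negPf dw).
have Ncd : fc != fd.
  apply/eqP => E; have : c \in corners fd by rewrite -E Cc !inE eqxx !orbT.
  by rewrite Cd !inE (negPf cw) (negPf cb) (negPf cd).
have Swc : share_edge fw fc.
  by apply: (@share_edgeP _ _ [set w; a]); rewrite ?Fw ?Fc !inE ?(setUC [set w]) eqxx ?orbT.
have Swd : share_edge fw fd.
  by apply: (@share_edgeP _ _ [set b; w]); rewrite ?Fw ?Fd !inE ?(setUC [set b]) eqxx ?orbT.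
have Kc := dual_path_near DP Hw Hc Swc Nwc.
have Kd := dual_path_near DP Hw Hd Swd Nwd.
have Icd : index fc (f0 :: fs) <> index fd (f0 :: fs).
  by move=> E; case/eqP: Ncd; rewrite -(nth_index set0 Hc) E nth_index.
(* [g] contains the base (a, b): it is the parent triangle or, at the root, the first face of the
   dual path, which may be [fw] itself. *)
have [g Hg [gab gN]] : exists2 g, g \in f0 :: fs &
    [set a; b] \in face_edges g /\ (index g (f0 :: fs) = 0 \/ g != fw).
  case: (located_parent L) => [[_ -> ->]|[q [l' [r' [a' [b' [L' D]]]]]]].
    by exists f0; rewrite ?inE ?eqxx //; split=> //; left; rewrite /= eqxx.
  have Eq : ear t u v q a' b' by exists l', r'.
  have /andP[aX bX] := tight_closed W SP PG uP vP TP Ew wX.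
  have qX : q \in X by case: D => [[_ <- _]|[<- _ _]].
  have [fq Hq Fq] := handle_triangle Eq qX; exists fq => //; split.
    by rewrite Fq; case: D => [[-> -> _]|[-> -> _]];
      rewrite !inE ?(setUC [set a']) ?(setUC [set q]) eqxx ?orbT.
  right; apply/eqP => E.
  have : w \in corners fq by rewrite E Cw !inE eqxx !orbT.
  rewrite (corners_triangle Fq) !inE.
  have [R1 R2] := rank_ear W Eq; have [R3 R4] := rank_ear W Ew.
  have Rq : rank t q < rank t w by case: D => [[_ <- _]|[<- _ _]].
  have /negPf -> : w != a' by apply: contraTneq (ltn_trans R1 Rq) => ->; rewrite ltnn.
  have /negPf -> : w != b' by apply: contraTneq (ltn_trans R2 Rq) => ->; rewrite ltnn.
  by have /negPf -> : w != q by apply: contraTneq Rq => ->; rewrite ltnn.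
(* If [fw] came first, both its neighbours would have index 1. *)
have gw : g != fw.
  case: gN => // g0; apply/eqP => E; move: g0 Kc Kd Icd; rewrite E => ->.
  by case=> // ->; case=> // ->.
have Sgw : share_edge fw g.
  by apply: share_edgeP gab; rewrite Fw !inE eqxx.
rewrite eq_sym in gw; have Kg := dual_path_near DP Hw Hg Sgw gw.
have /andP[ga gb] := corners_edge gab.
case: (near_pigeonhole Kc Kd Kg Icd) => E.
  have {}E : g = fc by rewrite -(nth_index set0 Hg) E nth_index.
  by move: gb; rewrite E Cc !inE eq_sym (negPf ab) eq_sym (negPf wb) eq_sym (negPf cb).
have {}E : g = fd by rewrite -(nth_index set0 Hg) E nth_index.
by move: ga; rewrite E Cd !inE eq_sym (negPf wa) (negPf ab) eq_sym (negPf da).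
Qed.

Lemma handle_unbranched : unbranched t X.
Proof. exact: unbranched_located handle_unbranched_at. Qed.

End Handle.

Lemma face_edge_in P rho o f e : standard_embedding P rho o ->
  f \in faces P rho -> e \in face_edges f -> e \in edges P.
Proof.
move=> [[_ R _] _ _ _ _] Hf /imsetP[d Hd ->].
by have := face_darts R Hf Hd; rewrite mem_darts.
Qed.

Lemma neighbours_left t u v : wf t u v ->
  neighbours (tgraph t u v) u =i v :: lspine t.
Proof. by move=> W z; rewrite inE -fanL_lspine (mem_fanL _ W). Qed.

Lemma neighbours_right t u v : wf t u v ->
  neighbours (tgraph t u v) v =i u :: rspine t.
Proof. by move=> W z; rewrite inE -fanR_rspine (mem_fanR _ W). Qed.

Lemma graph_union0 H : graph_union H (empty_graph T) = H.
Proof. by case: H => V E; rewrite /graph_union /= !setU0. Qed.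

Lemma graph_unionA H K F : graph_union H (graph_union K F) = graph_union (graph_union H K) F.
Proof. by rewrite /graph_union /= !setUA. Qed.

Lemma fan_glue t u v x H P F : wf t u v -> simple_graph H -> subgraph H (tgraph t u v) ->
  u \in vertices H -> v \in vertices H -> tight H ->
  fan (tgraph t u v) P x F -> edges H :&: edges F = edges P :&: edges F ->
  [/\ simple_graph (graph_union H F), subgraph (graph_union H F) (tgraph t u v),
      tight (graph_union H F) &
      forall z, z \in vertices F -> z \in x |: neighbours (tgraph t u v) x].
Proof.
move=> W SH HG uH vH TH [->|[FG [MF _] /subsetP VF [e [Ee _]]]] E.
  by rewrite graph_union0; split=> // z; rewrite inE.
have [SF _ _] := MF; have TF := maximal_outerplanar_edges MF.
split=> //; first exact: graph_union_simple.
  exact: graph_union_sub.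
by apply: (tight_glue (e := e) W) => //; rewrite E setIC.
Qed.

Lemma umbrella_prefix t u v U : wf t u v -> umbrella (tgraph t u v) u v U ->
  exists h, [/\ prefix h t, h <> Leaf, U = tgraph h u v &
    ud (summarize t) <= (hang h t).+1].
Proof.
move=> W [_ _ [P [F1 [F2 [EU [PG [e' [_ _ [MP PP]]]] HF1 HF2 DF]]] _]].
case: PP => rho [o [f [fs [Emb DP fuv _]]]]; have [SP P3 _] := MP.
have Hf : f \in faces P rho.
  by case: (DP) => _ /(_ f) + _; rewrite inE eqxx => /esym; rewrite inE => /andP[].
have /(simple_adj_vertices SP)/andP[uP vP] : adj P u v := face_edge_in Emb Hf fuv.
have TP := maximal_outerplanar_edges MP.
have [S1 G1 T1 V1] := fan_glue W SP PG uP vP TP HF1 erefl.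
have u1 : u \in vertices (graph_union P F1) by rewrite in_setU uP.
have v1 : v \in vertices (graph_union P F1) by rewrite in_setU vP.
(* The fans being edge-disjoint, the second one meets the handle and first fan together just where
   it meets the handle. *)
have E2 : edges (graph_union P F1) :&: edges F2 = edges P :&: edges F2.
  by rewrite /= setIUl (disjoint_setI0 DF) setU0.
have [S2 G2 T2 V2] := fan_glue W S1 G1 u1 v1 T1 HF2 E2.
rewrite -graph_unionA -EU in S2 G2 T2.
have uU : u \in vertices U by rewrite EU in_setU uP.
have vU : v \in vertices U by rewrite EU in_setU vP.
have [CX _] := tight_tree W SP PG uP vP TP.
have [_ EUt] := tight_tree W S2 G2 uU vU T2.
have B := handle_unbranched W SP PG uP vP TP P3 Emb DP fuv.
(* Otherwise upward closure would leave no vertices in the handle but [u] and [v], and it has at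
   least three. *)
have wX : rooted t (vertices P).
  apply/negPn/negP => /(upclosed_unrooted CX) N.
  have : vertices P \subset [set u; v].
    apply/subsetP => z zP; have := subsetP (andP PG).1 z zP.
    rewrite mem_tgraph mem_outer in_set2 orbA => /orP[//|/N].
    by rewrite zP.
  move/subset_leq_card; rewrite cards2 => H.
  by have := leq_trans P3 H; case: (_ != _).
have wU : rooted t (vertices U).
  by case: (t) wX => //= w l r; rewrite EU in_setU => ->.
exists (prune t (vertices U)); split=> //.
- exact: prune_prefix.
- by case: (t) wU => //= w l r ->.
have VU z : z \in inner t -> z \in vertices U ->
    [\/ z \in vertices P, z \in lspine t | z \in rspine t].
  move=> zt; have /andP[zu zv] := wf_in_neq W zt.
  rewrite EU !in_setU => /or3P[|/V1|/V2]; first by constructor.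
    by rewrite in_setU1 (neighbours_left W) inE (negPf zu) (negPf zv); constructor.
  by rewrite in_setU1 (neighbours_right W) inE (negPf zu) (negPf zv); constructor.
have Ui : uniq (inner t) by move: W; rewrite /wf /outer /= rcons_uniq => /and3P[].
by case: (t) CX B wX wU VU Ui => // w l r CX B wX wU VU Ui; apply: ud_le CX B wX wU VU.
Qed.

Lemma umbrella_lower_bound G u v (d : nat) : umbrella_system G u v d ->
  forall t, wf t u v -> G = tgraph t u v -> ud (summarize t) <= d.
Proof.
elim=> {G u v d} G u v U S a b k HU Hab HS _ IH t W EG.
subst G; have [h [Ph Nh EU B]] := umbrella_prefix W HU.
apply: leq_trans B _; rewrite add1n ltnS.
apply: (hang_bound (u := u) (v := v) Ph) => s x y Ns H.
have [Lt Lh] := hanging_located H.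
have He : [set x; y] \in anchor_edges (tgraph t u v) U.
  by rewrite EU; apply/(anchor_hanging _ W Ph Nh); exists s, x, y.
have Wh := prefix_wf Ph W.
have ES := hanging_unique W Lt (leaf_not_base Wh Nh Lh) (HS _ He).
apply: leq_trans (leq_bigmax_cond _ He).
have Ws := located_wf Lt W.
(* The system names the ends of the anchor-edge in either order; one order is that of [s], the other
   that of its reflection. *)
case/set2_eqP: (Hab _ He) => -[Ea Eb].
  by apply: (IH _ He); rewrite -Ea -Eb.
have := IH _ He (mirror s); rewrite summarize_mirror /=; apply.
  by rewrite -Ea -Eb wf_mirror.
by rewrite -Ea -Eb tgraph_mirror.
Qed.

(** * Construction of an optimal umbrella *)

Lemma path_to_prefix h s u v x y : path_to h s u v x y -> prefix h s.
Proof. by elim=> //= *; split. Qed.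

Lemma path_to_located h s u v x y : path_to h s u v x y -> located s u v Leaf x y.
Proof. by elim=> [*|? ? ? ? ? ? ? ? _ ?|? ? ? ? ? ? ? ? _ ?]; constructor. Qed.

Lemma path_exists s a b : exists h x y,
  path_to h s a b x y /\ hang h s <= path_ud (summarize s).
Proof.
elim: s a b => [|w l IHl r IHr] a b.
  by exists Leaf, a, b; split=> //; constructor.
have [hl [x [y [Pl Hl]]]] := IHl a w; have [hr [x' [y' [Pr Hr]]]] := IHr w b.
rewrite /= /minn; case: ifP => _.
  exists (Node w hl Leaf), x, y; split; first by constructor.
  by rewrite /= geq_max !leq_max Hl leqnn orbT.
exists (Node w Leaf hr), x', y'; split; first by constructor.
by rewrite /= geq_max !leq_max Hr leqnn orbT.
Qed.

Fixpoint left_fan s := if s is Node w l r then Node w (left_fan l) Leaf else Leaf.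
Fixpoint right_fan s := if s is Node w l r then Node w Leaf (right_fan r) else Leaf.

Lemma left_fan_path s a b : exists x y, path_to (left_fan s) s a b x y.
Proof.
elim: s a b => [|w l IHl r _] a b; first by exists a, b; constructor.
by have [x [y H]] := IHl a w; exists x, y; constructor.
Qed.

Lemma right_fan_path s a b : exists x y, path_to (right_fan s) s a b x y.
Proof.
elim: s a b => [|w l _ r IHr] a b; first by exists a, b; constructor.
by have [x [y H]] := IHr w b; exists x, y; constructor.
Qed.

Lemma left_fan_inner s : inner (left_fan s) =i lspine s.
Proof. by elim: s => //= w l IHl r _ z; rewrite mem_cat !inE IHl orbC. Qed.

Lemma right_fan_inner s : inner (right_fan s) =i rspine s.
Proof. by elim: s => //= w l _ r IHr z; rewrite !inE IHr. Qed.

Lemma hang_left_fan s : hang (left_fan s) s = lfan_ud (summarize s).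
Proof. by elim: s => //= w l -> r _; rewrite maxnC. Qed.

Lemma hang_right_fan s : hang (right_fan s) s = rfan_ud (summarize s).
Proof. by elim: s => //= w l _ r ->. Qed.

(* A path [h] out of [s] together with the remaining fan [g] at the left end a
   of its base (a, b); [g] starts at the last edge (a, z) of [h] at a. *)
Lemma path_fan_exists s a b : wf s a b -> exists h x y z g k,
  [/\ path_to h s a b x y, prefix k s & hang k s <= lpath_ud (summarize s)] /\
  [/\ wf g a z, exists s' x' y', path_to g s' a z x' y',
      tedges g a z \subset tedges s a b & {subset inner g <= lspine s}] /\
  [/\ tedges k a b = tedges h a b :|: tedges g a z,
      inner k =i inner h ++ inner g, [set a; z] \in tedges h a b,
      (forall p, p \in inner g -> p \notin outer h a b) & {subset lspine s <= inner k}].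
Proof.
elim: s a b => [|w l IHl r IHr] a b W.
  exists Leaf, a, b, b, Leaf, Leaf; split; [split|split; split] => //; first by constructor.
  - by exists Leaf, a, b; constructor.
  - by rewrite setUid.
  - by rewrite inE.
have [Wl Wr] := (wf_left W, wf_right W).
rewrite [lpath_ud _]/= /minn; case: ifP => _.
  (* The path turns away from [a] at once, so the whole fan of the left part remains to be added at
     (a, w). *)
  have [h [x [y [Ph Hh]]]] := path_exists r w b.
  have [x' [y' Pf]] := left_fan_path l a w.
  have Pl := path_to_prefix Pf; have Pr := path_to_prefix Ph.
  exists (Node w Leaf h), x, y, w, (left_fan l), (Node w (left_fan l) h).
  split; [split|split; split].
  - by constructor.
  - by split.
  - by rewrite /= hang_left_fan geq_max !leq_max leqnn Hh orbT.
  - exact: prefix_wf Pl Wl.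
  - by exists l, x', y'.
  - apply: subset_trans (prefix_edges a w Pl) _; apply/subsetP => e.
    by rewrite tedges_node => ->; rewrite orbT.
  - by move=> p; rewrite left_fan_inner inE => ->; rewrite orbT.
  - apply/setP => e; rewrite in_setU !tedges_node in_set1 [RHS]orbC.
    case: (eqVneq e [set a; w]) => [->|_]; first by rewrite tedges_base !orbT.
    by rewrite /= orbCA.
  - by move=> p; rewrite /= !(mem_cat, inE) orbC orbA.
  - by rewrite tedges_node in_set1 eqxx orbT.
  - move=> p pf; have pl := mem_subseq (prefix_subseq Pl) pf.
    have /andP[pa pw] := wf_in_neq Wl pl.
    rewrite outer_nodeE negb_or !mem_outer !negb_or pa pw /=.
    apply/andP; split.
      by apply/eqP => Eb; apply: (wf_inner_disj W pl); rewrite Eb mem_outer eqxx orbT.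
    apply/negP => /(mem_subseq (prefix_subseq Pr)) pr.
    by apply: (wf_inner_disj W pl); rewrite mem_outer pr !orbT.
  - by move=> p; rewrite /= inE mem_cat inE left_fan_inner orbCA orbA => ->.
(* The path goes on along the fan at [a], and the rest of the fan is the one found in the left
   part. *)
have [h [x [y [z [g [k [[Ph Pk Hk] [[Wg Pg Sg Ig] [Ek Ik Ez Dg Sk]]]]]]]]] := IHl a w Wl.
exists (Node w h Leaf), x, y, z, g, (Node w k Leaf).
split; [split|split; split] => //.
- by constructor.
- by rewrite /= geq_max !leq_max Hk leqnn orbT.
- by apply: subset_trans Sg _; apply/subsetP => e; rewrite tedges_node => ->; rewrite orbT.
- by move=> p /Ig; rewrite inE => ->; rewrite orbT.
- by rewrite /= Ek -!setUA; congr (_ :|: (_ :|: _)); rewrite setUC.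
- move=> p; rewrite /= !(mem_cat, inE) Ik mem_cat.
  by case: (p \in inner h); case: (p \in inner g); case: (p == w).
- by rewrite tedges_node Ez !orbT.
- move=> p pg; rewrite outer_nodeE negb_or Dg //= mem_outer orbF negb_or.
  have pl := lspine_inner (Ig _ pg); have /andP[_ ->] := wf_in_neq Wl pl; rewrite /=.
  by apply/eqP => Eb; apply: (wf_inner_disj W pl); rewrite Eb mem_outer eqxx orbT.
- by move=> p; rewrite /= inE mem_cat inE => /orP[->|/Sk->//]; rewrite orbT.
Qed.

(** A fan without triangles would be a single edge, which is not an outerplanar path; the definition
    of an umbrella has the empty graph instead. *)
Definition fan_graph g a b := if g is Leaf then empty_graph T else tgraph g a b.

Lemma fan_graph_union H g a b : simple_graph H -> [set a; b] \in edges H ->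
  graph_union H (fan_graph g a b) = graph_union H (tgraph g a b).
Proof.
case: g => // SH E; have /andP[aH bH] := simple_adj_vertices SH E.
rewrite graph_union0 /graph_union.
have -> : vertices H :|: vertices (tgraph Leaf a b) = vertices H.
  apply/setUidPl/subsetP => z; rewrite mem_tgraph mem_outer orbF.
  by case/orP => /eqP->.
have -> : edges H :|: edges (tgraph Leaf a b) = edges H.
  by apply/setUidPl; rewrite /= sub1set.
by case: H {SH E aH bH}.
Qed.

Lemma fan_intro t u v P x g a b s' x' y' : wf t u v -> simple_graph P ->
  wf g a b -> path_to g s' a b x' y' -> x \in [set a; b] ->
  tedges g a b \subset tedges t u v ->
  (forall c, c \in outer g a b -> c \in x |: neighbours (tgraph t u v) x) ->
  [set a; b] \in edges P -> (forall c, c \in inner g -> c \notin vertices P) ->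
  fan (tgraph t u v) P x (fan_graph g a b).
Proof.
move=> W SP Wg Pg xab Sg N Eab D; case: g Wg Pg Sg N D => [|w l r] Wg Pg Sg N D.
  by left.
move Eg: (Node w l r) Wg Pg Sg N D => g Wg Pg Sg N D.
have -> : fan_graph g a b = tgraph g a b by rewrite -Eg.
right; split.
- apply/andP; split=> //; apply/subsetP => c; rewrite !mem_tgraph => /N.
  have xt : x \in outer t u v.
    apply: tedges_outer xab; exact: (subsetP Sg) (tedges_base _ _ _).
  rewrite in_setU1 in_set => /orP[/eqP->//|].
  by rewrite /adj /= => /tedges_outer; apply; rewrite set22.
- by apply: path_to_outerplanar_path Pg Wg _; rewrite -Eg.
- by apply/subsetP => c; rewrite mem_tgraph; apply: N.
exists [set a; b]; split=> //; apply/setP => e; rewrite in_setI in_set1.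
apply/andP/eqP => [[eg eP]|->]; last by split=> //; apply: tedges_base.
apply: edge_in_pair (tedges_card Wg eg) _; apply/subsetP => c ce.
have := tedges_outer eg ce; rewrite mem_outer orbA in_set2 => /orP[//|/D].
have /andP[_ /subsetP/(_ c ce)->//] : (#|e| == 2) && (e \subset vertices P).
by have := forallP SP e; rewrite eP.
Qed.

Lemma edges_fan_graph g a b : edges (fan_graph g a b) \subset tedges g a b.
Proof. by case: g => //=; apply: sub0set. Qed.

(** The handle is the root triangle followed by a path into the left part. The first fan is what
    this path omits of the triangles at [u]; the second is the full fan of the right part at [v],
    which meets the handle in (w, v). *)
Lemma umbrella_left w l r u v : wf (Node w l r) u v -> exists h,
  [/\ prefix h (Node w l r), h <> Leaf,
      umbrella (tgraph (Node w l r) u v) u v (tgraph h u v) &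
      hang h (Node w l r) <= maxn (lpath_ud (summarize l)) (rfan_ud (summarize r))].
Proof.
move=> W; have [Wl Wr] := (wf_left W, wf_right W).
have [h [x [y [z [g [k [[Ph Pk Hk] [[Wg [s' [x' [y' Pg]]] Sg Ig] [Ek Ik Ez Dg Sk]]]]]]]]] :=
  path_fan_exists Wl.
have [x'' [y'' Pf]] := right_fan_path r w v.
have Prf := path_to_prefix Pf; have Wf := prefix_wf Prf Wr.
have Pt : path_to (Node w h Leaf) (Node w l r) u v x y by constructor.
have PP := path_to_prefix Pt; have WP := prefix_wf PP W.
set t := Node w l r in W Pt PP *; set P := tgraph (Node w h Leaf) u v.
have SP : simple_graph P := tgraph_simple WP.
have Iu z' : z' \in [set u; z] -> z' \in outer h u w by exact: tedges_outer Ez.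
have Et : tedges l u w \subset tedges t u v.
  by apply/subsetP => e; rewrite tedges_node => ->; rewrite orbT.
have Et' : tedges r w v \subset tedges t u v.
  by apply/subsetP => e; rewrite tedges_node => ->; rewrite !orbT.
have EP e : (e \in edges P) = [|| e == [set u; v], e \in tedges h u w | e == [set w; v]].
  by rewrite -[edges P]/(tedges (Node w h Leaf) u v) tedges_node in_set1.
have EuzP : [set u; z] \in edges P by rewrite EP Ez orbT.
have EwvP : [set w; v] \in edges P by rewrite EP eqxx !orbT.
have VP c : (c \in vertices P) = (c \in outer h u w) || (c == v).
  rewrite mem_tgraph outer_nodeE (mem_outer Leaf) orbF.
  case: eqP => [->|//]; by rewrite (mem_outer h) eqxx !orbT.
have Ig' c : c \in inner g -> c \in inner l by move/Ig/lspine_inner.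
exists (Node w k (right_fan r)); split=> //.
- split.
  + exact: base_noncutting.
  + have Wk : wf (Node w k (right_fan r)) u v by apply: prefix_wf W; split.
    by rewrite (tgraph_card Wk) /= size_cat /= addnS.
  + exists P, (fan_graph g u z), (fan_graph (right_fan r) w v); split.
    * rewrite graph_unionA (fan_graph_union _ SP EuzP).
      have S2 : simple_graph (graph_union P (tgraph g u z)).
        by apply: graph_union_simple => //; apply: tgraph_simple.
      rewrite (fan_graph_union _ S2); last by apply/setUP; left.
      congr Graph.
        apply/setP => c; rewrite !in_setU VP !mem_tgraph !mem_outer.
        rewrite /= !(mem_cat, inE) Ik mem_cat.
        have : (c == z) ==> [|| c == u, c == w | c \in inner h].
          by apply/implyP => /eqP->; rewrite -mem_outer Iu // set22.
        by case: (c == z); case: (c == u); case: (c == v); case: (c == w);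
          case: (c \in inner h); case: (c \in inner g); case: (c \in inner _).
      rewrite -[edges (graph_union _ _)]/(edges P :|: tedges g u z).
      rewrite -[edges (tgraph (right_fan r) w v)]/(tedges (right_fan r) w v).
      apply/setP => e; rewrite tedges_node Ek (in_setU e (edges P :|: _)).
      rewrite (in_setU e (edges P)) EP (in_setU e (tedges h u w)).
      case: (eqVneq e [set w; v]) => [->|_]; first by rewrite tedges_base !orbT.
      by rewrite orbF -!orbA.
    * split; first exact: prefix_subgraph.
      exists [set x; y]; have L := path_to_located Pt; split.
      - exact: leaf_noncutting W L.
      - exact: leaf_not_base W _ L.
      - exact: path_to_connecting Pt WP _.
    * apply: (fan_intro W SP Wg Pg _ (subset_trans Sg Et)) => //; first by rewrite set21.
        move=> c; rewrite mem_outer in_setU1 (neighbours_left W) /= !inE.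
        case/or3P => [->//|/eqP->|/Ig->]; last by rewrite !orbT.
        have : z \in neighbours (tgraph t u v) u.
          by rewrite in_set; apply: (subsetP (prefix_edges u v PP)); apply: EuzP.
        by rewrite (neighbours_left W) /= !inE => ->; rewrite orbT.
      move=> c cg; rewrite VP negb_or Dg //=.
      by apply/eqP => Ec; apply: (wf_inner_disj W (Ig' _ cg)); rewrite Ec mem_outer eqxx orbT.
    * apply: (fan_intro W SP Wf Pf _ (subset_trans (prefix_edges w v Prf) Et')) => //.
      - by rewrite set22.
      - move=> c; rewrite mem_outer in_setU1 (neighbours_right W) /= !inE right_fan_inner.
        by case/or3P => ->; rewrite ?orbT.
      move=> c cf; have cr := mem_subseq (prefix_subseq Prf) cf; rewrite VP negb_or.
      have /andP[_ ->] := wf_in_neq Wr cr; rewrite andbT; apply/negP => ch.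
      apply: (wf_inner_disjr W cr); move: ch; rewrite !mem_outer => /or3P[->|->|] //.
        by rewrite orbT.
      by move/(mem_subseq (prefix_subseq (path_to_prefix Ph))) => ->; rewrite !orbT.
    * rewrite -setI_eq0; apply/eqP/setP => e; rewrite in_setI in_set0; apply/negP => /andP[E1 E2].
      have {}E1 := subsetP Sg _ (subsetP (edges_fan_graph _ _ _) _ E1).
      have {}E2 := subsetP (prefix_edges w v Prf) _ (subsetP (edges_fan_graph _ _ _) _ E2).
      have : e \subset [set w].
        apply/subsetP => c ce; rewrite in_set1; apply/eqP.
        exact: wf_disj W (tedges_outer E1 ce) (tedges_outer E2 ce).
      by move/subset_leq_card; rewrite cards1 (tedges_card Wl E1).
  + apply/subsetP => c; rewrite in_setU (neighbours_left W) (neighbours_right W) /=.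
    rewrite mem_tgraph mem_outer /= !(mem_cat, inE) right_fan_inner.
    case/orP => /or3P[->|->|]; rewrite ?orbT //; first by move/Sk => ->; rewrite !orbT.
    by move=> ->; rewrite !orbT.
- by rewrite /= hang_right_fan geq_max !leq_max Hk leqnn orbT.
Qed.

Lemma umbrella_swap G u v U : umbrella G u v U -> umbrella G v u U.
Proof.
move=> [NC C3 [P [F1 [F2 [EU [PG [e' [E1 E2 E3]]] H1 H2 D]]]] N].
split; rewrite ?(setUC [set v]) //; last by rewrite setUC.
exists P, F2, F1; split=> //; last by rewrite disjoint_sym.
  by rewrite EU /graph_union /= (setUC (vertices F1)) (setUC (edges F1)).
by split=> //; exists e'; rewrite ?(setUC [set v]).
Qed.

Lemma umbrella_exists t u v : wf t u v -> t <> Leaf -> exists h,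
  [/\ prefix h t, h <> Leaf, umbrella (tgraph t u v) u v (tgraph h u v) &
      (hang h t).+1 <= ud (summarize t)].
Proof.
case: t => // w l r W _.
have [C|C] : ud (summarize (Node w l r)) =
    (maxn (lpath_ud (summarize l)) (rfan_ud (summarize r))).+1 \/
  ud (summarize (Node w l r)) = (maxn (lfan_ud (summarize l)) (rpath_ud (summarize r))).+1.
- by rewrite /= /minn; case: ifP; auto.
- by have [h [P N U B]] := umbrella_left W; exists h; rewrite C ltnS.
have W' : wf (Node w (mirror r) (mirror l)) v u.
  by rewrite -[Node _ _ _]/(mirror (Node w l r)) wf_mirror.
have [h [P N U B]] := umbrella_left W'.
exists (mirror h); split.
- by rewrite -(mirrorK (Node w l r)); apply: prefix_mirror.
- by move=> E; apply: N; rewrite -(mirrorK h) E.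
- rewrite tgraph_mirror; apply: umbrella_swap.
  by rewrite -(tgraph_mirror (Node w l r)).
- rewrite C ltnS -(mirrorK (Node w l r)) hang_mirror; apply: leq_trans B _.
  by rewrite !summarize_mirror maxnC.
Qed.

Lemma umbrella_system_exists t u v : wf t u v -> t <> Leaf ->
  umbrella_system (tgraph t u v) u v (ud (summarize t)).
Proof.
have [n] := ubnP (size (inner t)); elim: n t u v => // n IH t u v Hn W N.
have [h [P Nh HU B]] := umbrella_exists W N.
(* A simultaneous choice of the hanging part and its oriented edge; sets that are not anchor-edges
   get a dummy value. *)
have [F HF] : exists F : {set T} -> (tree T * T * T), forall e,
  e \in anchor_edges (tgraph t u v) (tgraph h u v) ->
  [/\ hanging h t u v (F e).1.1 (F e).1.2 (F e).2, (F e).1.1 <> Leaf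
    & e = [set (F e).1.2; (F e).2]].
  apply: (@fin_all_exists {set T} (fun => (tree T * T * T)%type) (fun e p =>
    e \in anchor_edges (tgraph t u v) (tgraph h u v) ->
    [/\ hanging h t u v p.1.1 p.1.2 p.2, p.1.1 <> Leaf & e = [set p.1.2; p.2]])) => e.
  case: (boolP (e \in anchor_edges (tgraph t u v) (tgraph h u v))) => [|_].
    by move/(anchor_hanging _ W P Nh) => [s [x [y [H Ns E]]]]; exists (s, x, y).
  by exists (Leaf, u, v).
have Wh := prefix_wf P W.
pose S e := tgraph (F e).1.1 (F e).1.2 (F e).2.
have Sys : umbrella_system (tgraph t u v) u v
    (1 + \max_(e in anchor_edges (tgraph t u v) (tgraph h u v)) ud (summarize (F e).1.1)).
  apply: (@UmbrellaSystem _ _ _ _ _ S (fun e => (F e).1.2) (fun e => (F e).2)) => //.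
  - by move=> e /HF[].
  - move=> e He; have [H Ns E] := HF e He; have [Lt Lh] := hanging_located H.
    rewrite {1}E; apply: hanging_exists => //; exact: leaf_not_base Wh Nh Lh.
  - move=> e He; have [H Ns E] := HF e He; have [Lt Lh] := hanging_located H.
    apply: IH Ns; last exact: located_wf Lt W.
    have [t' [Pm _ _ NL]] := located_split Lt.
    rewrite ltnS in Hn; apply: leq_trans Hn.
    rewrite (perm_size Pm) size_cat -[X in X < _]add0n ltn_add2r.
    case: t' NL {Pm} => [/(_ erefl)[_ [Eu Ev]]|w l r _]; last by rewrite size_cat addnS.
    by have := leaf_not_base Wh Nh Lh; rewrite Eu Ev eqxx.
(* The constructed depth is at most [ud] by the choice of the umbrella, and at least [ud] by the
   lower bound applied to the system just built. *)
have -> : ud (summarize t) = 1 + \max_(e in anchor_edges (tgraph t u v) (tgraph h u v))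
    ud (summarize (F e).1.1); last exact: Sys.
apply/eqP; rewrite eqn_leq (umbrella_lower_bound Sys W erefl) /=.
apply: leq_trans B; rewrite add1n ltnS; apply/bigmax_leqP => e He.
by have [H _ _] := HF e He; apply: hanging_le H.
Qed.

Theorem rooted_umbrella_depth_tgraph t u v : wf t u v -> t <> Leaf ->
  rooted_umbrella_depth (tgraph t u v) u v (ud (summarize t)).
Proof.
move=> W N; split; first exact: umbrella_system_exists.
by move=> d /umbrella_lower_bound; apply.
Qed.

End Umbrellas.

(** * Running times of programs *)

(** The cost [c] of testing the guard is charged to the decrease [d] of the remaining work, which is
    at least 1; the final [c] pays for the last test. *)
Lemma while_bound K c m m' d t1 t2 : 0 < d -> d + m' = m ->
  t1 <= K * d -> t2 <= (K + c) * m' + c -> c + t1 + t2 <= (K + c) * m + c.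
Proof.
move=> d0 <- B1 B2; have Hc : c <= c * d by rewrite leq_pmulr.
rewrite mulnDr (mulnDl K c d); move: (K * d) (c * d) ((K + c) * m') B1 B2 Hc; lia.
Qed.

Section Hoare.

Variable W : nat.

Definition runs c s T (Q : state -> Prop) :=
  exists t s', [/\ exec W c s t s', t <= T & Q s'].

Lemma runs_weaken c s T T' (Q Q' : state -> Prop) :
  runs c s T Q -> T <= T' -> (forall s', Q s' -> Q' s') -> runs c s T' Q'.
Proof.
by move=> [t [s' [E B H]]] TT QQ; exists t, s'; split; auto; apply: leq_trans TT.
Qed.

Lemma runs_seq c1 c2 s T1 T2 (Q1 Q2 : state -> Prop) :
  runs c1 s T1 Q1 -> (forall s', Q1 s' -> runs c2 s' T2 Q2) ->
  runs (Seq c1 c2) s (T1 + T2) Q2.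
Proof.
move=> [t1 [s1 [E1 B1 H1]]] /(_ _ H1)[t2 [s2 [E2 B2 H2]]].
exists (t1 + t2), s2; split=> //; last exact: leq_add.
exact: ExecSeq E1 E2.
Qed.

(* [wp] and [time] are meant for loop-free commands only. *)
Fixpoint wp c s (Q : state -> Prop) : Prop :=
  match c with
  | Skip => Q s
  | Assign r e => eval s e <= W /\ Q (set_reg s r (eval s e))
  | Put a i e => [/\ eval s i <= W, eval s e <= W & Q (set_arr s a (eval s i) (eval s e))]
  | Seq c1 c2 => wp c1 s (fun s1 => wp c2 s1 Q)
  | If e c1 c2 => (eval s e <> 0 -> wp c1 s Q) /\ (eval s e = 0 -> wp c2 s Q)
  | While _ _ => False
  end.

Fixpoint time c : nat :=
  match c with
  | Skip => 1
  | Assign _ e => 1 + cost e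
  | Put _ i e => 1 + cost i + cost e
  | Seq c1 c2 => time c1 + time c2
  | If e c1 c2 => 1 + cost e + (time c1 + time c2)
  | While _ _ => 0
  end.

Lemma wp_runs c s Q : wp c s Q -> runs c s (time c) Q.
Proof.
elim: c s Q => //= [|r e|a i e|c1 IH1 c2 IH2|e c1 IH1 c2 IH2] s Q.
- by exists 1, s; split=> //; constructor.
- move=> [B H]; exists (1 + cost e), (set_reg s r (eval s e)).
  by split=> //; constructor.
- move=> [B1 B2 H]; exists (1 + cost i + cost e), (set_arr s a (eval s i) (eval s e)).
  by split=> //; constructor.
- by move=> /IH1 H; apply: runs_seq H _ => s' /IH2.
- move=> [H1 H2]; case: (eqVneq (eval s e) 0) => E.
    have [t [s' [X B H]]] := IH2 _ _ (H2 E).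
    exists (1 + cost e + t), s'; split=> //; first exact: ExecIfFalse.
    by rewrite leq_add2l (leq_trans B) // leq_addl.
  have [t [s' [X B H]]] := IH1 _ _ (H1 (elimN eqP E)).
  exists (1 + cost e + t), s'; split=> //; first exact: ExecIfTrue.
  by rewrite leq_add2l (leq_trans B) // leq_addr.
Qed.

Lemma wp_weaken c s (Q Q' : state -> Prop) :
  wp c s Q -> (forall s', Q s' -> Q' s') -> wp c s Q'.
Proof.
elim: c s Q Q' => //= [|r e|a i e|c1 IH1 c2 IH2|e c1 IH1 c2 IH2] s Q Q'.
- by move=> H; apply.
- by move=> [B H] /(_ _ H).
- by move=> [B1 B2 H] /(_ _ H).
- by move=> H QQ; apply: IH1 H _ => s' H; apply: IH2 H QQ.
- by move=> [H1 H2] QQ; split=> [/H1|/H2] H; [apply: IH1 H QQ|apply: IH2 H QQ].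
Qed.

(* [I m s]: the remaining work of the loop is at most [m], up to a factor [K]. *)
Lemma runs_while e c K (I : nat -> state -> Prop) Q :
  (forall m s, I m s -> eval s e <> 0 ->
     exists2 m', m' < m & runs c s (K * (m - m')) (I m')) ->
  (forall m s, I m s -> eval s e = 0 -> Q s) ->
  forall m s, I m s -> runs (While e c) s ((K + (1 + cost e)) * m + (1 + cost e)) Q.
Proof.
move=> step done; elim/ltn_ind => m IH s Is.
case: (eqVneq (eval s e) 0) => E.
  by exists (1 + cost e), s; split; [exact: ExecWhileDone|exact: leq_addl|exact: done Is E].
have [m' lt [t1 [s1 [X1 B1 I1]]]] := step _ _ Is (elimN eqP E).
have [t2 [s2 [X2 B2 I2]]] := IH _ lt _ I1.
exists (1 + cost e + t1 + t2), s2; split=> //; first exact: ExecWhileStep X1 X2.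
by apply: while_bound B1 B2; rewrite ?subn_gt0 ?subnK // ltnW.
Qed.

End Hoare.

(** With truncated subtraction these are the absolute difference, the maximum and the minimum. *)
Definition neqE a b := Add (Defs.Sub a b) (Defs.Sub b a).
Definition maxE a b := Add a (Defs.Sub b a).
Definition minE a b := Defs.Sub a (Defs.Sub a b).

Lemma eval_neqE s a b : (eval s (neqE a b) = 0) <-> (eval s a = eval s b).
Proof. by rewrite /=; lia. Qed.

(** * Eliminating ears *)

Section Elimination.

Variable T : finType.
Implicit Types (t s l r h : tree T) (a b c u v w x y z p q : T) (e R : {set T}).

Lemma located_edge_unique t u v s x y s' x' y' : wf t u v ->
  located t u v s x y -> located t u v s' x' y' -> [set x; y] = [set x'; y'] ->
  [/\ s = s', x = x' & y = y'].
Proof.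
elim: t u v => [|w l IHl r IHr] u v W L L' E.
  by inversion L; inversion L'; subst.
have [Wl Wr] := (wf_left W, wf_right W); have /andP[Nv Nu] := wf_left_notin W.
have Kl s0 c d : located l u w s0 c d -> [set u; v] = [set c; d] -> False.
  move=> L0 E0; case/negP: Nv.
  apply: tedges_outer (subsetP (located_edges L0) _ (tedges_base _ _ _)) _.
  by rewrite -E0 set22.
have Kr s0 c d : located r w v s0 c d -> [set u; v] = [set c; d] -> False.
  move=> L0 E0; case/negP: Nu.
  apply: tedges_outer (subsetP (located_edges L0) _ (tedges_base _ _ _)) _.
  by rewrite -E0 set21.
have Klr s0 c d s1 c' d' : located l u w s0 c d -> located r w v s1 c' d' ->
    [set c; d] = [set c'; d'] -> False.
  move=> L0 L1 E0; have := subsetP (located_edges L0) _ (tedges_base _ _ _) => H0.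
  have := subsetP (located_edges L1) _ (tedges_base _ _ _); rewrite -E0 => H1.
  have : [set c; d] \subset [set w].
    apply/subsetP => z zc; rewrite in_set1; apply/eqP.
    exact: wf_disj W (tedges_outer H0 zc) (tedges_outer H1 zc).
  by move/subset_leq_card; rewrite cards1 (tedges_card Wl H0).
inversion L; subst; inversion L'; subst; try by [
  | exfalso; apply: Kl E; eassumption | exfalso; apply: Kl (esym E); eassumption
  | exfalso; apply: Kr E; eassumption | exfalso; apply: Kr (esym E); eassumption
  | exfalso; apply: Klr E; eassumption | exfalso; apply: Klr (esym E); eassumption].
- by apply: IHl Wl _ _ E.
- by apply: IHr Wr _ _ E.
Qed.

Section FixTree.

Variables (t : tree T) (u v : T).
Hypothesis W : wf t u v.
Let G := tgraph t u v.

(* [s] is the part of [t] beyond the edge xy, up to reflection. *)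
Definition beyond s x y := located t u v s x y \/ located t u v (mirror s) y x.

Lemma beyond_mirror s x y : beyond s x y -> beyond (mirror s) y x.
Proof. by case=> H; [right; rewrite mirrorK|left]. Qed.

Lemma beyond_left w l r x y : beyond (Node w l r) x y -> beyond l x w.
Proof.
by case=> H; [left|right]; apply: located_trans H _; do 2 constructor.
Qed.

Lemma beyond_unique s s' x y : beyond s x y -> beyond s' x y -> s = s'.
Proof.
have N s0 c d : located t u v s0 c d -> c != d by move/located_wf/(_ W)/wf_neq.
case=> H [] H'.
- by have [] := located_edge_unique W H H' erefl.
- have [_ E _] := located_edge_unique W H H' (setUC _ _).
  by have := N _ _ _ H; rewrite E eqxx.
- have [_ E _] := located_edge_unique W H H' (setUC _ _).
  by have := N _ _ _ H; rewrite E eqxx.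
- by have [/(can_inj (@mirrorK T))] := located_edge_unique W H H' erefl.
Qed.

Lemma beyond_ear w l r x y : beyond (Node w l r) x y ->
  exists a b, ear t u v w a b /\ [set a; b] = [set x; y].
Proof.
case=> H; first by exists x, y; split=> //; exists l, r.
by exists y, x; split; [exists (mirror r), (mirror l)|rewrite setUC].
Qed.

Definition isroot s z := if s is Node c _ _ then c == z else false.

(** The machine recognises children by this test: an eliminated apex heads the part beyond (x, w)
    exactly when its feet are [x] and [w]. *)
Lemma beyond_child w l r x y s z p q : beyond (Node w l r) x y ->
  beyond s p q -> isroot s z -> ([set p; q] = [set x; w]) <-> isroot l z.
Proof.
move=> /beyond_left H Hs Rs; split=> [/set2_eqP[] [Ep Eq]|Rl].
- by rewrite Ep Eq in Hs; rewrite (beyond_unique H Hs).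
- rewrite Ep Eq in Hs; rewrite (beyond_unique H (beyond_mirror Hs)).
  by case: (s) Rs.
case: l H Rl => // c l1 l2 H /eqP Ec; case: s Hs Rs => // d r1 r2 Hs /eqP Ed.
have [a [b [E1 <-]]] := beyond_ear Hs; have [a' [b' [E2 <-]]] := beyond_ear H.
by rewrite Ed -Ec in E1; have [-> ->] := ear_unique W E1 E2.
Qed.

Lemma neighbours_ear w a b z : ear t u v w a b ->
  (z \in neighbours G w) <->
  z \in [set a; b] \/ exists a' b', ear t u v z a' b' /\ w \in [set a'; b'].
Proof.
move=> E; have [E1 E2 E3] := ear_edges E; rewrite inE /adj in_set2.
have wt := ear_inner E; split.
  move=> H; have [R|R] := leqP (rank t z) (rank t w).
    have [a' [b' [E' D]]] := adj_rank W H R wt; have [-> ->] := ear_unique W E E'.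
    by left; case: D => ->; rewrite eqxx ?orbT.
  have zt : z \in inner t by rewrite -rank_gt0 (leq_ltn_trans _ R).
  rewrite [[set w; z] \in _](_ : _ = ([set z; w] \in tedges t u v)) in H; last by rewrite setUC.
  have [a' [b' [E' D]]] := adj_rank W H (ltnW R) zt.
  by right; exists a', b'; split=> //; rewrite in_set2; case: D => ->; rewrite eqxx ?orbT.
case=> [/orP[] /eqP->|[a' [b' [E' /set2P D]]]]; first by rewrite setUC.
  by [].
by have [_ F1 F2] := ear_edges E'; case: D => ->; rewrite ?(setUC [set b']).
Qed.

(** Closed away from the root: no remaining apex has an eliminated foot. *)
Definition eliminated R := [/\ u \notin R, v \notin R &
  forall z a b, ear t u v z a b -> (a \in R) || (b \in R) -> z \in R].

Definition live R x := neighbours G x :\: R.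

Definition available R x := [&& x \notin R, x != u, x != v & #|live R x| == 2].

Lemma neighbours_sym x y : (x \in neighbours G y) = (y \in neighbours G x).
Proof. by rewrite !inE adj_sym. Qed.

Lemma feet_live R w a b : eliminated R -> ear t u v w a b -> w \notin R ->
  [set a; b] \subset live R w.
Proof.
move=> [_ _ C] E wR; apply/subsetP => z zab; rewrite in_setD.
apply/andP; split; last by apply/(neighbours_ear z E); left.
apply: contraNN wR => zR; apply: C E _; move: zab zR.
by rewrite in_set2 => /orP[] /eqP-> ->; rewrite ?orbT.
Qed.

Lemma available_ear R w : available R w -> w \in outer t u v ->
  exists a b, ear t u v w a b.
Proof.
case/and4P=> _ wu wv _; rewrite mem_outer (negPf wu) (negPf wv) /=.
exact: earP.
Qed.

(** The feet of a remaining vertex always remain, so two live neighbours can only be the feet. *)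
Lemma available_live R w a b : eliminated R -> available R w -> ear t u v w a b ->
  live R w = [set a; b].
Proof.
move=> ER /and4P[wR _ _ /eqP C] E; apply/esym/eqP; rewrite eqEcard (feet_live ER E wR) C.
by have [ab _ _ _ _] := ear_neq W E; rewrite cards2 ab.
Qed.

Lemma available_children R w a b z a' b' : eliminated R -> available R w ->
  ear t u v w a b -> ear t u v z a' b' -> w \in [set a'; b'] -> z \in R.
Proof.
move=> ER A E E' wz; apply/negPn/negP => zR.
have : z \in live R w.
  by rewrite in_setD zR; apply/(neighbours_ear z E); right; exists a', b'.
rewrite (available_live ER A E) in_set2.
have [Ra Rb] := rank_ear W E; have [Ra' Rb'] := rank_ear W E'.
have Rz : rank t w < rank t z by move: wz; rewrite in_set2 => /orP[] /eqP->.
case/orP => /eqP Ez; rewrite Ez in Rz.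
  by have := ltn_trans Ra Rz; rewrite ltnn.
by have := ltn_trans Rb Rz; rewrite ltnn.
Qed.

Lemma eliminated_add R w : eliminated R -> available R w -> w \in outer t u v ->
  eliminated (w |: R).
Proof.
move=> ER A wo; have [a [b E]] := available_ear A wo; have [uR vR C] := ER.
have /and4P[_ wu wv _] := A; split.
- by rewrite in_setU1 negb_or eq_sym wu.
- by rewrite in_setU1 negb_or eq_sym wv.
- move=> z a' b' E'; rewrite !in_setU1.
  case: (boolP (w \in [set a'; b'])) => [wz _|].
    by rewrite (available_children ER A E E' wz) orbT.
  rewrite in_set2 negb_or (eq_sym w a') (eq_sym w b') => /andP[/negPf-> /negPf->] /=.
  by move/(C _ _ _ E') ->; rewrite orbT.
Qed.

(** A remaining apex of maximal rank has no remaining neighbours except its feet, since any other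
    neighbour is an apex of larger rank. *)
Lemma available_exists R w : eliminated R -> w \in inner t -> w \notin R ->
  exists w', available R w' && (w' \in outer t u v).
Proof.
move=> ER wt wR.
have P0 : (w \in inner t) && (w \notin R) by rewrite wt.
have [w' /andP[wt' wR'] M] := @arg_maxnP T w
  (fun z => (z \in inner t) && (z \notin R)) (rank t) P0.
have [a [b E]] := earP u v wt'; have [ab _ _ wu wv] := ear_neq W E.
exists w'; rewrite /available wR' wu wv mem_outer wt' !orbT andbT /=.
have -> : live R w' = [set a; b]; last by rewrite cards2 ab.
apply/eqP; rewrite eqEsubset (feet_live ER E wR') andbT; apply/subsetP => z.
rewrite in_setD => /andP[zR /(neighbours_ear z E)[//|[a' [b' [E' wz]]]]].
have [Ra' Rb'] := rank_ear W E'.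
have Rz : rank t w' < rank t z by move: wz; rewrite in_set2 => /orP[] /eqP->.
by have := M z; rewrite zR (ear_inner E') => /(_ isT) /(leq_trans Rz); rewrite ltnn.
Qed.

Lemma live_add R w x : live (w |: R) x = live R x :\ w.
Proof. by apply/setP => z; rewrite !(in_setD, in_setU1, in_set1) negb_or andbA. Qed.

Lemma live_sym R x y : x \notin R -> y \notin R -> (x \in live R y) = (y \in live R x).
Proof. by move=> xR yR; rewrite !in_setD xR yR neighbours_sym. Qed.

(** A foot of [w] that is itself an apex has three live neighbours: [w] and its own two feet. Hence
    feet are not yet on the stack when [w] is popped. *)
Lemma feet_not_available R w a b x : eliminated R -> w \notin R -> ear t u v w a b ->
  x \in [set a; b] -> x \notin R /\ (x != u -> x != v -> 2 < #|live R x|).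
Proof.
move=> ER wR E xab; have xl := subsetP (feet_live ER E wR) _ xab.
have xR : x \notin R by move: xl; rewrite in_setD => /andP[].
split=> // xu xv.
have xt : x \in inner t.
  have [Oa Ob _] := ear_outer E.
  have : x \in outer t u v by move: xab; rewrite in_set2 => /orP[] /eqP->.
  by rewrite mem_outer (negPf xu) (negPf xv).
have [a' [b' E']] := earP u v xt; have [ab' _ _ _ _] := ear_neq W E'.
have S : w |: [set a'; b'] \subset live R x.
  rewrite subUset sub1set (feet_live ER E' xR) andbT.
  by rewrite live_sym.
apply: leq_trans (subset_leq_card S); rewrite cardsU1 cards2 ab'.
suff -> : w \notin [set a'; b'] by [].
rewrite in_set2; have [Ra Rb] := rank_ear W E; have [Ra' Rb'] := rank_ear W E'.
have Rx : rank t x < rank t w by move: xab; rewrite in_set2 => /orP[] /eqP->.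
apply/negP => /orP[] /eqP Ew; rewrite Ew in Rx.
  by have := ltn_trans Ra' Rx; rewrite ltnn.
by have := ltn_trans Rb' Rx; rewrite ltnn.
Qed.

End FixTree.

End Elimination.

(** * The program *)

(* Registers: 3 loop counter, 4 stack size, 5 vertex being eliminated, 6 and 7
   its feet, 8 and 9 current position in its adjacency list and end of the list,
   10 neighbour read, 11 and 12 apexes of the parts beyond the edges to the feet
   (n if there is none), 13-16 summaries of these parts.
   Arrays: 2 degrees among remaining vertices, 3 eliminated vertices, 4 stack of
   remaining vertices of degree 2, 5 and 6 feet, 7-12 fields of [summary]. *)

Definition push r :=
  If (neqE (Reg r) (Reg 1))
    (If (neqE (Reg r) (Reg 2))
      (If (neqE (Get 2 (Reg r)) (Const 2)) Skip
        (Seq (Put 4 (Reg 4) (Reg r)) (Assign 4 (Add (Reg 4) (Const 1))))) Skip) Skip.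

Definition initialize :=
  While (Defs.Sub (Reg 0) (Reg 3))
    (Seq (Put 2 (Reg 3) (Defs.Sub (Get 0 (Add (Reg 3) (Const 1))) (Get 0 (Reg 3))))
    (Seq (push 3) (Assign 3 (Add (Reg 3) (Const 1))))).

Definition rewind :=
  Seq (Assign 8 (Get 0 (Reg 5))) (Assign 9 (Get 0 (Add (Reg 5) (Const 1)))).

(** Register 6 is cleared because [find_feet] copies it to register 7 before any foot has been
    found, and what is copied must fit in a word. *)
Definition pop :=
  Seq (Assign 6 (Const 0))
  (Seq (Assign 4 (Defs.Sub (Reg 4) (Const 1)))
  (Seq (Assign 5 (Get 4 (Reg 4)))
  (Seq (Put 3 (Reg 5) (Const 1)) rewind))).

Definition scan c :=
  While (Defs.Sub (Reg 9) (Reg 8))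
    (Seq (Assign 10 (Get 1 (Reg 8))) (Seq c (Assign 8 (Add (Reg 8) (Const 1))))).

Definition find_feet :=
  If (Get 3 (Reg 10)) Skip (Seq (Assign 7 (Reg 6)) (Assign 6 (Reg 10))).

(** The sum of the stored feet minus the current vertex; an eliminated neighbour has the current
    vertex as one of its feet. *)
Definition other_foot :=
  Defs.Sub (Add (Get 5 (Reg 10)) (Get 6 (Reg 10))) (Reg 5).

Definition find_children :=
  If (Get 3 (Reg 10))
    (If (neqE other_foot (Reg 6))
      (If (neqE other_foot (Reg 7)) Skip (Assign 12 (Reg 10)))
      (Assign 11 (Reg 10)))
    Skip.

(** The summary of a child was stored relative to the order in which its feet had been found. Array
    5 tells whether the fields for the end [p] are the left or the right ones. *)
Definition fetch c p f :=
  If (neqE (Get 5 (Reg c)) (Reg p))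
    (Seq (Assign f (Get 11 (Reg c))) (Assign f.+1 (Get 12 (Reg c))))
    (Seq (Assign f (Get 9 (Reg c))) (Assign f.+1 (Get 10 (Reg c)))).

Definition store :=
  Seq (fetch 11 6 13) (Seq (fetch 12 7 15)
  (Seq (Put 5 (Reg 5) (Reg 6)) (Seq (Put 6 (Reg 5) (Reg 7))
  (Seq (Put 9 (Reg 5) (maxE (Get 7 (Reg 12)) (Reg 13)))
  (Seq (Put 10 (Reg 5) (minE (maxE (Get 8 (Reg 12)) (Reg 13)) (maxE (Get 7 (Reg 12)) (Reg 14))))
  (Seq (Put 11 (Reg 5) (maxE (Get 7 (Reg 11)) (Reg 15)))
  (Seq (Put 12 (Reg 5) (minE (maxE (Get 8 (Reg 11)) (Reg 15)) (maxE (Get 7 (Reg 11)) (Reg 16))))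
  (Seq (Put 8 (Reg 5) (minE (maxE (Get 8 (Reg 11)) (Get 7 (Reg 12)))
                            (maxE (Get 7 (Reg 11)) (Get 8 (Reg 12)))))
  (Put 7 (Reg 5) (Add (minE (maxE (Reg 14) (Reg 15)) (maxE (Reg 13) (Reg 16))) (Const 1))))))))))).

Definition release r :=
  Seq (Put 2 (Reg r) (Defs.Sub (Get 2 (Reg r)) (Const 1))) (push r).

Definition eliminate :=
  Seq pop (Seq (scan find_feet)
  (Seq (Seq (Assign 11 (Reg 0)) (Seq (Assign 12 (Reg 0)) rewind))
  (Seq (scan find_children)
  (Seq store (Seq (release 6) (Seq (release 7)
  (Assign 3 (Defs.Sub (Reg 3) (Const 1))))))))).

Definition program :=
  Seq initialize (Seq (Assign 3 (Defs.Sub (Reg 0) (Const 2)))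
  (Seq (While (Reg 3) eliminate) (Assign 0 (Get 7 (Reg 5))))).

(** * Correctness and running time of the program *)

Section Correctness.

Variables (n : nat) (t : tree 'I_n) (u v : 'I_n) (L : 'I_n -> seq 'I_n).
Let G := tgraph t u v.
Hypotheses (Wt : wf t u v) (Nt : t <> Leaf) (VG : vertices G = [set: 'I_n]).
Hypothesis HL : adjacency_lists G L.
Implicit Types (w x y z : 'I_n) (s : state) (R : {set 'I_n}).

Let lists := [seq map val (L x) | x <- enum 'I_n].
Let off i := sumn (take i (shape lists)).

Lemma mem_L x z : (z \in L x) = (z \in neighbours G x).
Proof. by rewrite (perm_mem (HL x)) mem_enum. Qed.

Lemma L_uniq x : uniq (L x).
Proof. by rewrite (perm_uniq (HL x)) enum_uniq. Qed.

Lemma size_L x : size (L x) = #|neighbours G x|.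
Proof. by rewrite (perm_size (HL x)) -cardE. Qed.

Lemma outer_all x : x \in outer t u v.
Proof. by rewrite -mem_tgraph -/G VG inE. Qed.

Lemma n_eq : n = (size (inner t)).+2.
Proof.
by have := tgraph_card Wt; rewrite -[tgraph t u v]/G VG cardsT card_ord.
Qed.

Lemma size_lists : size lists = n.
Proof. by rewrite size_map size_enum_ord. Qed.

Lemma nth_lists x : nth [::] lists x = map val (L x).
Proof. by rewrite (nth_map x) ?size_enum_ord // nth_ord_enum. Qed.

Lemma nth_shape x : nth 0 (shape lists) x = size (L x).
Proof. by rewrite (nth_map [::]) ?size_lists // nth_lists size_map. Qed.

Lemma off_next x : off x.+1 = off x + size (L x).
Proof.
by rewrite /off (take_nth 0) ?sumn_rcons ?nth_shape // size_map size_lists.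
Qed.

Lemma sum_size_L : \sum_(x < n) size (L x) = #|edges G| + #|edges G|.
Proof.
rewrite -(card_darts (tgraph_simple Wt)) -sum1_card.
rewrite (partition_big (fun d : 'I_n * 'I_n => d.1) predT) //=.
apply: eq_bigr => x _; rewrite size_L -sum1_card.
rewrite (reindex_onto (fun z => (x, z)) (fun d => d.2)) /=; last by case=> ? ? /andP[_ /eqP<-].
by apply: eq_bigl => z; rewrite !inE /= !eqxx !andbT.
Qed.

(** The total length of the lists is the degree sum [2(2n - 3)]. *)
Lemma off_n : off n <= 4 * n.
Proof.
rewrite /off take_oversize; last by rewrite size_map size_lists.
have -> : sumn (shape lists) = \sum_(x < n) size (L x).
  rewrite sumnE /shape /lists -map_comp big_map big_enum /=.
  by apply: eq_bigr => x _; rewrite size_map.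
rewrite sum_size_L (card_tedges Wt); have := n_eq.
by move: (size (inner t)) => m E; rewrite [in leqRHS]E; lia.
Qed.

Lemma off_le i : off i <= 4 * n.
Proof.
apply: leq_trans off_n; rewrite /off [X in _ <= sumn X]take_oversize.
  2: by rewrite size_map size_lists.
by rewrite -{2}(cat_take_drop i (shape lists)) sumn_cat leq_addr.
Qed.

Definition input s := [/\ reg s 0 = n, reg s 1 = u, reg s 2 = v,
  (forall i, i <= n -> arr s 0 i = off i) &
  forall x j, j < size (L x) -> arr s 1 (off x + j) = nth x (L x) j].

Lemma input_initial : input (input_state L u v).
Proof.
split=> // [i Hi|x j Hj].
  change (nth 0 [seq off i | i <- iota 0 n.+1] i = off i).
  by rewrite (nth_map 0) ?size_iota ?nth_iota.
change (nth 0 (flatten lists) (off x + j) = nth x (L x) j).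
have -> : off x + j = flatten_index (shape lists) x j by [].
have Hx : x < size (shape lists) by rewrite size_map size_lists.
have Hj' : j < nth 0 (shape lists) x by rewrite nth_shape.
rewrite nth_flatten flatten_indexKl // flatten_indexKr // nth_lists.
by rewrite (nth_map x).
Qed.

(* [s'] differs from [s] in work registers only. *)
Definition keep s s' := arr s' = arr s /\ forall r, r <= 5 -> reg s' r = reg s r.

Lemma keep_trans s1 s2 s3 : keep s1 s2 -> keep s2 s3 -> keep s1 s3.
Proof. by move=> [E1 H1] [E2 H2]; split=> [|r Hr]; rewrite ?E2 ?E1 ?H2 ?H1. Qed.

Lemma keep_set_reg s r k : 5 < r -> keep s (set_reg s r k).
Proof.
move=> Hr; split=> // r' Hr' /=; case: eqP => // E; move: Hr'.
by rewrite E leqNgt Hr.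
Qed.

Variable W : nat.
Hypothesis HW : 8 * n <= W.

(** Offsets into the concatenated lists reach up to [4 * n]. The margin of 8 fits below [8 * n]
    because [n] is at least 2. *)
Lemma small k : k <= 4 * n + 8 -> k <= W.
Proof. move=> H; apply: leq_trans HW; have := n_eq; lia. Qed.

Definition stack s (q : seq 'I_n) :=
  reg s 4 = size q /\ forall i d, i < size q -> arr s 4 i = nth d q i.

Definition pushes s x := [&& x != u, x != v & arr s 2 x == 2].

Lemma wp_push r x s q Q : input s -> reg s r = x -> r <> 4 -> stack s q -> size q <= n ->
  (forall s', (forall r', r' <> 4 -> reg s' r' = reg s r') ->
     (forall a i, a <> 4 -> arr s' a i = arr s a i) ->
     stack s' (if pushes s x then rcons q x else q) -> Q s') ->
  wp W (push r) s Q.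
Proof.
move=> [_ E1 E2 _ _] Er r4 [S1 S2] Hq H.
rewrite /push /pushes in H *; rewrite /= Er E1 E2.
have ne (a b : nat) : (a - b + (b - a) = 0) <-> (a = b) by lia.
split=> [/ne Nu|/ne Eu]; last first.
  by apply: H => //; rewrite -val_eqE /= Eu eqxx.
have xu : x != u by rewrite -val_eqE; apply/eqP.
split=> [/ne Nv|/ne Ev]; last first.
  by apply: H => //; rewrite -(val_eqE x v) /= Ev eqxx andbF.
have xv : x != v by rewrite -val_eqE; apply/eqP.
split=> [/ne Nd|/ne Ed].
  by apply: H => //; rewrite xu xv /=; case: eqP.
have Sm : size q <= W by apply: small; lia.
split; first by rewrite S1.
  apply: small; have := ltn_ord x; lia.
split; first by rewrite S1; apply: small; lia.
apply: H => [r' /eqP/negPf Hr'|a i /eqP/negPf Ha|] /=; first by rewrite Hr'.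
  by rewrite Ha.
rewrite xu xv Ed eqxx /=; split; first by rewrite /= size_rcons S1 addn1.
move=> i d; rewrite size_rcons ltnS /= S1 => Hi; rewrite nth_rcons.
by case: ltngtP Hi => // Hi _; apply: S2.
Qed.

(* The invariant [I] relates the state to the part of the list already read. *)
Lemma runs_scan c (I : seq 'I_n -> state -> Prop) w s s0 :
  input s0 -> (forall p s, I p s -> keep s0 s /\ reg s 9 = off w.+1) ->
  (forall p z q s, L w = p ++ z :: q -> I p s -> reg s 10 = z ->
     wp W c s (fun s' => I (rcons p z) s' /\ reg s' 8 = reg s 8)) ->
  (forall p s k, I p s -> I p (set_reg s 8 k)) ->
  (forall p s k, I p s -> I p (set_reg s 10 k)) ->
  I [::] s -> reg s 8 = off w ->
  runs W (scan c) s ((time c + 13) * size (L w) + 4) (I (L w)).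
Proof.
move=> In Ik Hc I8 I10 I0 E8.
pose J m s := exists p q, [/\ L w = p ++ q, I p s, reg s 8 = off w + size p & m = size q].
have J0 : J (size (L w)) s by exists [::], (L w); rewrite addn0.
(* One round costs [time c + 7]: 3 for reading the neighbour and 4 for advancing. Each test of the
   guard costs 4 more. *)
have := @runs_while W (Defs.Sub (Reg 9) (Reg 8))
  (Seq (Assign 10 (Get 1 (Reg 8))) (Seq c (Assign 8 (Add (Reg 8) (Const 1)))))
  (time c + 7) J (I (L w)) _ _ _ _ J0.
move=> H; apply: runs_weaken (H _ _) _ (fun s' K => K); last by rewrite /=; lia.
- move=> m s1 [p [q [EL Ip E]]] /=; have [K E9] := Ik _ _ Ip.
  rewrite E9 E off_next EL size_cat; case: q EL => [|z q] EL; first by rewrite addn0 subnn.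
  move=> -> _; exists (size q) => //.
  have [[_ _ _ _ Adj] Hz] : input s0 /\ z \in L w by rewrite EL mem_cat inE eqxx orbT.
  have Rz : arr s1 1 (reg s1 8) = z.
    rewrite K.1 E Adj ?EL ?size_cat ?nth_cat ?ltnn ?subnn //=; lia.
  have Ez : off w + (size p).+1 <= 4 * n.
    by rewrite (leq_trans _ (off_le w.+1)) // off_next EL size_cat leq_add2l /= addnS ltnS leq_addr.
  apply: runs_weaken (wp_runs (Q := J (size q)) _) _ (fun s' K => K); last first.
    rewrite /= subSn // subnn muln1; lia.
  rewrite /= Rz; split; first by apply: small; have := ltn_ord z; lia.
  apply: wp_weaken (Hc p z q _ EL (I10 _ _ _ Ip) _) _ => // s2 [I2 R2].
  rewrite R2 /= E; split; first by apply: small; lia.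
  exists (rcons p z), q; rewrite cat_rcons; split=> //; first exact: I8.
  by rewrite /= size_rcons addn1 addnS.
- move=> m s1 [p [q [EL Ip E]]] /=; have [_ ->] := Ik _ _ Ip.
  rewrite E off_next EL size_cat; case: q EL => [|z q] EL /=; last by lia.
  by move=> _; rewrite cats0.
Qed.

Definition stored s (i : nat) (S : summary) :=
  [/\ arr s 7 i = ud S, arr s 8 i = path_ud S, arr s 9 i = lfan_ud S,
      arr s 10 i = lpath_ud S & arr s 11 i = rfan_ud S /\ arr s 12 i = rpath_ud S].

Definition node_ok s x := exists (t' : tree 'I_n) (p q : 'I_n),
  [/\ beyond t u v t' p q, isroot t' x, arr s 5 x = p, arr s 6 x = q
    & stored s x (summarize t')].

(** Index [n] belongs to no vertex; its zero entries serve as the summary of an absent part, so the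
    recursion needs no case distinction. *)
Definition base R s :=
  [/\ input s, eliminated t u v R, forall x, x \in R -> node_ok s x,
      stored s n summary0 & forall x, x \notin R -> arr s 2 x = #|live t u v R x|].

(** After [w] has been popped, the flags already count it as eliminated, while degrees and summaries
    still refer to [R]. *)
Definition mid R w s q :=
  [/\ base R s, available t u v R w, reg s 5 = w, forall x, arr s 3 x = (x \in w |: R)
    & [/\ stack s q, uniq q & q =i [pred x | available t u v R x & x != w]]].

Definition invariant R s :=
  [/\ base R s, forall x, arr s 3 x = (x \in R)
    & exists q, [/\ stack s q, uniq q & q =i available t u v R]].

Lemma input_frame s s' : input s ->
  (forall r, r <= 2 -> reg s' r = reg s r) ->
  (forall a i, a <= 1 -> arr s' a i = arr s a i) -> input s'.
Proof.
move=> [E0 E1 E2 H0 H1] Hr Ha.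
split; rewrite ?Hr //; first by move=> i Hi; rewrite Ha // H0.
by move=> x j Hj; rewrite Ha // H1.
Qed.

Lemma stored_frame s s' i S : stored s i S ->
  (forall a, 7 <= a <= 12 -> arr s' a i = arr s a i) -> stored s' i S.
Proof. by move=> [? ? ? ? [? ?]] H; split; rewrite ?H //; split; rewrite H. Qed.

Lemma node_ok_frame s s' x : node_ok s x ->
  (forall a, 5 <= a <= 12 -> arr s' a x = arr s a x) -> node_ok s' x.
Proof.
move=> [s0 [p [q [B I E5 E6 S]]]] H; exists s0, p, q; split; rewrite ?H //.
apply: stored_frame S _ => a /andP[Ha Ha']; apply: H; rewrite Ha' andbT.
exact: leq_trans Ha.
Qed.

Lemma mid_keep R w s s' q : mid R w s q -> keep s s' -> mid R w s' q.
Proof.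
move=> [[In El Nd Nu Dg] A E5 Rm [[S1 S2] Uq Eq]] [Ea Er].
have In' : input s' by apply: input_frame In _ _ => [r Hr|a i _]; rewrite ?Er ?Ea // (leq_trans Hr).
split; rewrite ?Er //; last 2 first.
- by move=> x; rewrite Ea.
- by split=> //; split; rewrite ?Er // => i d; rewrite Ea; apply: S2.
split=> //; last by move=> x; rewrite Ea; apply: Dg.
  by move=> x /Nd H; apply: node_ok_frame H _ => a _; rewrite Ea.
by apply: stored_frame Nu _ => a _; rewrite Ea.
Qed.

Lemma size_stack (q : seq 'I_n) : uniq q -> size q <= n.
Proof. by move/card_uniqP <-; rewrite -[n in _ <= n]card_ord max_card. Qed.

Lemma neighbours_irrefl w : (w \in neighbours G w) = false.
Proof.
apply/negP; rewrite inE /adj => H; have := tedges_card Wt H.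
by rewrite setUid cards1.
Qed.

Lemma off_small i : off i <= W.
Proof. by apply: small; apply: leq_trans (off_le _) (leq_addr _ _). Qed.

Lemma ord_small x : x <= W.
Proof. by apply: small; have := ltn_ord x; lia. Qed.

(** * Elimination of a single vertex *)

Lemma pop_ok R s w0 : invariant R s -> available t u v R w0 ->
  runs W pop s (time pop) (fun s' => exists w q,
    [/\ mid R w s' q, reg s' 8 = off w, reg s' 9 = off w.+1, reg s' 3 = reg s 3
      & reg s' 6 <= n]).
Proof.
move=> [[In El Nd Nu Dg] Rm [q [[S1 S2] Uq Eq]]] A; apply: wp_runs.
have : w0 \in q by rewrite Eq.
case/lastP: q S1 S2 Uq Eq => // q w S1 S2 Uq Eq _.
have Sq := size_stack Uq; rewrite size_rcons in S1 Sq.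
have Ew : arr s 4 (size q) = w by rewrite (S2 _ w) ?size_rcons // nth_rcons ltnn eqxx.
have Aw : available t u v R w by rewrite -[available _ _ _ _ _]Eq mem_rcons inE eqxx.
have [_ _ _ Off _] := In; have wn := ltn_ord w.
rewrite /= S1 subn1 /= Ew addn1 !Off //; last exact: ltnW.
split=> //; split; first by apply: small; apply: leq_trans (ltnW Sq) _; lia.
split; first exact: ord_small.
split; [exact: ord_small|by apply: small; rewrite addnC|].
split; first exact: off_small.
split; first exact: off_small.
exists w, q; split=> //.
have wR : w \notin R by case/and4P: Aw.
split=> //.
- move=> x /=; rewrite in_setU1 (inj_eq val_inj); case: eqP => //= _; exact: Rm.
- split; first split=> //=.
  + by move=> i d Hi; rewrite (S2 _ d) ?size_rcons ?(leqW Hi) // nth_rcons Hi.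
  + by move: Uq; rewrite rcons_uniq => /andP[].
  + move=> x; have := Eq x; rewrite mem_rcons !inE; move: Uq; rewrite rcons_uniq => /andP[Nq _].
    case: eqP => [->|_] /= => [_|->]; last by rewrite andbT.
    by rewrite (negPf Nq) andbF.
Qed.

Lemma scan_feet_ok R w s q : mid R w s q -> reg s 8 = off w -> reg s 9 = off w.+1 ->
  reg s 6 <= n ->
  runs W (scan find_feet) s ((time find_feet + 13) * size (L w) + 4) (fun s' =>
    keep s s' /\ exists x y, [/\ reg s' 6 = x, reg s' 7 = y, x != y
      & live t u v R w = [set x; y]]).
Proof.
move=> M E8 E9 E6; have [[In El Nd Nu Dg] A E5 Rm _] := M.
pose alive := fun z => z \notin w |: R.
(* Registers 6 and 7 hold the last and the last but one live neighbour read so far; in the end there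
   are exactly two. *)
pose I p s' := [/\ keep s s', reg s' 9 = off w.+1, reg s' 6 <= n &
  forall f z, filter alive p = rcons f z -> reg s' 6 = z /\
    forall f' z', f = rcons f' z' -> reg s' 7 = z'].
have H := @runs_scan find_feet I w s s In _ _ _ _ _ E8.
apply: runs_weaken (H _ _ _ _ _) (leqnn _) _ => {H}.
- by move=> p s' [].
- move=> p z r s' EL [K K9 K6 KI] Rz; rewrite /= Rz K.1 Rm; split.
    case: (boolP (z \in w |: R)) => // zR _; split=> //; split=> //.
    by rewrite filter_rcons /alive zR.
  case: (boolP (z \in w |: R)) => // zR _; split.
    by apply: small; apply: leq_trans K6 _; lia.
  split; first exact: ord_small.
  split=> //; split=> //=.
  + by apply: keep_trans K _; apply: (keep_trans (keep_set_reg _ _ _) (keep_set_reg _ _ _)).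
  + exact: ltnW.
  + rewrite filter_rcons /alive zR => f z0 /rcons_inj[Ef <-]; split=> // f' z' Ef'.
    by case: (KI f' z'); rewrite ?Ef.
- move=> p s' k [K K9 K6 KI]; split=> //; exact: keep_trans K (keep_set_reg _ _ _).
- move=> p s' k [K K9 K6 KI]; split=> //; exact: keep_trans K (keep_set_reg _ _ _).
- by split=> // -[].
move=> s' [K _ _ KI]; split=> //.
have F z : (z \in filter alive (L w)) = (z \in live t u v R w).
  rewrite mem_filter mem_L /alive in_setU1 negb_or in_setD -[tgraph t u v]/G.
  by case: eqP => [->|_] //=; rewrite neighbours_irrefl andbF.
have S2 : size (filter alive (L w)) = 2.
  have /and4P[_ _ _ /eqP <-] := A.
  by rewrite -(card_uniqP (filter_uniq alive (L_uniq w))); apply: eq_card F.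
move: S2 F (filter_uniq alive (L_uniq w)) KI.
case: (filter _ _) => // y [|x []] // _ F /=; rewrite inE => /andP[yx _].
move=> /(_ [:: y] x erefl)[-> /(_ [::] y erefl) ->].
exists x, y; split=> //; first by rewrite eq_sym.
by apply/setP => z; rewrite -F !inE orbC.
Qed.

(* The apex of [l], once it has been found in the list [p]. *)
Definition apex_in (l : tree 'I_n) (p : seq 'I_n) : nat :=
  if l is Node c _ _ then if c \in p then c : nat else n else n.

Definition apex (l : tree 'I_n) : nat := if l is Node c _ _ then c : nat else n.

Lemma apex_in_rcons l p z : apex_in l (rcons p z) = if isroot l z then z : nat else apex_in l p.
Proof.
case: l => //= c _ _; rewrite mem_rcons inE.
by case: eqP => [->|].
Qed.

Lemma beyond_flip w l r (x y : 'I_n) : beyond t u v (Node w l r) x y ->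
  beyond t u v (Node w (mirror r) (mirror l)) y x.
Proof. exact: beyond_mirror. Qed.

Lemma isroot_mirror (l : tree 'I_n) z : isroot (mirror l) z = isroot l z.
Proof. by case: l. Qed.

Lemma apex_mirror (l : tree 'I_n) : apex (mirror l) = apex l.
Proof. by case: l. Qed.

Section Step.

Variables (R : {set 'I_n}) (w x y : 'I_n) (l r : tree 'I_n).
Hypotheses (El : eliminated t u v R) (Aw : available t u v R w).
Hypothesis (B : beyond t u v (Node w l r) x y).

Lemma feet_ear : exists a b, ear t u v w a b /\ live t u v R w = [set x; y].
Proof.
have [a [b [E Eab]]] := beyond_ear B; exists a, b; split=> //.
by rewrite (available_live Wt El Aw E).
Qed.

Lemma left_child z : isroot l z -> z \in R /\ z \in L w.
Proof.
have [a [b [E Eab]]] := beyond_ear B; have := beyond_left B.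
case: l => // c l1 l2 Bc /eqP <-; have [a' [b' [E' Eab']]] := beyond_ear Bc.
have wc : w \in [set a'; b'] by rewrite Eab' set22.
have cR := available_children Wt El Aw E E' wc; split; first exact: cR.
by rewrite mem_L; apply: (proj2 (neighbours_ear Wt c E)); right; exists a', b'.
Qed.

(** The only neighbours of [w] that do not have [w] as a foot are the feet of [w], and these are
    live. *)
Lemma eliminated_neighbour (s' : tree 'I_n) (p q : 'I_n) z : z \in R -> z \in L w ->
  beyond t u v s' p q -> isroot s' z -> w \in [set p; q].
Proof.
move=> zR zL Bs Rs; have [a [b [E Elive]]] := feet_ear.
have Eab := available_live Wt El Aw E.
rewrite mem_L in zL; case: (proj1 (neighbours_ear Wt z E) zL) => [|[a' [b' [E' wz]]]].
  by rewrite -Eab in_setD zR.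
case: s' Bs Rs => // c s1 s2 Bs /eqP Ec; have [a1 [b1 [E1 <-]]] := beyond_ear Bs.
by rewrite Ec in E1; have [-> ->] := ear_unique Wt E1 E'.
Qed.

End Step.

Lemma scan_children_ok R w s q x y l r : mid R w s q ->
  reg s 6 = x -> reg s 7 = y -> x != y -> beyond t u v (Node w l r) x y ->
  reg s 11 = n -> reg s 12 = n -> reg s 8 = off w -> reg s 9 = off w.+1 ->
  runs W (scan find_children) s ((time find_children + 13) * size (L w) + 4) (fun s' =>
    [/\ keep s s', reg s' 6 = x, reg s' 7 = y, reg s' 11 = apex l & reg s' 12 = apex r]).
Proof.
move=> M E6 E7 xy B E11 E12 E8 E9; have [[In El Nd Nu Dg] A E5 Rm _] := M.
have Bf := beyond_flip B.
pose I p s' := [/\ keep s s', reg s' 9 = off w.+1, reg s' 6 = x, reg s' 7 = y &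
  reg s' 11 = apex_in l p /\ reg s' 12 = apex_in r p].
have H := @runs_scan find_children I w s s In _ _ _ _ _ E8.
apply: runs_weaken (H _ _ _ _ _) (leqnn _) _ => {H}.
- by move=> p s' [].
- move=> p z p' s' EL [K K9 K6 K7 [K11 K12]] Rz.
  have zL : z \in L w by rewrite EL mem_cat inE eqxx orbT.
  have zw : z != w by apply: contraTneq zL => ->; rewrite mem_L neighbours_irrefl.
  have Ez : eval s' (Get 3 (Reg 10)) = (z \in R).
    by rewrite /= Rz K.1 Rm in_setU1 (negPf zw).
  rewrite /find_children; split; rewrite Ez; last first.
    case: (boolP (z \in R)) => // zR _.
    have Nl : isroot l z = false by apply/negP => /(left_child El A B)[zR' _]; rewrite zR' in zR.
    have Nr : isroot r z = false.
      rewrite -isroot_mirror; apply/negP => /(left_child El A Bf)[zR' _].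
      by rewrite zR' in zR.
    by split=> //; split=> //; rewrite !apex_in_rcons Nl Nr.
  case: (boolP (z \in R)) => // zR _.
  have [t' [p1 [q1 [B1 R1 V5 V6 _]]]] := Nd z zR.
  have wpq := eliminated_neighbour El A B zR zL B1 R1.
  have [o [Eo Ev]] : exists o, [set p1; q1] = [set w; o] /\ eval s' other_foot = o.
    rewrite /= K.1 Rz V5 V6 (K.2 5) // E5.
    case/set2P: wpq => <-; [exists q1|exists p1]; split=> //; first by rewrite addKn.
      by rewrite setUC.
    by rewrite addnK.
  have Il : isroot l z = (o == x).
    apply/idP/eqP => [/(beyond_child Wt B B1 R1)|Eox]; last first.
      by apply/(beyond_child Wt B B1 R1); rewrite Eo Eox setUC.
    by rewrite Eo setUC => /set2_eqP[] [// -> ->].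
  have Ir : isroot r z = (o == y).
    rewrite -isroot_mirror; apply/idP/eqP => [/(beyond_child Wt Bf B1 R1)|Eoy]; last first.
      by apply/(beyond_child Wt Bf B1 R1); rewrite Eo Eoy setUC.
    by rewrite Eo setUC => /set2_eqP[] [// -> ->].
  have zW : z <= W := ord_small z.
  have Oy : (eval s' (neqE other_foot (Reg 7)) = 0) <-> o = y.
    by rewrite eval_neqE Ev [eval _ _]/= K7; split=> [/val_inj|->].
  have Ox : (eval s' (neqE other_foot (Reg 6)) = 0) <-> o = x.
    by rewrite eval_neqE Ev [eval _ _]/= K6; split=> [/val_inj|->].
  split=> [Nx|/Ox Eox].
    have {Nx} Nx : o != x by apply/eqP => /Ox.
    split=> [Ny|/Oy Eoy].
      have {Ny} Ny : o != y by apply/eqP => /Oy.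
      by split=> //; split=> //; rewrite !apex_in_rcons ?Il ?Ir (negPf Nx) (negPf Ny).
    split; first by rewrite /= Rz.
    split=> //; rewrite /= Rz; split=> //; first exact: keep_trans K (keep_set_reg _ _ _).
    by split; rewrite /= ?K11 !apex_in_rcons ?Il ?Ir ?(negPf Nx) // Eoy eqxx.
  split; first by rewrite /= Rz.
  split=> //; rewrite /= Rz; split=> //; first exact: keep_trans K (keep_set_reg _ _ _).
  split; rewrite /= ?K12 !apex_in_rcons ?Il ?Ir; first by rewrite Eox eqxx.
  by rewrite Eox (negPf xy).
- move=> p s' k [K K9 K6 K7 K11]; split=> //; exact: keep_trans K (keep_set_reg _ _ _).
- move=> p s' k [K K9 K6 K7 K11]; split=> //; exact: keep_trans K (keep_set_reg _ _ _).
- by split=> //; split; [case: (l)|case: (r)].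
move=> s' [K _ K6 K7 [K11 K12]]; split=> //.
  by rewrite K11; case: (l) B => // c l1 l2 B'; rewrite /= (left_child El A B' _).2 /=.
rewrite K12; case: (r) Bf => // c l1 l2 B'.
by rewrite /= (left_child El A B' (z := c) _).2 //= eqxx.
Qed.

Lemma summary_small (l : tree 'I_n) (x y : 'I_n) : beyond t u v l x y ->
  let S := summarize l in
  [/\ ud S <= n, path_ud S <= n, lfan_ud S <= n, lpath_ud S <= n
    & rfan_ud S <= n /\ rpath_ud S <= n].
Proof.
move=> B; have [[m1 m2 m3] [m4 m5 m6 m7]] := summarize_monotone l.
have Sz : ud (summarize l) <= n.
  have Wl : wf l x y by case: B => /located_wf/(_ Wt) //; rewrite wf_mirror.
  apply: leq_trans (ud_le_size l) (size_stack _).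
  by move: Wl; rewrite /wf /outer cons_uniq rcons_uniq => /and3P[].
have S1 : path_ud (summarize l) <= n := leq_trans m1 Sz.
split=> //; [exact: leq_trans m2 Sz|exact: leq_trans m6 S1|].
by split; [exact: leq_trans m3 Sz|exact: leq_trans m7 S1].
Qed.

(** The conditions on array 5 are those tested by [fetch], one for each orientation of the stored
    child; if the part is absent, every entry involved is 0. *)
Lemma child_stored R s w x y l r : base R s -> available t u v R w ->
  beyond t u v (Node w l r) x y ->
  [/\ arr s 7 (apex l) = ud (summarize l), arr s 8 (apex l) = path_ud (summarize l),
      arr s 5 (apex l) = x ->
        arr s 9 (apex l) = lfan_ud (summarize l) /\ arr s 10 (apex l) = lpath_ud (summarize l)
    & arr s 5 (apex l) <> x ->
        arr s 11 (apex l) = lfan_ud (summarize l) /\ arr s 12 (apex l) = lpath_ud (summarize l)].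
Proof.
move=> [In El Nd Nu Dg] A B; case El0 : l => [|c l1 l2].
  by case: Nu => N1 N2 N3 N4 [N5 N6]; rewrite /= N1 N2 N3 N4 N5 N6.
have Rc : isroot l c by rewrite El0 /= eqxx.
have [cR _] := left_child El A B Rc.
have [t' [p [q [B1 R1 V5 V6 [V7 V8 V9 V10 [V11 V12]]]]]] := Nd c cR.
rewrite -El0; have -> : apex l = c by rewrite El0.
have Bl := beyond_left B.
have := proj2 (beyond_child Wt B B1 R1) Rc => /set2_eqP[] [Ep Eq]; subst p q.
  have Et := beyond_unique Wt B1 Bl; subst t'.
  by rewrite V7 V8 V9 V10 V5; split.
have Et := beyond_unique Wt (beyond_mirror B1) Bl; rewrite -Et.
rewrite V7 V8 V11 V12 V5 summarize_mirror; split=> // /val_inj E.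
have Wl : wf l x w by case: (Bl) => /located_wf/(_ Wt) //; rewrite wf_mirror.
by have := wf_neq Wl; rewrite E eqxx.
Qed.

Lemma maxE_nat a b : a + (b - a) = maxn a b. Proof. lia. Qed.
Lemma minE_nat a b : a - (a - b) = minn a b. Proof. lia. Qed.

Lemma wp_fetch R s w x y l r c p f Q : base R s -> available t u v R w ->
  beyond t u v (Node w l r) x y -> reg s c = apex l -> reg s p = x -> f != c ->
  Q (set_reg (set_reg s f (lfan_ud (summarize l))) f.+1 (lpath_ud (summarize l))) ->
  wp W (fetch c p f) s Q.
Proof.
move=> Ba A B Ec Ep fc HQ; have [_ _ H9 H11] := child_stored Ba A B.
have [_ _ S3 S4 _] := summary_small (beyond_left B).
have n4 : n <= 4 * n + 8 by lia.
rewrite /fetch; split=> [/(contra_not (proj2 (eval_neqE _ _ _)))|/eval_neqE] /=; rewrite Ec Ep.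
  move=> /H11[-> E12]; split; first by apply: small; apply: leq_trans S3 n4.
  rewrite eq_sym (negPf fc) E12; split=> //; by apply: small; apply: leq_trans S4 n4.
move=> /H9[-> E10]; split; first by apply: small; apply: leq_trans S3 n4.
rewrite eq_sym (negPf fc) E10; split=> //; by apply: small; apply: leq_trans S4 n4.
Qed.

Lemma wp_seq c1 c2 s Q : wp W c1 s (fun s1 => wp W c2 s1 Q) -> wp W (Seq c1 c2) s Q.
Proof. by []. Qed.

Lemma wp_store R w s q x y l r Q : mid R w s q -> beyond t u v (Node w l r) x y ->
  reg s 6 = x -> reg s 7 = y -> reg s 11 = apex l -> reg s 12 = apex r ->
  (forall s', (forall k, k <= 7 -> reg s' k = reg s k) ->
     (forall a (i : nat), a <= 4 \/ i <> w -> arr s' a i = arr s a i) ->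
     arr s' 5 w = x -> arr s' 6 w = y -> stored s' w (summarize (Node w l r)) -> Q s') ->
  wp W store s Q.
Proof.
move=> [Ba A E5 _ _] B E6 E7 E11 E12 HQ.
have Bf := beyond_flip B; have [In El Nd Nu Dg] := Ba.
have Wl : apex l <> w.
  case El0 : l => [|c l1 l2] /=; first by move=> E; have := ltn_ord w; rewrite -E ltnn.
  have Rc : isroot l c by rewrite El0 /= eqxx.
  have [cR _] := left_child El A B Rc; move=> /val_inj Ecw.
  by case/and4P: A; rewrite -Ecw cR.
have Wr : apex r <> w.
  rewrite -apex_mirror; case El0 : (mirror r) => [|c l1 l2] /=.
    by move=> E; have := ltn_ord w; rewrite -E ltnn.
  have Rc : isroot (mirror r) c by rewrite El0 /= eqxx.
  have [cR _] := left_child El A Bf Rc; move=> /val_inj Ecw.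
  by case/and4P: A; rewrite -Ecw cR.
have [L7 L8 _ _] := child_stored Ba A B.
have [R7 R8 _ _] := child_stored Ba A Bf; rewrite apex_mirror summarize_mirror /= in R7 R8.
rewrite /store; apply: wp_seq; apply: (wp_fetch (f := 13) Ba A B E11 E6 isT).
apply: wp_seq.
set s1 := set_reg (set_reg s _ _) _ _.
have Ba1 : base R s1.
  split=> //; exact: input_frame In _ _.
have E12' : reg s1 12 = apex (mirror r) by rewrite apex_mirror -E12.
have E7' : reg s1 7 = y by rewrite -E7.
(* The right part is the left part of the reflected polygon. *)
apply: (wp_fetch (f := 15) Ba1 A Bf E12' E7' isT).
rewrite summarize_mirror /s1 => {s1 Ba1 E12' E7'}.
have [s1 s2 s3 s4 [s5 s6]] := summary_small B.
have n4 : n <= 4 * n + 8 by lia.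
have Sm k : k <= n -> k <= W by move=> Hk; apply: small; apply: leq_trans Hk n4.
rewrite /= E5 E6 E7 E11 E12 L7 L8 R7 R8 !maxE_nat !minE_nat addn1.
split; [exact: ord_small|exact: ord_small|].
split; [exact: ord_small|exact: ord_small|].
split; [exact: ord_small|exact: Sm s3|].
split; [exact: ord_small|exact: Sm s4|].
split; [exact: ord_small|exact: Sm s5|].
split; [exact: ord_small|exact: Sm s6|].
split; [exact: ord_small|exact: Sm s2|].
split; [exact: ord_small|exact: Sm s1|].
apply: HQ => //=.
- by case=> [|[|[|[|[|[|[|[|k]]]]]]]].
- move=> a i; case=> [Ha|/eqP/negPf Hi]; last by rewrite /= Hi !andbF.
  by case: a Ha => [|[|[|[|[|a]]]]].
- by rewrite eqxx.
- by rewrite eqxx.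
- by rewrite /stored /= eqxx.
Qed.

Lemma wp_release k x s q Q : input s -> reg s k = x -> k <> 4 -> stack s q -> size q <= n ->
  arr s 2 x <= n ->
  (forall s', (forall k', k' <> 4 -> reg s' k' = reg s k') ->
     (forall a i, a <> 4 -> a <> 2 -> arr s' a i = arr s a i) ->
     (forall z, arr s' 2 z = if z == x then arr s 2 x - 1 else arr s 2 z) ->
     stack s' (if [&& x != u, x != v & arr s 2 x - 1 == 2] then rcons q x else q) -> Q s') ->
  wp W (release k) s Q.
Proof.
move=> In Ek k4 [S1 S2] Hq Hd HQ; apply: wp_seq.
have n4 : n <= 4 * n + 8 by lia.
split; first by rewrite /= Ek; apply: ord_small.
  by rewrite /= Ek; apply: small; apply: leq_trans (leq_subr _ _) (leq_trans Hd n4).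
have -> : eval s (Reg k) = x by exact: Ek.
have -> : eval s (Defs.Sub (Get 2 (Reg k)) (Const 1)) = arr s 2 x - 1 by rewrite /= Ek.
set s1 := set_arr _ _ _ _.
have In1 : input s1 by apply: input_frame In _ _ => // -[|[|a]].
have Ek1 : reg s1 k = x by exact: Ek.
have St1 : stack s1 q by [].
apply: (wp_push In1 Ek1 k4 St1 Hq) => s' Hr Ha; rewrite /pushes /s1 /= eqxx => Hs.
apply: HQ => //.
- by move=> a i /eqP Na4 /eqP/negPf Na2; rewrite Ha ?/s1 /= ?Na2 //; apply/eqP.
- by move=> z; rewrite Ha.
Qed.

Lemma n_small : n <= W.
Proof. apply: small; lia. Qed.

(** Names the intermediate state before the rest of the program is considered, so that a long
    composition can be followed forwards. *)
Lemma runs_split c1 s T1 Q1 : runs W c1 s T1 Q1 -> exists s1, Q1 s1 /\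
  forall c2 T2 Q2, runs W c2 s1 T2 Q2 -> runs W (Seq c1 c2) s (T1 + T2) Q2.
Proof.
move=> [t1 [s1 [E1 B1 H1]]]; exists s1; split=> // c2 T2 Q2 [t2 [s2 [E2 B2 H2]]].
exists (t1 + t2), s2; split; [exact: ExecSeq E1 E2|exact: leq_add|by []].
Qed.

Lemma card_live_add R w x y z : eliminated t u v R -> available t u v R w ->
  live t u v R w = [set x; y] -> z \notin R ->
  #|live t u v (w |: R) z| = #|live t u v R z| - (z \in [set x; y]).
Proof.
move=> El Aw Ew zR; have wR : w \notin R by case/and4P: Aw.
by rewrite live_add (cardsD1 w (live t u v R z)) (live_sym t u v wR zR) Ew addKn.
Qed.

Lemma finish_ok R w s q x y l r : mid R w s q -> reg s 6 = x -> reg s 7 = y -> x != y ->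
  live t u v R w = [set x; y] -> beyond t u v (Node w l r) x y ->
  reg s 11 = apex l -> reg s 12 = apex r -> reg s 3 <= n ->
  wp W (Seq store (Seq (release 6) (Seq (release 7)
    (Assign 3 (Defs.Sub (Reg 3) (Const 1)))))) s
    (fun s' => [/\ invariant (w |: R) s', reg s' 3 = reg s 3 - 1 & reg s' 5 = w]).
Proof.
move=> M E6 E7 xy Ew B E11 E12 E3; have [[In El Nd Nu Dg] A E5 Rm [[S1 S2] Uq Eq]] := M.
have wR : w \notin R by case/and4P: A.
have [a [b [E Eab]]] := beyond_ear B.
have xab : x \in [set a; b] by rewrite Eab set21.
have yab : y \in [set a; b] by rewrite Eab set22.
have [xR Bx] := feet_not_available Wt El wR E xab.
have [yR By] := feet_not_available Wt El wR E yab.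
have Nav z : (z != u -> z != v -> 2 < #|live t u v R z|) -> z \notin q.
  move=> H; rewrite Eq inE; apply/negP => /andP[/and4P[_ zu zv /eqP Cz] _].
  by have := H zu zv; rewrite Cz.
(* Neither foot is on the stack: it has more than two live neighbours or is an end of the base. So
   the pushes below create no duplicates. *)
have xq := Nav x Bx; have yq := Nav y By.
have Cn z : #|live t u v R z| <= n.
  by apply: leq_trans (max_card _) _; rewrite card_ord.
apply: wp_seq; apply: (wp_store M B E6 E7 E11 E12) => s5 R5 A5 V5 V6 Sw.
have In5 : input s5.
  apply: input_frame In _ _ => [k Hk|c i Hc]; first by apply: R5; apply: leq_trans Hk _.
  by apply: A5; left; apply: leq_trans Hc _.
have E65 : reg s5 6 = x by rewrite R5.
have St5 : stack s5 q.
  by split; [rewrite R5|move=> i d Hi; rewrite A5; [apply: S2|left]].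
have Sq := size_stack Uq.
have D5 z : z \notin R -> arr s5 2 z = #|live t u v R z| by move=> /Dg <-; apply: A5; left.
have Dx : arr s5 2 x <= n by rewrite D5.
apply: wp_seq; apply: (wp_release In5 E65 _ St5 Sq Dx) => // s6 R6 A6 D6; rewrite D5 // => St6.
have In6 : input s6.
  apply: input_frame In5 _ _ => [k Hk|c i Hc]; first by apply: R6 => Ek; rewrite Ek in Hk.
  by apply: A6 => Ec; rewrite Ec in Hc.
have E76 : reg s6 7 = y by rewrite R6 // R5.
have D6y : arr s6 2 y = #|live t u v R y| by rewrite D6 eq_sym (negPf xy) D5.
set q6 := if _ then rcons q x else q in St6.
have U6 : uniq q6 by rewrite /q6; case: ifP; rewrite // rcons_uniq xq.
have Dy : arr s6 2 y <= n by rewrite D6y.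
apply: wp_seq; apply: (wp_release In6 E76 _ St6 (size_stack U6) Dy) => // s7 R7 A7 D7.
rewrite D6y => St7; set q7 := if _ then rcons q6 y else q6 in St7.
have R73 : reg s7 3 = reg s 3 by rewrite R7 // R6 // R5.
split.
  by rewrite /= R73; apply: leq_trans (leq_subr _ _) (leq_trans E3 n_small).
have yq6 : y \notin q6.
  by rewrite /q6; case: ifP => _ //; rewrite mem_rcons inE eq_sym (negPf xy).
have A37 c (i : nat) : c <> 2 -> c <> 4 -> c <= 4 \/ i <> w -> arr s7 c i = arr s c i.
  by move=> c2 c4 H; rewrite A7 // A6 // A5.
have A57 c (i : nat) : c <> 2 -> c <> 4 -> arr s7 c i = arr s5 c i.
  by move=> c2 c4; rewrite A7 // A6.
have Dg7 z : z \notin w |: R -> arr s7 2 z = #|live t u v (w |: R) z|.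
  rewrite in_setU1 negb_or => /andP[zw zR].
  rewrite D7 D6y D6 !D5 // (card_live_add El A Ew zR) in_set2.
  case: (eqVneq z y) => [->|_]; first by rewrite eq_sym (negPf xy).
  by case: (eqVneq z x) => [->|_]; rewrite ?subn0.
split=> /=; last 2 first.
- by rewrite R73.
- by rewrite R7 // R6 // R5.
have ge5 c : 5 <= c -> c <> 2 /\ c <> 4 by move=> Hc; split=> Ec; rewrite Ec in Hc.
split=> //.
- split.
  + apply: input_frame In6 _ _ => [k Hk|c i Hc].
      by rewrite /= -R7; [case: k Hk => [|[|[|k]]]|move=> Ek; rewrite Ek in Hk].
    by rewrite /= A7 // => Ec; rewrite Ec in Hc.
  + by apply: eliminated_add => //; apply: outer_all.
  + move=> z; rewrite in_setU1 => zR'; case: (eqVneq z w) zR' => [-> _|zw /= zR].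
      exists (Node w l r), x, y; split=> //=; rewrite ?A57 //.
      by apply: stored_frame Sw _ => c /andP[Hc _] /=; apply: A57 => Ec; rewrite Ec in Hc.
    apply: node_ok_frame (Nd z zR) _ => c /andP[Hc _] /=; have [c2 c4] := ge5 c Hc.
    by apply: A37 => //; right=> /val_inj Ezw; rewrite Ezw eqxx in zw.
  + apply: stored_frame Nu _ => c /andP[Hc _] /=.
    have [c2 c4] := ge5 c (leq_trans (isT : 5 <= 7) Hc).
    by apply: A37 => //; right=> Enw; have := ltn_ord w; rewrite -Enw ltnn.
  + by move=> z /Dg7.
- by move=> z /=; rewrite A37 ?Rm //; left.
exists q7; split.
- by split; [exact: St7.1|exact: St7.2].
- by rewrite /q7; case: ifP; rewrite // rcons_uniq yq6.
have lx : #|live t u v (w |: R) x| = #|live t u v R x| - 1.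
  by rewrite (card_live_add El A Ew xR) set21.
have ly : #|live t u v (w |: R) y| = #|live t u v R y| - 1.
  by rewrite (card_live_add El A Ew yR) set22.
have [_ wx' wy' _ _] : [/\ True, w != x, w != y, True & True].
  split=> //; [apply: contraTneq xab => <-|apply: contraTneq yab => <-];
  have [_ wa wb _ _] := ear_neq Wt E; by rewrite in_set2 negb_or wa wb.
have xR' : x \notin w |: R by rewrite in_setU1 negb_or eq_sym wx' xR.
have yR' : y \notin w |: R by rewrite in_setU1 negb_or eq_sym wy' yR.
have Hy : (y \in q7) = available t u v (w |: R) y.
  rewrite /available yR' ly /q7; case: ifP => H; first by rewrite mem_rcons inE eqxx ?H.
  by rewrite (negPf yq6) ?H.
have Hx : (x \in q7) = available t u v (w |: R) x.
  have -> : (x \in q7) = (x \in q6).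
    by rewrite /q7; case: ifP => _ //; rewrite mem_rcons inE (negPf xy).
  rewrite /available xR' lx /q6; case: ifP => H; first by rewrite mem_rcons inE eqxx ?H.
  by rewrite (negPf xq) ?H.
move=> z; case: (eqVneq z y) => [->|zy]; first exact: Hy.
case: (eqVneq z x) => [->|zx]; first exact: Hx.
have -> : (z \in q7) = (z \in q).
  by rewrite /q7 /q6; do 2 case: ifP => _; rewrite ?(mem_rcons, in_cons) ?(negPf zy) ?(negPf zx).
(* A vertex other than [w] and its feet loses no live neighbour, so its status is unchanged. *)
apply: etrans (Eq z) _; change (available t u v R z && (z != w) = available t u v (w |: R) z).
rewrite /available in_setU1 negb_or.
case: (eqVneq z w) => [->|zw] /=; first by rewrite andbF.
rewrite andbT; case: (boolP (z \in R)) => //= zR.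
by rewrite (card_live_add El A Ew zR) in_set2 (negPf zx) (negPf zy) subn0.
Qed.

Lemma beyond_exists R w x y : eliminated t u v R -> available t u v R w ->
  live t u v R w = [set x; y] -> exists l r, beyond t u v (Node w l r) x y.
Proof.
move=> El A Ew; have [a [b [l [r H]]]] := available_ear A (outer_all w).
have E : ear t u v w a b by exists l, r.
have := available_live Wt El A E; rewrite Ew => /set2_eqP[] [-> ->].
  by exists l, r; left.
by exists (mirror r), (mirror l); right; rewrite /= !mirrorK.
Qed.

Lemma eliminate_ok R s w0 : invariant R s -> available t u v R w0 -> reg s 3 <= n ->
  exists2 w, available t u v R w & runs W eliminate s (500 * (size (L w)).+1)
    (fun s' => [/\ invariant (w |: R) s', reg s' 3 = reg s 3 - 1 & reg s' 5 = w]).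
Proof.
move=> Inv A0 E3; have [s1 [[w [q [M1 E8 E9 E31 E6]]] K1]] := runs_split (pop_ok Inv A0).
have [_ A _ _ _] := M1; exists w => //.
have [s2 [[Kp2 [x [y [E62 E72 xy Ew]]]] K2]] := runs_split (scan_feet_ok M1 E8 E9 E6).
have M2 := mid_keep M1 Kp2; have [[In2 El2 _ _ _] _ E52 _ _] := M2.
have [l [r B]] := beyond_exists El2 A Ew.
pose c := Seq (Assign 11 (Reg 0)) (Seq (Assign 12 (Reg 0)) rewind).
have W3 : wp W c s2 (fun s3 => [/\ keep s2 s3, reg s3 6 = x, reg s3 7 = y &
    [/\ reg s3 11 = n, reg s3 12 = n, reg s3 8 = off w & reg s3 9 = off w.+1]]).
  have [En _ _ Off _] := In2; have wn := ltn_ord w.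
  rewrite /= En E52 addn1 !Off //; last exact: ltnW.
  have nW := n_small.
  do 2 (split=> //); split; first exact: off_small.
  split; first exact: off_small.
  by split=> //; split=> // k; case: k => [|[|[|[|[|[|k]]]]]].
have [s3 [[Kp3 E63 E73 [E113 E123 E83 E93]] K3]] := runs_split (wp_runs W3).
have M3 := mid_keep M2 Kp3.
have [s4 [[Kp4 E64 E74 E114 E124] K4]] := runs_split
  (scan_children_ok M3 E63 E73 xy B E113 E123 E83 E93).
have M4 := mid_keep M3 Kp4.
have E34 : reg s4 3 = reg s 3 by rewrite Kp4.2 // Kp3.2 // Kp2.2.
have E34n : reg s4 3 <= n by rewrite E34.
have F := finish_ok M4 E64 E74 xy Ew B E114 E124 E34n.
apply: runs_weaken (K1 _ _ _ (K2 _ _ _ (K3 _ _ _ (K4 _ _ _ (wp_runs F))))) _ _; last first.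
  by move=> s' [I' E' E5']; rewrite -E34.
move: (size (L w)) => m.
(* The fixed costs are evaluated to numerals; 500 is a round bound covering the two scans per
   neighbour as well as the rest. *)
set c1 := time pop; set c2 := time find_feet; set c3 := time c; set c4 := time find_children.
set c5 := time _; vm_compute in c1, c2, c3, c4, c5; rewrite /c1 /c2 /c3 /c4 /c5; lia.
Qed.

(** * Total running time *)

(** Initialisation takes at most 100 + 4 per vertex, the main loop 500 + 2 per unit of weight, each
    including its guard; the other terms are the final tests and the two single assignments. *)
Lemma total_cost m k : k <= 5 * m -> 3 <= m ->
  104 * m + 4 + (4 + (502 * k + 2 + 3)) <= 4000 * m.
Proof. lia. Qed.

(** A potential: each remaining vertex has yet to pay for the scans of its own list, and it does so
    once. The degree sum keeps the initial value linear. *)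
Definition weight R := \sum_(z in ~: R) (size (L z)).+1.

Lemma weight_add R w : w \notin R ->
  weight R = (size (L w)).+1 + weight (w |: R).
Proof.
move=> wR; rewrite /weight (big_setD1 w) ?in_setC //=; congr (_ + _).
by apply: eq_bigl => z; rewrite !inE negb_or.
Qed.

Lemma weight0 : weight set0 <= 5 * n.
Proof.
rewrite /weight setC0 (eq_bigl predT) => [|z]; last by rewrite inE.
have -> : \sum_i (size (L i)).+1 = \sum_i size (L i) + n.
  rewrite (eq_bigr (fun i => size (L i) + 1)) => [|i _]; last by rewrite addn1.
  by rewrite big_split /= sum_nat_const cardT size_enum_ord muln1.
rewrite sum_size_L (card_tedges Wt); have := n_eq.
by move: (size (inner t)) => m E; rewrite [X in _ + X]E [in leqRHS]E; lia.
Qed.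

Lemma card_setC_add R w : w \notin R -> #|~: R| = #|~: (w |: R)|.+1.
Proof.
move=> wR; rewrite (cardsD1 w (~: R)) inE wR add1n; congr _.+1.
by apply: eq_card => z; rewrite !inE negb_or.
Qed.

(* The vertex eliminated last, if any, has remaining feet. *)
Definition last_ok R s := R = set0 \/ exists w, [/\ w \in R, reg s 5 = w &
  forall a b, ear t u v w a b -> (a \notin R) && (b \notin R)].

Definition loop_inv m s := exists R,
  [/\ invariant R s, reg s 3 = #|~: R| - 2, m = weight R & last_ok R s].

Lemma loop_step m s : loop_inv m s -> eval s (Reg 3) <> 0 ->
  exists2 m', m' < m & runs W eliminate s (500 * (m - m')) (loop_inv m').
Proof.
move=> [R [Inv E3 -> _]]; rewrite /= E3 => N0.
have [[_ El _ _ _] _ _] := Inv.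
have C : #|~: R| <= n by apply: leq_trans (max_card _) _; rewrite card_ord.
have [w1 w1R w1t] : exists2 w1, w1 \notin R & w1 \in inner t.
  have : ~~ (~: R \subset [set u; v]).
    apply/negP => /subset_leq_card; rewrite cards2 => H; apply: N0.
    apply/eqP; rewrite subn_eq0; apply: leq_trans H _; by case: (_ != _).
  case/subsetPn => w1; rewrite in_setC in_set2 => w1R N; exists w1 => //.
  by have := outer_all w1; rewrite mem_outer orbA (negPf N).
have [w0 /andP[A0 _]] := available_exists Wt El w1t w1R.
have E3n : reg s 3 <= n by rewrite E3 (leq_trans (leq_subr _ _)).
have [w A H] := eliminate_ok Inv A0 E3n.
have wR : w \notin R by case/and4P: A.
exists (weight (w |: R)); first by rewrite (weight_add wR) addSn ltnS leq_addl.
rewrite (weight_add wR) addnK.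
apply: runs_weaken H (leqnn _) _ => s' [I' E' E5']; exists (w |: R); split=> //.
  by rewrite E' E3 (card_setC_add wR) -subnDA addnC subnDA subn1.
right; exists w; split=> //; first by rewrite setU11.
move=> a b E; have S := feet_live Wt El E wR; rewrite !in_setU1 !negb_or.
have [_ wa wb _ _] := ear_neq Wt E; rewrite eq_sym wa eq_sym wb /=.
have := subsetP S a (set21 _ _); have := subsetP S b (set22 _ _).
by rewrite !in_setD => /andP[-> _] /andP[-> _].
Qed.

(** When only [u] and [v] remain, they must be the feet of the vertex eliminated last, so its part
    is the whole polygon up to reflection. *)
Lemma loop_end m s : loop_inv m s -> eval s (Reg 3) = 0 ->
  exists2 w, reg s 5 = w & arr s 7 w = ud (summarize t).
Proof.
move=> [R [[[_ El Nd _ _] _ _] E3 _ La]]; rewrite /= E3 => /eqP; rewrite subn_eq0 => C2.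
have [uR vR _] := El; have uv := wf_neq Wt.
case: La => [R0|[w [wR E5 Hw]]].
  move: C2; rewrite R0 setC0 cardsT card_ord; have := n_eq.
  case: (t) Nt => // w l r _ En; rewrite leqNgt => /negP[].
  by rewrite En /= size_cat addnS.
exists w => //; have [s' [p [q [B Rs _ _ [-> _ _ _ _]]]]] := Nd w wR.
have RC : ~: R = [set u; v].
  by apply/esym/eqP; rewrite eqEcard subUset !sub1set !in_setC uR vR cards2 uv.
case: s' B Rs => // c l r B /eqP Ec; have [a [b [E Eab]]] := beyond_ear B.
rewrite Ec in E; have /andP[aR bR] := Hw a b E.
have [ab _ _ _ _] := ear_neq Wt E.
have Euv : [set p; q] = [set u; v].
  rewrite -Eab; apply/eqP; rewrite eqEcard !cards2 ab uv subUset !sub1set -RC !in_setC aR bR //.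
case: B => H; first by have := located_base Wt H Euv => ->.
rewrite setUC in Euv; have Em := located_base Wt H Euv.
have -> : ud (summarize (Node c l r)) = ud (summarize (mirror (Node c l r))).
  by rewrite summarize_mirror.
by rewrite Em.
Qed.

(** The arrays from 3 on, apart from the stack, are still zero; this provides the cleared flags and
    the empty summary at index [n]. *)
Definition init_inv m s := exists i, [/\ i <= n, input s, reg s 3 = i, m = n - i &
  [/\ forall x : 'I_n, x < i -> arr s 2 x = #|neighbours G x|,
      forall a k, 3 <= a -> a <> 4 -> arr s a k = 0 &
      exists q, [/\ stack s q, uniq q &
        q =i [pred x : 'I_n | (x < i) && available t u v set0 x]]]].

Lemma live0 x : live t u v set0 x = neighbours G x.
Proof. by rewrite /live setD0. Qed.

Lemma init_step m s : init_inv m s -> eval s (Defs.Sub (Reg 0) (Reg 3)) <> 0 ->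
  exists2 m', m' < m & runs W
    (Seq (Put 2 (Reg 3) (Defs.Sub (Get 0 (Add (Reg 3) (Const 1))) (Get 0 (Reg 3))))
    (Seq (push 3) (Assign 3 (Add (Reg 3) (Const 1))))) s (100 * (m - m')) (init_inv m').
Proof.
move=> [i [Hi In E3 -> [Dg Z [q [St Uq Eq]]]]]; have [En _ _ Off _] := In.
rewrite [eval _ _]/= En E3 => /eqP; rewrite subn_eq0 -ltnNge => lt.
pose x := Ordinal lt; have Ex : i = x by [].
exists (n - i.+1); first by rewrite ltn_sub2l.
have Ed : n - i - (n - i.+1) = 1 by rewrite subnS -subn1 subKn // subn_gt0.
rewrite Ed muln1; set c := Seq _ _.
suff Hwp : wp W c s (init_inv (n - i.+1)).
  by apply: runs_weaken (wp_runs Hwp) _ (fun _ K => K).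
have Od : off i.+1 - off i = #|neighbours G x| by rewrite Ex off_next addKn size_L.
have Cn : #|neighbours G x| <= n by apply: leq_trans (max_card _) _; rewrite card_ord.
have V3 : eval s (Reg 3) = i by [].
have Vd : eval s (Defs.Sub (Get 0 (Add (Reg 3) (Const 1))) (Get 0 (Reg 3))) = #|neighbours G x|.
  by rewrite [eval _ _]/= E3 addn1 !Off.
apply: wp_seq; split; rewrite ?V3 ?Vd.
- exact: leq_trans Hi n_small.
- exact: leq_trans Cn n_small.
set s1 := set_arr _ _ _ _.
have In1 : input s1 by apply: input_frame In _ _ => // -[|[|a]].
have E31 : reg s1 3 = x by rewrite -Ex -E3.
have St1 : stack s1 q by case: St => S1 S2; split.
have n34 : 3 <> 4 by [].
apply: wp_seq; apply: (wp_push In1 E31 n34 St1 (size_stack Uq)) => s2 R2 A2 St2.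
have R23 : reg s2 3 = i by rewrite R2.
split; first by rewrite [eval _ _]/= R23 addn1 (leq_trans lt n_small).
have -> : eval s2 (Add (Reg 3) (Const 1)) = i.+1 by rewrite [eval _ _]/= R23 addn1.
have P1 : pushes s1 x = available t u v set0 x.
  by rewrite /pushes /available live0 in_set0 /s1 /= Ex eqxx.
rewrite P1 in St2.
have xq : x \notin q by rewrite Eq inE ltnn.
exists i.+1; split=> //.
  apply: input_frame In1 _ _ => [k Hk|a k Ha] /=.
    by rewrite -R2; [case: k Hk => [|[|[|k]]]|move=> Ek; rewrite Ek in Hk].
  by rewrite A2 // => Ea; rewrite Ea in Ha.
split.
- move=> z; rewrite ltnS leq_eqVlt => /orP[/eqP Ez|Hz] /=.
    have -> : z = x by apply: val_inj.
    by rewrite A2 // /s1 /= Ex eqxx.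
  rewrite A2 // /s1 /=; case: eqP => [Ez|_]; last exact: Dg.
  by rewrite Ez ltnn in Hz.
- move=> a k Ha a4 /=; rewrite A2 // /s1 /=; case: a Ha a4 => [|[|[|a]]] //= Ha a4.
  exact: Z.
exists (if available t u v set0 x then rcons q x else q); split.
- by case: St2 => S1 S2; split.
- by case: ifP => _; rewrite // rcons_uniq xq.
move=> z; rewrite [RHS]inE ltnS leq_eqVlt.
have -> : (val z == i) = (z == x) by rewrite -(inj_eq val_inj).
case: (eqVneq z x) => [->|zx] /=.
  by case: ifP; rewrite ?mem_rcons ?inE ?eqxx // (negPf xq).
have -> : (z \in if available t u v set0 x then rcons q x else q) = (z \in q).
  by case: ifP => _ //; rewrite mem_rcons in_cons (negPf zx).
by rewrite Eq inE.
Qed.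

Lemma eliminated0 : eliminated t u v set0.
Proof. by split; rewrite ?in_set0 // => z a b _; rewrite !in_set0. Qed.

Lemma init_end m s : init_inv m s -> eval s (Defs.Sub (Reg 0) (Reg 3)) = 0 ->
  invariant set0 s.
Proof.
move=> [i [Hi In E3 _ [Dg Z [q [St Uq Eq]]]]]; have [En _ _ _ _] := In.
rewrite [eval _ _]/= En E3 => /eqP; rewrite subn_eq0 => ni.
have lt x : x < i by apply: leq_trans (ltn_ord x) ni.
split.
- split=> //; first exact: eliminated0.
  + by move=> x; rewrite in_set0.
  + by split; rewrite ?Z //; split; rewrite Z.
  + by move=> x _; rewrite live0 Dg.
- by move=> x; rewrite in_set0 Z.
- by exists q; split=> // x; rewrite Eq inE lt.
Qed.

Lemma program_correct : runs W program (input_state L u v) (4000 * n)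
  (fun s => output s = ud (summarize t)).
Proof.
have I0 : init_inv n (input_state L u v).
  exists 0; split=> //; first exact: input_initial.
    by rewrite subn0.
  by split=> //; [case=> [|[|[]]]|exists [::]; split=> // z].
have [s1 [[In1 Rm1 St1] K1]] := runs_split (runs_while init_step init_end I0).
have [[Inp El Nd Nu Dg] _] := (In1, I).
have En : reg s1 0 = n by case: Inp.
have A : wp W (Assign 3 (Defs.Sub (Reg 0) (Const 2))) s1 (loop_inv (weight set0)).
  split; first by rewrite [eval _ _]/= En (leq_trans (leq_subr _ _) n_small).
  have -> : eval s1 (Defs.Sub (Reg 0) (Const 2)) = n - 2 by rewrite [eval _ _]/= En.
  exists set0; split; [|by rewrite setC0 cardsT card_ord|by []|by left].
  have In2 : input (set_reg s1 3 (n - 2)) by apply: input_frame Inp _ _ => [[|[|[|k]]]|].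
  by split.
have [s2 [I2 K2]] := runs_split (wp_runs A).
have [s3 [[w E5 E7] K3]] := runs_split (runs_while loop_step loop_end I2).
have B : wp W (Assign 0 (Get 7 (Reg 5))) s3 (fun s => output s = ud (summarize t)).
  rewrite [wp _ _ _ _]/= E5 E7; split=> //; apply: leq_trans n_small.
  apply: leq_trans (ud_le_size t) _.
  by rewrite [X in _ <= X]n_eq ltnW.
apply: runs_weaken (K1 _ _ _ (K2 _ _ _ (K3 _ _ _ (wp_runs B)))) _ (fun _ H => H).
set T := (X in X <= _); have -> : T = 104 * n + 4 + (4 + (502 * weight set0 + 2 + 3)).
  by rewrite /T.
apply: total_cost weight0 _; rewrite [X in _ <= X]n_eq.
by case: (t) Nt => // w' l r _; rewrite /= size_cat addnS.
Qed.

End Correctness.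

Theorem theorem3 :
  exists (prog : cmd) (C : nat),
  forall (n : nat) (G : graph 'I_n) (L : 'I_n -> seq 'I_n) (u v : 'I_n),
    maximal_outerplanar G ->
    vertices G = [set: 'I_n] ->
    adjacency_lists G L ->
    noncutting G [set u; v] ->
    exists (t : nat) (s : state),
      [/\ exec (C * n) prog (input_state L u v) t s,
          t <= C * n
        & rooted_umbrella_depth G u v (output s)].
Proof.
exists program, 4000 => n G L u v M VG HL NC.
have [t [W EG N]] := maximal_outerplanar_tree M NC; subst G.
(* One constant serves for time and word size, and the words actually required are much smaller. *)
have H8 : 8 * n <= 4000 * n by rewrite leq_mul2r orbT.
have [T [s [E B O]]] := program_correct W N VG HL H8.
exists T, s; split=> //; rewrite O; exact: rooted_umbrella_depth_tgraph.
Qed.
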